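(* Let $n\ge2$, let $\Omega \subset \mathbb{R}^n$ be a bounded Lipschitz domain and $\sigma \in \mathcal{M}(\partial \Omega)$. Then there exists a vector field $\mathbf{F} \in L^1(\mathbb{R}^n; \mathbb{R}^n)$ with distributional divergence $\operatorname{div} \mathbf{F} \in L^1(\mathbb{R}^n)$ such that $$\limsup_{\varepsilon \downarrow 0} \frac1{2\varepsilon} \int_{B_\varepsilon(\partial \Omega)} |\mathbf{F}| \,\mathrm{d} x \leq C |\sigma|(\partial \Omega)<\infty,$$ where $C$ is a constant depending only on $n$ and $\Omega$, and $$\langle \mathbf{F} \cdot \nu, \cdot \rangle_{\partial\Omega} = \sigma .$$ Moreover, if $\int_{\partial\Omega} \mathrm{d}\sigma=0$, then $\mathbf{F}$ can be chosen to be divergence-free in a neighbourhood of $\overline{\Omega}$.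
   Context: $\mathcal{M}(\partial\Omega)$ denotes the finite signed Radon measures on $\partial\Omega$ and $|\sigma|$ the total variation measure. $B_\varepsilon(\partial\Omega)=\{x\in\mathbb{R}^n:\operatorname{dist}(x,\partial\Omega)<\varepsilon\}$. Normal trace: for $\mathbf{F}\in L^1(\mathbb{R}^n;\mathbb{R}^n)$ whose distributional divergence is a finite signed Radon measure and a Borel set $E\subset\mathbb{R}^n$, the (weak) normal trace is the functional on bounded Lipschitz functions $\phi$ on $\mathbb{R}^n$ $$\langle \mathbf{F}\cdot\nu,\phi\rangle_{\partial E}:=\int_E\phi\,\mathrm{d}(\operatorname{div}\mathbf{F})+\int_E\mathbf{F}\cdot\nabla\phi\,\mathrm{d}x .$$ The identity $\langle \mathbf{F}\cdot\nu,\cdot\rangle_{\partial\Omega}=\sigma$ means $\langle \mathbf{F}\cdot\nu,\phi\rangle_{\partial\Omega}=\int_{\partial\Omega}\phi\,\mathrm{d}\sigma$ for all bounded Lipschitz $\phi$ on $\mathbb{R}^n$. *)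

(* Defs.v *)
From HB Require Import structures.
From mathcomp Require Import all_boot all_order all_algebra.
From mathcomp Require Import all_classical all_reals all_analysis measurable_realfun.

Set Implicit Arguments.
Unset Strict Implicit.
Unset Printing Implicit Defensive.

Import Order.TTheory GRing.Theory Num.Theory.
Import numFieldNormedType.Exports.

Local Open Scope classical_set_scope.
Local Open Scope ring_scope.

HB.instance Definition _ (R : realType) (n : nat) :=
  @isMeasurable.Build (sigma_display (@open 'rV[R]_n)) 'rV[R]_n
    <<s @open 'rV[R]_n >> (@sigma_algebra0 _ setT _)
    (@sigma_algebraC _ _) (@sigma_algebra_bigcup _ setT _).

Section borel_rV.
Context {R : realType}.

Lemma open_measurable_rV n (U : set 'rV[R]_n) : open U -> measurable U.
Proof. exact: sub_sigma_algebra. Qed.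

Lemma measurable_coord n (i : 'I_n) :
  measurable_fun [set: 'rV[R]_n] (fun v => v 0 i).
Proof.
apply: (measurability _ (RGenOpens.measurableE R)) => _ [_ [a [b ->] <-]].
rewrite setTI; apply: open_measurable_rV.
apply: open_comp; last exact: interval_open.
by move=> v _; exact: coord_continuous.
Qed.

Lemma measurable_fun_rV d (T : measurableType d) n (f : T -> 'rV[R]_n) :
  (forall i, measurable_fun setT (fun x => f x 0 i)) -> measurable_fun setT f.
Proof.
move=> mf; apply: (@measurability _ _ _ _ _ _ (@open 'rV[R]_n)) => //.
move=> _ [U oU <-]; rewrite setTI.
pose cube (p : 'rV[rat]_n * nat) : set 'rV[R]_n :=
  [set v | forall i, `|v 0 i - ratr (p.1 0 i)| < p.2.+1%:R^-1].
have mcube p : measurable (f @^-1` cube p).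
  have -> : f @^-1` cube p = \bigcap_(i in [set: 'I_n])
      ((fun x => f x 0 i) @^-1` ball (ratr (p.1 0 i) : R) p.2.+1%:R^-1).
    apply/seteqP; split => [x H i _|x H i]; first by rewrite /= /ball/= distrC; exact: H.
    by rewrite distrC; exact: H.
  apply: fin_bigcap_measurable => // i _; rewrite -[X in measurable X]setTI.
  by apply: mf => //; exact: measurable_ball.
have -> : U = \bigcup_(p in [set p | cube p `<=` U]) cube p.
  apply/seteqP; split => [v Uv|v [p /= pU]]; last exact: pU.
  have /nbhs_ballP[e /= e0 eU] : nbhs v U by exact: open_nbhs_nbhs.
  have [k ke] : exists k : nat, k.+1%:R^-1 < e / 2.
    have [k _ ke] := near_infty_natSinv_lt (PosNum (divr_gt0 e0 (ltr0n _ 2))).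
    by exists k; exact: ke (leqnn k).
  have k0 : 0 < k.+1%:R^-1 :> R by rewrite invr_gt0 ltr0n.
  have /choice[q Hq] : forall i : 'I_n, exists q : rat,
      `|v 0 i - ratr q| < k.+1%:R^-1.
    move=> i; have [|q] := @rat_in_itvoo _ (v 0 i - k.+1%:R^-1) (v 0 i + k.+1%:R^-1).
      by rewrite ltrD2l gtrN.
    rewrite in_itv/= => /andP[q1 q2]; exists q.
    by rewrite distrC ltr_distl q1 q2.
  exists (\row_i q i, k); last by move=> i; rewrite mxE; exact: Hq.
  move=> w /= Hw; apply: eU; split => // i j; rewrite ord1.
  have := Hw j; rewrite mxE => wq.
  rewrite /ball/= (splitr e) (le_lt_trans (ler_distD (ratr (q j)) _ _))//.
  by rewrite ltrD// (lt_trans _ ke)// distrC.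
rewrite preimage_bigcup; rewrite bigcup_mkcond; apply: countable_bigcupT_measurable => // p.
by case: ifPn.
Qed.

Definition cons_rV n (p : R * 'rV[R]_n) : 'rV[R]_n.+1 :=
  row_mx (p.1)%:M p.2 : 'rV[R]_(1 + n).

Definition uncons_rV n (v : 'rV[R]_n.+1) : R * 'rV[R]_n :=
  (v 0 0, rsubmx (v : 'rV[R]_(1 + n))).

Lemma cons_rVK n : cancel (@cons_rV n) (@uncons_rV n).
Proof.
move=> [x v]; rewrite /uncons_rV /cons_rV row_mxKr; congr pair.
transitivity ((x%:M : 'M[R]_1) 0 0); last by rewrite mxE eqxx.
rewrite -[RHS](row_mxEl _ v); suff -> : lshift n (0 : 'I_1) = 0 by [].
exact/val_inj.
Qed.

Lemma cons_rV0 n (p : R * 'rV[R]_n) : cons_rV p 0 0 = p.1.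
Proof. by have /(congr1 fst) := cons_rVK p. Qed.

Lemma cons_rVS n (p : R * 'rV[R]_n) i : cons_rV p 0 (lift ord0 i) = p.2 0 i.
Proof. by rewrite /cons_rV -(@rshift1 n) (@row_mxEr _ 1 1 n). Qed.

Lemma measurable_cons_rV n : measurable_fun setT (@cons_rV n).
Proof.
apply: measurable_fun_rV => i; rewrite /cons_rV.
rewrite -[i](@splitK 1 n i); case: (@fintype.split 1 n i) => j /=.
  rewrite (_ : (fun _ => _) = fst); first exact: measurable_fst.
  apply/funext => -[x v]; rewrite (@row_mxEl _ 1 1 n).
  by rewrite [j]ord1 mxE eqxx.
rewrite (_ : (fun _ => _) = (fun v : 'rV[R]_n => v 0 j) \o snd).
  by apply: measurableT_comp; [exact: measurable_coord|exact: measurable_snd].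
by apply/funext => -[x v]; rewrite (@row_mxEr _ 1 1 n).
Qed.

Lemma measurable_uncons_rV n : measurable_fun setT (@uncons_rV n).
Proof.
apply/measurable_fun_pairP; split; first exact: measurable_coord.
apply: measurable_fun_rV => i; rewrite /uncons_rV /comp/=.
under eq_fun do rewrite mxE.
exact: measurable_coord.
Qed.

End borel_rV.

Section lebesgue_rV.
Context {R : realType}.
Local Open Scope ereal_scope.

Lemma product_measure_sigma_finite d1 d2
    (T1 : measurableType d1) (T2 : measurableType d2)
    (m1 : {sigma_finite_measure set T1 -> \bar R})
    (m2 : {sigma_finite_measure set T2 -> \bar R}) :
  sigma_finite setT (m1 \x m2).
Proof.
have /sigma_finiteP[F [TF ndF Foo]] := sigma_finiteT m1.
have /sigma_finiteP[G [TG ndG Goo]] := sigma_finiteT m2.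
exists (fun n => F n `*` G n).
  rewrite -setXTT TF TG predeqE => -[x y]; split.
    move=> [/= [n _ Fnx] [k _ Gky]]; exists (maxn n k) => //; split.
    - by move: x Fnx; exact/subsetPset/ndF/leq_maxl.
    - by move: y Gky; exact/subsetPset/ndG/leq_maxr.
  by move=> [n _ []/= ? ?]; split; exists n.
move=> k; have [? ?] := Foo k; have [? ?] := Goo k.
split; first exact: measurableX.
by rewrite product_measure1E// lte_mul_pinfty// ge0_fin_numE.
Qed.

Section lebesgue_cons.
Variables (n : nat) (mu : {sigma_finite_measure set 'rV[R]_n -> \bar R}).

Definition lebesgue_cons : set 'rV[R]_n.+1 -> \bar R :=
  pushforward (@lebesgue_measure R \x mu) (@cons_rV R n).

Let mpre (A : set 'rV[R]_n.+1) :
  measurable A -> measurable (@cons_rV R n @^-1` A).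
Proof.
by move=> mA; rewrite -[X in measurable X]setTI; exact: measurable_cons_rV.
Qed.

Let lebesgue_cons0 : lebesgue_cons set0 = 0.
Proof. by rewrite /lebesgue_cons /pushforward preimage_set0 measure0. Qed.

Let lebesgue_cons_ge0 A : 0 <= lebesgue_cons A.
Proof. by rewrite /lebesgue_cons /pushforward; exact: measure_ge0. Qed.

Let lebesgue_cons_sigma_additive : semi_sigma_additive lebesgue_cons.
Proof.
move=> F mF tF mUF; rewrite /lebesgue_cons /pushforward preimage_bigcup.
apply: measure_semi_sigma_additive.
- by move=> k; exact: mpre.
- apply/trivIsetP => /= i j _ _ ij; rewrite -preimage_setI.
  by move/trivIsetP : tF => /(_ _ _ _ _ ij) ->//; rewrite preimage_set0.
- by rewrite -preimage_bigcup; exact: mpre.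
Qed.

HB.instance Definition _ := isMeasure.Build _ _ _ lebesgue_cons
  lebesgue_cons0 lebesgue_cons_ge0 lebesgue_cons_sigma_additive.

Let lebesgue_cons_sigma_finite : sigma_finite setT lebesgue_cons.
Proof.
have [F UF mF] : sigma_finite setT (@lebesgue_measure R \x mu).
  exact: product_measure_sigma_finite.
exists (fun k => @uncons_rV R n @^-1` F k).
  by rewrite -preimage_bigcup -UF preimage_setT.
move=> k; have [mFk Fk] := mF k; split.
  by rewrite -[X in measurable X]setTI; exact: measurable_uncons_rV.
rewrite /lebesgue_cons /pushforward -comp_preimage.
by rewrite (_ : _ \o _ = id) //; apply/funext => p; exact: cons_rVK.
Qed.

HB.instance Definition _ := Measure_isSigmaFinite.Build _ _ _ lebesgue_cons
  lebesgue_cons_sigma_finite.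

End lebesgue_cons.

Fixpoint lebesgue_rV n : {sigma_finite_measure set 'rV[R]_n -> \bar R} :=
  match n with
  | 0%N => dirac (0%R : 'rV[R]_0)
  | n'.+1 => lebesgue_cons (lebesgue_rV n')
  end.

Lemma lebesgue_rV_box n (A : 'I_n -> set R) : (forall i, measurable (A i)) ->
  lebesgue_rV n [set v : 'rV[R]_n | forall i, A i (v 0%R i)] =
  \prod_(i < n) lebesgue_measure (A i).
Proof.
elim: n A => [|n IHn] A mA.
  by rewrite big_ord0 /= diracE mem_set//= => -[].
rewrite big_ord_recl -IHn; last by move=> i; exact: mA.
rewrite /= /lebesgue_cons /pushforward.
rewrite -product_measure1E; [|exact: mA|]; last first.
  rewrite (_ : mkset _ = \bigcap_(i in [set: 'I_n])
      ((fun v : 'rV[R]_n => v 0%R i) @^-1` A (lift ord0 i))); last first.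
    by apply/seteqP; split => [v Av i _|v Av i]; exact: Av.
  apply: fin_bigcap_measurable => // i _; rewrite -[X in measurable X]setTI.
  exact: measurable_coord.
congr (product_measure1 _ _ _); apply/seteqP; split => -[x v] /=.
- move=> Av; split=> [|i].
    by have := Av ord0; rewrite cons_rV0.
  by have := Av (lift ord0 i); rewrite cons_rVS.
- move=> [Ax Av] i; case: (unliftP ord0 i) => [j|] ->.
    by rewrite cons_rVS; exact: Av.
  by rewrite cons_rV0.
Qed.

End lebesgue_rV.

Section euclidean.
Context {R : realType}.

Definition dotv n (u v : 'rV[R]_n) : R := \sum_(i < n) u 0 i * v 0 i.

(* The library norm of 'rV[R]_n is the sup norm, which induces the same
   topology, bounded sets and Lipschitz functions; lengths and distances are
   measured with the Euclidean norm. *)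
Definition enorm n (v : 'rV[R]_n) : R := Num.sqrt (dotv v v).

Definition topo_boundary (T : topologicalType) (A : set T) : set T :=
  closure A `\` interior A.

Definition eucl_dist n (A : set 'rV[R]_n) (x : 'rV[R]_n) : R :=
  inf [set enorm (x - y) | y in A].

Definition eucl_nbhd n (e : R) (A : set 'rV[R]_n) : set 'rV[R]_n :=
  [set x | eucl_dist A x < e].

(* Near each boundary point, in coordinates rotated by an orthogonal matrix O,
   A is the strict epigraph, in the k-th direction, of a Lipschitz function of
   the n - 1 other coordinates. *)
Definition lipschitz_boundary n (A : set 'rV[R]_n) : Prop :=
  forall x, topo_boundary A x ->
  exists (O : 'M[R]_n) (k : 'I_n) (gamma : 'rV[R]_n.-1 -> R) (r : R),
  [/\ O *m O^T = 1%:M, lipschitz gamma, 0 < r &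
      forall y, enorm (y - x) < r ->
        A y <-> gamma (col' k (y *m O)) < (y *m O) 0 k].

Definition bounded_lipschitz_domain n (A : set 'rV[R]_n) : Prop :=
  [/\ A !=set0, open A, connected A, bounded_set A & lipschitz_boundary A].

End euclidean.

Section calculus.
Context {R : realType} {n : nat}.
Implicit Types phi : 'rV[R]_n -> R.

Definition partial (i : 'I_n) phi : 'rV[R]_n -> R :=
  fun x => 'D_(delta_mx 0 i : 'rV[R]_n) phi x.

(* For a Lipschitz function this is its almost everywhere gradient: the partial
   derivatives are set to 0 where the difference quotients diverge. *)
Definition grad phi : 'rV[R]_n -> 'rV[R]_n := fun x => \row_i partial i phi x.

Fixpoint Ck (k : nat) phi : Prop :=
  continuous phi /\
  match k with
  | 0%N => True
  | k'.+1 => forall i : 'I_n,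
      (forall x, derivable phi x (delta_mx 0 i : 'rV[R]_n)) /\
      Ck k' (partial i phi)
  end.

Definition tsupport phi : set 'rV[R]_n := closure [set x | phi x != 0].

Definition test_function phi : Prop :=
  (forall k, Ck k phi) /\ compact (tsupport phi).

End calculus.

Section charges.
Context d (T : measurableType d) {R : realType} (s : {charge set T -> \bar R}).

Lemma hahn_ex : {PN : set T * set T | hahn_decomposition s PN.1 PN.2}.
Proof. by apply/cid; have [P [N PN]] := Hahn_decomposition s; exists (P, N). Qed.

(* By uniqueness of the Jordan decomposition, nothing below depends on the
   chosen Hahn decomposition on measurable sets. *)
Definition charge_tv : set T -> \bar R :=
  charge_variation (proj2_sig hahn_ex).

Definition charge_integral (D : set T) (f : T -> R) : R :=
  \int[jordan_pos (proj2_sig hahn_ex)]_(x in D) f x -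
  \int[jordan_neg (proj2_sig hahn_ex)]_(x in D) f x.

Definition concentrated_on (D : set T) : Prop :=
  forall A, measurable A -> A `&` D = set0 -> s A = 0%E.

End charges.

Section fields.
Context {R : realType} {n : nat}.
Local Notation leb := (@lebesgue_rV R n).
Implicit Types (F : 'rV[R]_n -> 'rV[R]_n) (mu : {charge set 'rV[R]_n -> \bar R}).

Definition L1_field F : Prop :=
  measurable_fun setT F /\ (\int[leb]_x (enorm (F x))%:E < +oo)%E.

Definition distributional_divergence F mu : Prop :=
  forall phi, test_function phi ->
    \int[leb]_x dotv (F x) (grad phi x) = - charge_integral mu setT phi.

Definition L1_charge mu : Prop :=
  exists2 g : 'rV[R]_n -> R, leb.-integrable setT (EFin \o g) &
    forall A, measurable A -> mu A = (\int[leb]_(x in A) (g x)%:E)%E.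

Definition divergence_free_in (U : set 'rV[R]_n) F : Prop :=
  forall phi, test_function phi -> tsupport phi `<=` U ->
    \int[leb]_x dotv (F x) (grad phi x) = 0.

Definition normal_trace F mu (E : set 'rV[R]_n) (phi : 'rV[R]_n -> R) : R :=
  charge_integral mu E phi + \int[leb]_(x in E) dotv (F x) (grad phi x).

Definition normal_trace_eq F mu (E : set 'rV[R]_n)
    (s : {charge set 'rV[R]_n -> \bar R}) : Prop :=
  forall phi, bounded_fun phi -> lipschitz phi ->
    normal_trace F mu E phi = charge_integral s (topo_boundary E) phi.

Definition boundary_mean F (E : set 'rV[R]_n) (e : R) : \bar R :=
  (((2 * e)^-1)%:E * \int[leb]_(x in eucl_nbhd e (topo_boundary E)) (enorm (F x))%:E)%E.

End fields.

(* Main.v *)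
From HB Require Import structures.
Require Import Defs.
From mathcomp Require Import all_boot all_order all_algebra.
From mathcomp Require Import all_classical all_reals all_analysis measurable_realfun.
From mathcomp Require Import ring lra.

Set Implicit Arguments.
Unset Strict Implicit.
Unset Printing Implicit Defensive.

Import Order.TTheory GRing.Theory Num.Theory.
Import numFieldNormedType.Exports.

Local Open Scope classical_set_scope.
Local Open Scope ring_scope.

(** The vector field is a superposition of flows along straight segments.

    Write [s = theta * m] with [m] the total variation of [s].  Near a boundary
    point, a Lipschitz domain contains a cone and its complement contains the
    opposite one ([boundary_cones]), so one box inside [Omega] and one box
    outside are seen, along segments, from all the nearby boundary points [y].
    Spreading [theta y * m] uniformly over the segments from the points of the
    inner box to [y], and then over those from [y] to the points of the outer
    box, gives a vector measure; at a fixed time, other than that of [y], the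
    position on the segment is uniform on a small box when [y] is given, so this vector measure has
    an integrable density ([superposition_density], [flow_field]).  Pairing the
    density with the gradient of a Lipschitz function amounts to integrating
    the increments along the segments; this uses Rademacher's theorem
    ([rademacher]) and the fact that a Lipschitz function of one variable is
    the integral of its derivative ([lipschitz_unit_FTC]).  So the inner field
    has divergence the uniform density of the inner box, with total mass the
    flux, minus [s], and the outer field has divergence [s] minus a density on
    the outer box: in the sum the singular part [s] cancels, and seen from
    [Omega] alone it remains as the normal trace.

    Because the cones have a fixed opening, a point moving along a segment away
    from [y] is at distance less than [e] from the boundary only up to the time
    [e / rho], where [rho] is the size of the boxes: hence the field has mass
    [O (e)] in the [e]-neighbourhood of the boundary ([cone_flow],
    [solvable_local]).  By compactness finitely many charts are
    enough ([compact_local_to_global], [solvable_boundary]).  Inside [Omega],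
    all the inner boxes are joined to a single reference box by flows that stay
    away from the boundary ([linked_connected]), so the divergence in [Omega] is
    [s (bd Omega)] times one uniform density.  It vanishes when
    [s (bd Omega) = 0]; since the outer boxes are at a positive distance from
    the closure of [Omega], the field is then divergence-free near it. *)

(** * Lebesgue measure and norm of row vectors *)

Section measurable_rV.
Context {R : realType} {n : nat} d (T : measurableType d).
Implicit Types f g : T -> 'rV[R]_n.

Lemma measurable_coord_comp f i :
  measurable_fun setT f -> measurable_fun setT (fun x => f x 0 i).
Proof.
by move=> mf; apply: (measurableT_comp (@measurable_coord R n i)).
Qed.

Lemma measurable_rVD f g : measurable_fun setT f -> measurable_fun setT g ->
  measurable_fun setT (fun x => f x + g x).
Proof.
move=> mf mg; apply: measurable_fun_rV => i; under eq_fun do rewrite mxE.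
by apply: measurable_funD; exact: measurable_coord_comp.
Qed.

Lemma measurable_rVZ (r : T -> R) f : measurable_fun setT r ->
  measurable_fun setT f -> measurable_fun setT (fun x => r x *: f x).
Proof.
move=> mr mf; apply: measurable_fun_rV => i; under eq_fun do rewrite mxE.
by apply: measurable_funM => //; exact: measurable_coord_comp.
Qed.

Lemma measurable_rVB f g : measurable_fun setT f -> measurable_fun setT g ->
  measurable_fun setT (fun x => f x - g x).
Proof.
move=> mf mg; apply: measurable_fun_rV => i; under eq_fun do rewrite !mxE.
by apply: measurable_funB; exact: measurable_coord_comp.
Qed.

End measurable_rV.

Section image_measure.
Context d d' (T : measurableType d) (T' : measurableType d') (R : realType).

(** The push-forward of a measure, carrying the measurability of the map so
    that its measure structure can be inferred. *)
Definition image_measure (m : {measure set T -> \bar R}) (f : T -> T')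
  of measurable_fun setT f : set T' -> \bar R := pushforward m f.

Section measure.
Variables (m : {measure set T -> \bar R}) (f : T -> T').
Hypothesis mf : measurable_fun setT f.

Let image0 : image_measure m mf set0 = 0%E.
Proof. by rewrite /image_measure measure0. Qed.

Let image_ge0 A : (0 <= image_measure m mf A)%E.
Proof. by rewrite /image_measure measure_ge0. Qed.

Let image_sigma_additive : semi_sigma_additive (image_measure m mf).
Proof. by apply: measure_semi_sigma_additive. Qed.

HB.instance Definition _ := isMeasure.Build _ _ _ (image_measure m mf)
  image0 image_ge0 image_sigma_additive.
End measure.

Variables (m : {finite_measure set T -> \bar R}) (f : T -> T').
Hypothesis mf : measurable_fun setT f.

Let image_finite : fin_num_fun (image_measure m mf).
Proof.
move=> A mA; apply: fin_num_measure; rewrite -[X in measurable X]setTI.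
exact: mf.
Qed.

HB.instance Definition _ := Measure_isFinite.Build _ _ _ (image_measure m mf)
  image_finite.

End image_measure.

Section lebesgue_rV_affine.
Context {R : realType}.

Definition box n (A : 'I_n -> set R) : set 'rV[R]_n :=
  [set v | forall i, A i (v 0 i)].

Lemma measurable_box n (A : 'I_n -> set R) :
  (forall i, measurable (A i)) -> measurable (box A).
Proof.
move=> mA.
rewrite (_ : box A = \bigcap_(i in [set: 'I_n])
    ((fun v : 'rV[R]_n => v 0 i) @^-1` A i)); last first.
  by apply/seteqP; split => [v Av i _|v Av i]; exact: Av.
apply: fin_bigcap_measurable => // i _; rewrite -[X in measurable X]setTI.
exact: measurable_coord.
Qed.

Lemma lebesgue_rV_boxE n (A : 'I_n -> set R) : (forall i, measurable (A i)) ->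
  lebesgue_rV n (box A) = (\prod_(i < n) lebesgue_measure (A i))%E.
Proof. exact: lebesgue_rV_box. Qed.

Lemma lebesgue_rV_box_lty n (A : 'I_n -> set R) :
  (forall i, measurable (A i)) -> (forall i, lebesgue_measure (A i) < +oo)%E ->
  (lebesgue_rV n (box A) < +oo)%E.
Proof.
move=> mA Aoo; rewrite lebesgue_rV_boxE//.
rewrite -ge0_fin_numE; last by apply: prode_ge0 => i _.
by apply: prode_fin_num => i _; rewrite ge0_fin_numE.
Qed.

(** Boxes are stable by intersection, and they generate the Borel sets because a
    map into row vectors is measurable as soon as its coordinates are. *)
Lemma lebesgue_rV_unique n (m : {measure set 'rV[R]_n -> \bar R}) :
  (forall A : 'I_n -> set R, (forall i, measurable (A i)) ->
     @lebesgue_rV R n (box A) = m (box A)) ->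
  forall X, measurable X -> @lebesgue_rV R n X = m X.
Proof.
move=> mE X mX.
pose G : set (set 'rV[R]_n) :=
  [set B | exists2 A : 'I_n -> set R, forall i, measurable (A i) & B = box A].
have Gm : G `<=` measurable by move=> _ [A mA ->]; exact: measurable_box.
pose C (k : nat) : set 'rV[R]_n := box (fun=> `[- k%:R, k%:R]%classic).
apply: (measure_unique G C) => //.
- apply/seteqP; split; last first.
    apply: smallest_sub => //; exact: sigma_algebra_measurable.
  have mG : measurable_fun setT (id : g_sigma_algebraType G -> 'rV[R]_n).
    apply: measurable_fun_rV => i _ B mB; rewrite setTI.
    apply: sub_sigma_algebra.
    exists (fun j => if j == i then B else setT); first by move=> j; case: ifP.
    apply/seteqP; split => [v Bv j /=|v /(_ i)]; last by rewrite eqxx.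
    by case: eqP => // ->.
  by move=> A mA; rewrite -(setTI A); exact: mG.
- move=> _ _ [A mA ->] [B mB ->]; exists (fun i => A i `&` B i).
    by move=> i; exact: measurableI.
  apply/seteqP; split => [v [Av Bv] i|v ABv]; first by split.
  by split => i; have [] := ABv i.
- by move=> k; exists (fun=> `[- k%:R, k%:R]%classic).
- rewrite -subTset => v _.
  exists (Num.truncn (\sum_i `|v 0 i|)).+1 => // i /=; rewrite in_itv/= -ler_norml.
  apply: (@le_trans _ _ (\sum_i `|v 0 i|)); last first.
    by apply/ltW; rewrite truncnS_gt.
  by rewrite (bigD1 i)//= lerDl sumr_ge0.
- by move=> _ [A mA ->]; exact: mE.
- move=> k; apply: lebesgue_rV_box_lty => // i; rewrite lebesgue_measure_itv/=.
  by case: ifP => // _; rewrite -EFinB ltry.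
Qed.

Lemma lebesgue_measure_affine (a c : R) (A : set R) : 0 < c -> measurable A ->
  (c%:E * lebesgue_measure ((fun x => (a + c * x)%R) @^-1` A) =
  lebesgue_measure A)%E.
Proof.
move=> c0 mA; have c00 : 0 <= c := ltW c0.
have mf : measurable_fun setT
    ((fun x => a + c * x) : measurableTypeR R -> measurableTypeR R).
  by apply: measurable_funD => //; exact: measurable_funM.
pose m : {measure set (measurableTypeR R) -> \bar R} :=
  mscale (NngNum c00) (image_measure (@lebesgue_measure R) mf).
rewrite [RHS](@lebesgue_measure_unique _ m)// => _ [[u v] _ <-].
rewrite /m /= /mscale/= /image_measure /pushforward /=.
rewrite (_ : _ @^-1` _ = `](u - a) / c, (v - a) / c]%classic); last first.
  apply/seteqP; split => x /=; rewrite !in_itv/=;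
    by rewrite ltr_pdivrMr// ler_pdivlMr// ltrBlDl lerBrDl [x * c]mulrC.
rewrite !lebesgue_measure_itv/= !lte_fin ltr_pM2r ?invr_gt0// ltrD2r.
case: ifP => _; last by rewrite mule0.
rewrite -!EFinB -EFinM; congr EFin; field; exact: lt0r_neq0.
Qed.

(** Both sides are measures of [A], so they need only be compared on boxes, where
    the claim splits into the coordinates. *)
Lemma lebesgue_rV_affine n (a : 'rV[R]_n) (c : R) (A : set 'rV[R]_n) :
  0 < c -> measurable A ->
  ((c ^+ n)%:E * lebesgue_rV n ((fun x => (a + c *: x)%R) @^-1` A) =
  lebesgue_rV n A)%E.
Proof.
move=> c0 mA; have cn0 : 0 <= c ^+ n by rewrite exprn_ge0// ltW.
have mf : measurable_fun setT (fun x : 'rV[R]_n => a + c *: x).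
  by apply: measurable_rVD => //; exact: measurable_rVZ.
pose m : {measure set 'rV[R]_n -> \bar R} :=
  mscale (NngNum cn0) (image_measure (lebesgue_rV n) mf).
rewrite [RHS](@lebesgue_rV_unique _ m)// => B mB.
rewrite /m /= /mscale/= /image_measure /pushforward /=.
rewrite (_ : _ @^-1` _ =
    box (fun i => (fun x : R => (a 0 i + c * x)%R) @^-1` B i)); last first.
  by apply/seteqP; split => x Bx i; have := Bx i; rewrite /= !mxE.
rewrite !lebesgue_rV_boxE//; last first.
  move=> i; rewrite -[X in measurable X]setTI.
  have mg : measurable_fun setT (fun x : R => a 0 i + c * x).
    by apply: measurable_funD => //; exact: measurable_funM.
  exact: mg.
rewrite (eq_bigr (fun i => c%:E * lebesgue_measure
  ((fun x : R => (a ord0 i + c * x)%R) @^-1` B i)))%E; last first.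
  by move=> i _; rewrite lebesgue_measure_affine.
rewrite big_split/=; congr (_ * _)%E.
by rewrite prodEFin prodr_const card_ord.
Qed.

Lemma lebesgue_rV_translation n (a : 'rV[R]_n) (A : set 'rV[R]_n) :
  measurable A -> lebesgue_rV n ((fun x => (x + a)%R) @^-1` A) = lebesgue_rV n A.
Proof.
move=> mA; rewrite -(@lebesgue_rV_affine _ a 1 A)// expr1n mul1e.
by congr (lebesgue_rV n (_ @^-1` A)); apply/funext => x; rewrite scale1r addrC.
Qed.

End lebesgue_rV_affine.
Section rV_norm.
Context {R : realType} {n : nat}.
Implicit Types v : 'rV[R]_n.

Lemma coord_le_norm v i : `|v 0 i| <= `|v|.
Proof.
rewrite [leRHS]/Num.norm/= mx_normrE.
exact: (@le_bigmax _ _ _ 0 (fun ij : 'I_1 * 'I_n => `|v ij.1 ij.2|) (0, i)).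
Qed.

Lemma norm_le_coord v (c : R) : 0 <= c -> (forall i, `|v 0 i| <= c) -> `|v| <= c.
Proof.
move=> c0 vc; rewrite [leLHS]/Num.norm/= mx_normrE.
by apply: bigmax_le => // -[i j] _ /=; rewrite ord1.
Qed.

Lemma norm_delta_mx_le1 (i : 'I_n) : `|delta_mx 0 i : 'rV[R]_n| <= 1.
Proof.
apply: norm_le_coord => // j; rewrite mxE eqxx /=.
by case: (j == i); rewrite ?normr1 ?normr0.
Qed.

End rV_norm.

(** * Bounded functions on sets of finite measure *)

Section bounded_integral.
Context d (T : measurableType d) (R : realType).
Variable mu : {measure set T -> \bar R}.
Implicit Types (A : set T) (f : T -> R).

Lemma ae_imply (P Q : T -> Prop) : (forall x, P x -> Q x) ->
  {ae mu, forall x, P x} -> {ae mu, forall x, Q x}.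
Proof.
by move=> PQ [N [mN N0 PN]]; exists N; split => // x nQ; apply: PN => /PQ.
Qed.

Lemma ae_and (P Q : T -> Prop) : {ae mu, forall x, P x} ->
  {ae mu, forall x, Q x} -> {ae mu, forall x, P x /\ Q x}.
Proof.
move=> nP nQ; apply: negligibleS (negligibleU nP nQ) => x /= /not_andP[]; tauto.
Qed.

Lemma integrable_bounded A f (M : R) : measurable A -> (mu A < +oo)%E ->
  measurable_fun setT f -> (forall x, `|f x| <= M) ->
  mu.-integrable A (EFin \o f).
Proof.
move=> mA Aoo mf fM; apply: measurable_bounded_integrable => //.
  exact: measurable_funTS.
exists M; split; first exact: num_real.
by move=> N MN x _ /=; rewrite (le_trans (fM x))// ltW.
Qed.

Lemma Rintegral_bound A f (M : R) : measurable A -> (mu A < +oo)%E ->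
  measurable_fun setT f -> (forall x, `|f x| <= M) ->
  `|\int[mu]_(x in A) f x| <= M * fine (mu A).
Proof.
move=> mA Aoo mf fM; have fi := integrable_bounded mA Aoo mf fM.
rewrite (le_trans (le_normr_Rintegral mA fi))// -Rintegral_cst//.
apply: le_Rintegral => // [|].
  exact: integrable_norm.
apply: (@integrable_bounded _ (cst M) `|M|) => //.
Qed.

Lemma bounded_convergence A (g : nat -> T -> R) f (M : R) :
  measurable A -> (mu A < +oo)%E ->
  (forall m, measurable_fun setT (g m)) -> measurable_fun setT f ->
  (forall m x, `|g m x| <= M) ->
  {ae mu, forall x, A x -> g m x @[m --> \oo] --> f x} ->
  \int[mu]_(x in A) g m x @[m --> \oo] --> \int[mu]_(x in A) f x.
Proof.
move=> mA Aoo mg mf gM gf.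
have Mi : mu.-integrable A (EFin \o cst M).
  exact: (@integrable_bounded _ (cst M) `|M|).
have H1 m : measurable_fun A (EFin \o g m).
  exact/measurable_EFinP/measurable_funTS.
have H2 : measurable_fun A (EFin \o f).
  exact/measurable_EFinP/measurable_funTS.
have H3 : {ae mu, forall x, A x -> (EFin \o g m) x @[m --> \oo] --> (f x)%:E}.
  apply: ae_imply gf => x gfx Ax.
  by apply/cvg_EFin; [exact: nearW|exact: gfx].
have H4 : {ae mu, forall x (m : nat),
    A x -> (`|(EFin \o g m) x| <= (EFin \o cst M) x)%E}.
  by apply: aeW => x m Ax; rewrite /= lee_fin.
have [fi _] := dominated_convergence mA H1 H2 H3 Mi H4.
by rewrite -(fineK (integrable_fin_num mA fi)) => /fine_cvg.
Qed.

End bounded_integral.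

(** * Lipschitz functions of one real variable *)

(** [lipschitz] hides the constant, on which the bounds below depend. *)
Definition bounded_slope (R : realType) (V : normedModType R) (k : R)
  (f : V -> R) := forall x y, `|f x - f y| <= k * `|x - y|.

Lemma bounded_slope_continuous (R : realType) (V : normedModType R) k
  (f : V -> R) : 0 < k -> bounded_slope k f -> continuous f.
Proof.
move=> k0 fk x; apply/cvgrPdist_lt => e e0.
have ek0 : 0 < e / k by rewrite divr_gt0.
have : \forall y \near x, `|x - y| < e / k by exact: cvgr_dist_lt.
apply: filterS => y xy; apply: (le_lt_trans (fk x y)).
by rewrite mulrC -ltr_pdivlMr.
Qed.

Lemma lebesgue_unit_itv (R : realType) :
  lebesgue_measure (`[0, 1]%classic : set R) = 1%E.
Proof. by rewrite lebesgue_measure_itv/= lte01 sube0. Qed.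

Section lipschitz_unit_interval.
Context {R : realType}.
Local Notation leb := (@lebesgue_measure R).
Variables (g : R -> R) (k : R).
Hypotheses (k0 : 0 < k) (gk : bounded_slope k g).

Let G x := g x + k * x.
Let H x := k * x - g x.

Let cg : continuous g. Proof. exact: bounded_slope_continuous gk. Qed.

Let ck : continuous (fun x : R => k * x).
Proof. by move=> x; apply: cvgM; [exact: cvg_cst|exact: cvg_id]. Qed.

Let G_nd : nondecreasing G.
Proof.
move=> x y xy; rewrite /G -lerBrDr addrAC -lerBlDl.
have := gk x y; rewrite [`|x - y|]distrC [`|y - x|]ger0_norm ?subr_ge0//.
by move=> /ler_normlP[]; nra.
Qed.

Let H_nd : nondecreasing H.
Proof.
move=> x y xy; rewrite /H.
have := gk x y; rewrite [`|x - y|]distrC [`|y - x|]ger0_norm ?subr_ge0//.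
by move=> /ler_normlP[]; nra.
Qed.

Let G_rc : right_continuous G.
Proof. by apply: right_continuousW => x; apply: cvgD; [exact: cg|exact: ck]. Qed.

Let H_rc : right_continuous H.
Proof. by apply: right_continuousW => x; apply: cvgB; [exact: ck|exact: cg]. Qed.

HB.instance Definition _ := isCumulative.Build R _ R G G_nd G_rc.
HB.instance Definition _ := isCumulative.Build R _ R H H_nd H_rc.

Let nuG : {measure set (measurableTypeR R) -> \bar R} :=
  lebesgue_stieltjes_measure (G : cumulative R R).
Let nuH : {measure set (measurableTypeR R) -> \bar R} :=
  lebesgue_stieltjes_measure (H : cumulative R R).

Let stieltjes_oc (f : cumulative R R) (a b : R) : a <= b ->
  lebesgue_stieltjes_measure f `]a, b]%classic = (f b - f a)%:E.
Proof.
move=> ab; rewrite /lebesgue_stieltjes_measure/= /measure_extension/=.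
rewrite measurable_mu_extE/=.
  by rewrite wlength_itv_bnd.
exact: is_ocitv.
Qed.

Let nuG_oc (a b : R) : a <= b -> nuG `]a, b]%classic = (G b - G a)%:E.
Proof. exact: stieltjes_oc. Qed.

Let nuH_oc (a b : R) : a <= b -> nuH `]a, b]%classic = (H b - H a)%:E.
Proof. exact: stieltjes_oc. Qed.

(** [g] cancels from the sum of the two distribution functions; in particular
    each of the two measures is dominated by the Lebesgue measure. *)
Let stieltjes_add (A : set R) : measurable A ->
  (nuG A + nuH A = (2 * k)%:E * leb A)%E.
Proof.
move=> mA; have k20 : 0 <= (2 * k)^-1 by rewrite invr_ge0 mulr_ge0// ltW.
pose m : {measure set (measurableTypeR R) -> \bar R} :=
  mscale (NngNum k20) (measure_add nuG nuH).
have mE B : m B = (((2 * k)^-1)%:E * (nuG B + nuH B))%E.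
  by rewrite -measure_addE.
rewrite [leb A](@lebesgue_measure_unique _ m)//; last first.
  move=> _ [[a b] _ <-]; rewrite mE/=.
  have [ba|ab] := leP b a.
    rewrite set_itv_ge; last by rewrite bnd_simp -leNgt.
    by rewrite [nuG _]measure0 [nuH _]measure0 adde0 mule0; exact: measure0.
  rewrite lebesgue_measure_itv/= lte_fin ab nuG_oc ?nuH_oc ?ltW//.
  rewrite -!EFinB -EFinD -EFinM /= /G /H; congr EFin; field; exact: lt0r_neq0.
rewrite mE muleA -EFinM mulfV ?mul1e//.
by rewrite mulf_neq0// lt0r_neq0.
Qed.

Let D : set (measurableTypeR R) := `]0 : R, 1]%classic.
Let mD : measurable D. Proof. exact: measurable_itv. Qed.

Let nuGD : (nuG D < +oo)%E.
Proof. by rewrite /D nuG_oc// ltry. Qed.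

Let nu : {finite_measure set (measurableTypeR R) -> \bar R} := mfrestr mD nuGD.

Let nu_leb : nu `<< leb.
Proof.
apply/null_content_dominatesP => A mA A0.
have : nuG A = 0%E.
  apply/eqP; rewrite eq_le measure_ge0 andbT.
  by rewrite (@le_trans _ _ (nuG A + nuH A)%E) ?leeDl// stieltjes_add// A0 mule0.
move=> nuA0; apply/eqP; rewrite eq_le measure_ge0 andbT -nuA0.
rewrite /nu /= /mfrestr/= /mrestr le_measure ?inE//; exact: measurableI.
Qed.

(** A Lipschitz function is differentiable almost everywhere and is the
    integral of its derivative: after adding a linear term it becomes the
    distribution function of a measure with bounded density, to which the
    Lebesgue differentiation theorem applies. *)
Lemma lipschitz_unit_FTC : exists f : R -> R,
  [/\ leb.-integrable setT (EFin \o f),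
      {ae leb, forall x : R, 0 < x < 1 -> is_derive x 1 g (f x)} &
      \int[leb]_(x in `[0, 1]) f x = g 1 - g 0].
Proof.
have cnu_leb : charge_of_finite_measure nu `<< leb := nu_leb.
pose f : R -> R := fine \o Radon_Nikodym (charge_of_finite_measure nu) leb.
have fE : EFin \o f = Radon_Nikodym (charge_of_finite_measure nu) leb.
  by apply/funext => x; rewrite /f /= fineK// Radon_Nikodym_fin_num.
have fi : leb.-integrable setT (EFin \o f).
  by rewrite fE; exact: Radon_Nikodym_integrable.
have nuE A : measurable A -> (\int[leb]_(x in A) (f x)%:E)%E = nu A.
  move=> mA; rewrite [RHS](Radon_Nikodym_integral cnu_leb mA) -fE.
  exact: eq_integral.
pose I : set R := `[0, 1]%classic.
have mI : measurable I by exact: measurable_itv.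
pose K x : R := k * \1_I x.
have ki : leb.-integrable setT (EFin \o K).
  rewrite (_ : _ \o _ = (fun x => k%:E * (EFin \o \1_I) x)%E)//.
  by apply: integrableZl => //; exact: integrable_indic_itv.
have nuI : \int[leb]_(x in I) f x = G 1 - G 0.
  rewrite /Rintegral nuE//= /mfrestr/= /mrestr setIidr; last first.
    by move=> x; rewrite /D /I /= !in_itv/= => /andP[/ltW -> ->].
  by rewrite nuG_oc.
exists (fun x => f x - K x); split => //.
- rewrite (_ : _ \o _ = (EFin \o f) \- (EFin \o K))%E//.
  exact: integrableB.
- have fi_y (y : R) : leb.-integrable `]-oo, y] (EFin \o f).
    exact: integrableS fi.
  have := @integrable_locally _ f setT measurableT fi.
  rewrite patch_setT => /(FTC1Ny fi_y); apply: filterS.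
    exact: (ae_filter_ringOfSetsType leb).
  move=> x [dF F'] /andP[x0 x1].
  have dG : is_derive x 1 G (f x).
    rewrite -F' derive1E.
    rewrite (_ : G = (fun y => G y - G 0) + cst (G 0)); last first.
      by apply/funext => y; rewrite fctE subrK.
    rewrite -[X in is_derive _ _ _ X]addr0; apply: is_deriveD.
    apply: near_eq_is_derive (derivableP dF).
    have : \forall y \near x, y \in `]0, 1[.
      by apply: near_in_itvoo; rewrite in_itv/= x0 x1.
    apply: filterS => y; rewrite in_itv/= => /andP[y0 y1].
    rewrite /Rintegral nuE//= /mfrestr/= /mrestr.
    rewrite (_ : _ `&` _ = `]0, y]%classic).
      by rewrite nuG_oc// ltW.
    apply/seteqP; split => z; rewrite /D /= !in_itv/=.
      by move=> [-> /andP[->]].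
    by move=> /andP[-> zy]; rewrite zy (le_trans zy (ltW y1)).
  have -> : g = G - (fun x => k * x).
    by apply/funext => y; rewrite fctE /= /G addrK.
  apply: is_deriveB; rewrite /K indicE mem_set/=; last first.
    by rewrite /I /= in_itv/= !ltW.
  rewrite -[k * _]/(k *: 1); exact: is_deriveZ.
- rewrite RintegralB//.
  + rewrite nuI /K RintegralZl//; last first.
      by apply: integrableS (integrable_indic_itv _ _ _ _).
    rewrite -[\int[_]_(_ in _) _]/(\int[leb]_(x in I) \1_I x).
    rewrite /Rintegral integral_indic// setIid [X in fine X]lebesgue_unit_itv.
    by rewrite /G /=; ring.
  + exact: integrableS fi.
  + exact: integrableS ki.
Qed.

End lipschitz_unit_interval.

(** * Directional derivatives of Lipschitz functions *)

Section directional_derivative.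
Context {R : realType} {n : nat}.
Local Notation E := 'rV[R]_n.
Local Notation leb := (@lebesgue_rV R n).

Lemma continuous_measurable_rV (f : E -> R) :
  continuous f -> measurable_fun setT f.
Proof.
move=> cf; apply: (measurability _ (RGenOpens.measurableE R)).
move=> _ [_ [a [b ->] <-]]; rewrite setTI; apply: open_measurable_rV.
by apply: open_comp; [move=> x _; exact: cf|exact: interval_open].
Qed.

Definition diff_quot (f : E -> R) (v x : E) (h : R) : R :=
  h^-1 * (f (h *: v + x) - f x).

Lemma diff_quot_cvgP f v x (l : R) :
  diff_quot f v x h @[h --> 0^'] --> l <-> is_derive x v f l.
Proof.
split=> [fl|[df <-]]; last exact: df.
by apply: DeriveDef; [apply/cvg_ex; exists l|apply/cvg_lim].
Qed.

Lemma is_derive_line (f : E -> R) (x v : E) (t l : R) :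
  is_derive t 1 (fun s => f (x + s *: v)) l <-> is_derive (x + t *: v) v f l.
Proof.
have dqE h : h^-1 *: (((fun s => f (x + s *: v)) \o shift t) (h *: 1) -
    f (x + t *: v)) = diff_quot f v (x + t *: v) h.
  by rewrite /diff_quot /= scalerDl [h *: 1]mulr1 addrCA.
split=> [[dg <-]|/diff_quot_cvgP fl].
  by apply/diff_quot_cvgP; rewrite -(funext dqE); exact: dg.
rewrite -(funext dqE) in fl.
by apply: DeriveDef; [apply/cvg_ex; exists l|apply/cvg_lim].
Qed.

Lemma natSinv_lt (e : R) : 0 < e -> exists m : nat, m.+1%:R^-1 < e.
Proof.
move=> e0; have [m _ me] := near_infty_natSinv_lt (PosNum e0).
by exists m; exact: me (leqnn m).
Qed.

Lemma natSinv_cvg_dnbhs : m.+1%:R^-1 @[m --> \oo] --> (0 : R)^'.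
Proof.
move=> A A0; have : \forall x \near (0 : R)^', A x by exact: A0.
rewrite near_withinE => /nbhs_ballP[d /= d0 dA].
have := near_infty_natSinv_lt (PosNum d0); apply: filterS => m md.
apply: dA; last by rewrite gt_eqF// invr_gt0 ltr0n.
by rewrite /ball/= sub0r normrN gtr0_norm ?invr_gt0.
Qed.

Section lipschitz.
Variables (f : E -> R) (k : R).
Hypotheses (k0 : 0 < k) (fk : bounded_slope k f).

Let cf : continuous f. Proof. exact: bounded_slope_continuous fk. Qed.

Lemma diff_quot_continuous v x (h : R) : h != 0 ->
  {for h, continuous (diff_quot f v x)}.
Proof.
move=> h0; apply: cvgM; first exact: inv_continuous.
apply: cvgB; last exact: cvg_cst.
apply: continuous_comp; last exact: cf.
by apply: cvgD; [apply: cvgZr_tmp; exact: cvg_id|exact: cvg_cst].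
Qed.

Lemma measurable_diff_quot v h : measurable_fun setT (diff_quot f v ^~ h).
Proof.
have mf := continuous_measurable_rV cf.
apply: measurable_funM => //; apply: measurable_funB => //.
by apply: (measurableT_comp mf); exact: measurable_rVD.
Qed.

Lemma diff_quot_bound v x h : `|diff_quot f v x h| <= k * `|v|.
Proof.
have [->|h0] := eqVneq h 0.
  by rewrite /diff_quot invr0 mul0r normr0 mulr_ge0// ltW.
rewrite /diff_quot normrM normfV ler_pdivrMl ?normr_gt0//.
by rewrite (le_trans (fk _ _))// addrK normrZ mulrCA.
Qed.

Definition rational_cauchy v x := forall m : nat, exists N : nat,
  forall p : rat * rat, 0 < `|ratr p.1 : R| < N.+1%:R^-1 ->
    0 < `|ratr p.2 : R| < N.+1%:R^-1 ->
    `|diff_quot f v x (ratr p.1) - diff_quot f v x (ratr p.2)| <= m.+1%:R^-1.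

(** Difference quotients are continuous in the step, so the Cauchy criterion
    may be tested on rational steps; this makes differentiability a Borel
    condition on the point. *)
Lemma derivableP_rational v x : derivable f x v <-> rational_cauchy v x.
Proof.
split => [/cvg_ex[/= l fl] m|xc].
  have m0 : 0 < m.+1%:R^-1 / 2 :> R by rewrite divr_gt0// invr_gt0 ltr0n.
  have /cvgrPdist_lt/(_ _ m0) := fl.
  rewrite near_withinE => /nbhs_ballP[d /= d0 df].
  have [N Nd] := natSinv_lt d0; exists N => -[p q] /= /andP[p0 pN] /andP[q0 qN].
  have H r : 0 < `|r| -> `|r| < N.+1%:R^-1 ->
      `|l - diff_quot f v x r| < m.+1%:R^-1 / 2.
    move=> r0 rN; apply: df; last by rewrite -normr_gt0.
    by rewrite /ball/= sub0r normrN (lt_trans rN).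
  rewrite (splitr m.+1%:R^-1) (le_trans (ler_distD l _ _))// lerD//.
    by rewrite distrC ltW// H.
  by rewrite ltW// H.
apply/cauchy_cvgP; apply: cauchy_exP => e e0.
have [m me] := natSinv_lt e0; have [N xN] := xc m.
have N0 : 0 < N.+1%:R^-1 :> R by rewrite invr_gt0 ltr0n.
have [p] := rat_in_itvoo N0; rewrite in_itv/= => /andP[p0 pN].
exists (diff_quot f v x (ratr p)).
suff : \forall h \near (0 : R)^',
  ball (diff_quot f v x (ratr p)) e (diff_quot f v x h) by [].
rewrite near_withinE; apply/nbhs_ballP; exists N.+1%:R^-1 => // h.
rewrite /ball/= sub0r normrN => hN h0.
apply: le_lt_trans me; rewrite leNgt; apply/negP => mh.
pose O := [set h : R | h != 0 /\ `|h| < N.+1%:R^-1 /\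
  m.+1%:R^-1 < `|diff_quot f v x (ratr p) - diff_quot f v x h|].
have Oh : nbhs h O.
  apply: filterI; first by apply: open_nbhs_nbhs; split; [exact: open_neq|].
  apply: filterI.
    apply/nbhs_ballP; exists (N.+1%:R^-1 - `|h|) => /=; first by rewrite subr_gt0.
    move=> y; rewrite /ball/= ltrBrDl; apply: le_lt_trans.
    by rewrite -[in leLHS](subrKC h y) (le_trans (ler_normD _ _))// distrC.
  have cD : `|diff_quot f v x (ratr p) - diff_quot f v x h'| @[h' --> h] -->
      `|diff_quot f v x (ratr p) - diff_quot f v x h|.
    apply: cvg_norm; apply: cvgB; first exact: cvg_cst.
    exact: diff_quot_continuous.
  exact: (cvgr_gt _ cD).
have [r [/= Or [q _ qr]]] : O° `&` range ratr !=set0.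
  apply: dense_rat; last exact: open_interior.
  by exists h; exact: Oh.
have [r0 [rN mr]] := interior_subset Or.
move: mr; rewrite ltNge -qr => /negP; apply.
apply: (xN (p, q)) => /=; first by rewrite normr_gt0 gt_eqF//= gtr0_norm.
by rewrite normr_gt0 qr r0.
Qed.

Lemma measurable_derivable v : measurable [set x | derivable f x v].
Proof.
pose good (m N : nat) (p : rat * rat) : set E := [set x |
  0 < `|ratr p.1 : R| < N.+1%:R^-1 -> 0 < `|ratr p.2 : R| < N.+1%:R^-1 ->
  `|diff_quot f v x (ratr p.1) - diff_quot f v x (ratr p.2)| <= m.+1%:R^-1].
have mgood m N p : measurable (good m N p).
  have [H1|H1] := boolP (0 < `|ratr p.1 : R| < N.+1%:R^-1); last first.
    rewrite (_ : good m N p = setT)//.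
    by apply/seteqP; split => // x _ /= H; rewrite H in H1.
  have [H2|H2] := boolP (0 < `|ratr p.2 : R| < N.+1%:R^-1); last first.
    rewrite (_ : good m N p = setT)//.
    by apply/seteqP; split => // x _ /= _ H; rewrite H in H2.
  rewrite (_ : good m N p = (fun x => `|diff_quot f v x (ratr p.1) -
      diff_quot f v x (ratr p.2)|) @^-1` [set` `]-oo, m.+1%:R^-1]]); last first.
    apply/seteqP; split => x /=; rewrite in_itv/=; first by move/(_ H1 H2).
    by move=> ? _ _.
  rewrite -[X in measurable X]setTI.
  have mg : measurable_fun setT (fun x => `|diff_quot f v x (ratr p.1) -
      diff_quot f v x (ratr p.2)|).
    apply: measurableT_comp => //.
    by apply: measurable_funB; exact: measurable_diff_quot.
  by apply: mg => //; exact: measurable_itv.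
rewrite (_ : mkset _ = \bigcap_m \bigcup_N \bigcap_p good m N p); last first.
  apply/seteqP; split => [x /derivableP_rational xc m _|x xc].
    by have [N xN] := xc m; exists N => // p _; exact: xN.
  apply/derivableP_rational => m; have [N _ xN] := xc m I.
  by exists N => p; exact: xN.
apply: bigcapT_measurable => m; apply: bigcupT_measurable => N.
rewrite -[X in measurable X]setCK setC_bigcap; apply: measurableC.
by apply: countable_bigcupT_measurable => // p; exact: measurableC.
Qed.

(** Where the derivative exists it is the limit of measurable difference
    quotients, and elsewhere it is [0] by convention. *)
Lemma measurable_derive v : measurable_fun setT (fun x => 'D_v f x).
Proof.
pose h (m : nat) (x : E) : R :=
  \1_[set x | derivable f x v] x * diff_quot f v x m.+1%:R^-1.
apply: (@measurable_fun_cvg _ _ _ _ h) => [m|x _].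
  apply: measurable_funM; last exact: measurable_diff_quot.
  by apply: measurable_indic; exact: measurable_derivable.
rewrite /h; have [xv|xv] := pselect (derivable f x v).
  rewrite indicE mem_set//; under eq_fun do rewrite mul1r.
  have /diff_quot_cvgP xl := derivableP xv.
  exact: (cvg_comp _ _ natSinv_cvg_dnbhs xl).
rewrite indicE memNset//; under eq_fun do rewrite mul0r.
by rewrite /derive dvgP//; exact: cvg_cst.
Qed.

Lemma derive_bound v x : `|'D_v f x| <= k * `|v|.
Proof.
have [xv|xv] := pselect (derivable f x v); last first.
  by rewrite /derive dvgP// normr0 mulr_ge0// ltW.
have /diff_quot_cvgP/cvg_norm xl := derivableP xv.
rewrite leNgt; apply/negP => lt_kD.
have lt_near : \forall h \near (0 : R)^', k * `|v| < `|diff_quot f v x h|.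
  exact: (cvgr_gt _ xl).
have [h] := @filter_ex _ _ (Proper_dnbhs_numFieldType 0) _ lt_near.
by rewrite ltNge diff_quot_bound.
Qed.

End lipschitz.
End directional_derivative.

(** * Rademacher's theorem *)

Section rademacher.
Context {R : realType} {n : nat}.
Local Notation E := 'rV[R]_n.
Local Notation leb := (@lebesgue_rV R n).

(** A set that meets every unit segment of a fixed direction in a null set is
    null: average its translates along the segment and exchange integrals. *)
Lemma null_along_segments (B : set E) (v : E) : measurable B ->
  (forall x, lebesgue_measure
     [set t : R | 0 <= t <= 1 /\ B (x + t *: v)] = 0%E) ->
  leb B = 0%E.
Proof.
move=> mB B0.
pose S : set (R * E) := [set p | 0 <= p.1 <= 1 /\ B (p.2 + p.1 *: v)].
have mS : measurable S.
  rewrite (_ : S = fst @^-1` (`[0 : R, 1]%classic) `&`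
      (fun p => p.2 + p.1 *: v) @^-1` B); last first.
    by apply/seteqP; split => p; rewrite /S /= in_itv.
  apply: measurableI; rewrite -[X in measurable X]setTI.
    by apply: measurable_fst => //; exact: measurable_itv.
  have mg : measurable_fun setT (fun p : R * E => p.2 + p.1 *: v).
    apply: measurable_rVD; first exact: measurable_snd.
    by apply: measurable_rVZ => //; exact: measurable_fst.
  exact: mg.
have : (lebesgue_measure \x leb)%E S = (lebesgue_measure \x^ leb)%E S.
  by apply: product_measure_unique => // A1 A2 mA1 mA2; exact: product_measure2E.
rewrite /product_measure1 /product_measure2.
rewrite [RHS]integral0_eq; last first.
  move=> y _ /=; rewrite -[RHS](B0 y); congr (lebesgue_measure _).
  by apply/seteqP; split => t; rewrite /ysection /= inE.
rewrite (_ : (\int[_]_x _)%E =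
    (\int[lebesgue_measure]_(t in `[0%R : R, 1%R]) leb B)%E); last first.
  rewrite [RHS]integral_mkcond; apply: eq_integral => t _; rewrite patchE /=.
  case: ifPn; rewrite ?inE ?notin_setE/= in_itv/= => tI.
    rewrite -(lebesgue_rV_translation (t *: v) mB); congr (leb _).
    apply/seteqP; split => y; rewrite /xsection /= inE; first by case.
    by move=> ?; split.
  rewrite (_ : xsection S t = set0) ?measure0//.
  by apply/seteqP; split => y //; rewrite /xsection /= inE => -[].
rewrite integral_cst ?measurable_itv// [X in (_ * X)%E]lebesgue_unit_itv.
by rewrite mule1.
Qed.

Lemma ae_derivable (f : E -> R) (k : R) (v : E) : 0 < k -> bounded_slope k f ->
  {ae leb, forall x, derivable f x v}.
Proof.
move=> k0 fk; apply/negligibleP.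
  by apply: measurableC; exact: measurable_derivable fk _.
apply: (@null_along_segments _ v).
  by apply: measurableC; exact: measurable_derivable fk _.
move=> x; pose g (t : R) := f (x + t *: v).
have kv0 : 0 < k * `|v| + 1 by rewrite ltr_wpDl// mulr_ge0// ltW.
have gk : bounded_slope (k * `|v| + 1) g.
  move=> s t; rewrite (le_trans (fk _ _))//.
  rewrite opprD addrACA subrr add0r -scalerBl normrZ mulrDl mul1r.
  by rewrite [`|s - t| * _]mulrC mulrA lerDl.
have [h [_ gh _]] := lipschitz_unit_FTC kv0 gk.
have mA : measurable
    [set t : R | 0 <= t <= 1 /\ (~` [set x | derivable f x v]) (x + t *: v)].
  rewrite (_ : mkset _ = `[0 : R, 1]%classic `&`
      (fun t => x + t *: v) @^-1` (~` [set x | derivable f x v])); last first.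
    by apply/seteqP; split => t; rewrite /= in_itv.
  apply: measurableI; first exact: measurable_itv.
  have mg : measurable_fun setT (fun t : R => x + t *: v).
    by apply: measurable_rVD => //; exact: measurable_rVZ.
  rewrite -[X in measurable X]setTI; apply: mg => //.
  by apply: measurableC; exact: measurable_derivable fk _.
apply/negligibleP => //.
have N1 (r : R) : lebesgue_measure.-negligible [set r].
  by apply/negligibleP => //; exact: lebesgue_measure_set1.
apply: negligibleS (negligibleU (negligibleU (N1 0) (N1 1)) gh).
move=> t [t01 fxt]; apply: contrapT => /= /not_orP[/not_orP[t0 t1]].
move=> /contrapT tD; apply: fxt => /=.
have t01' : 0 < t < 1.
  by move: t01 => /andP[]; rewrite !le_eqVlt => /predU1P[/esym//|->] /predU1P[].
by have /is_derive_line[] := tD t01'.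
Qed.

(** Open sets form a generating family stable by intersection, so they detect
    the vanishing of a signed measure. *)
Lemma charge_eq0_open (c : {charge set E -> \bar R}) :
  (forall U, open U -> c U = 0%E) -> forall A, measurable A -> c A = 0%E.
Proof.
move=> c0 A mA; have [P [N PN]] := Hahn_decomposition c.
have cE B : measurable B -> c B = (jordan_pos PN B - jordan_neg PN B)%E.
  by move=> mB; rewrite [LHS](jordan_decomp PN mB) /cadd/= cscaleN1.
rewrite cE//; suff -> : jordan_pos PN A = jordan_neg PN A.
  by rewrite subee// fin_num_measure.
apply: (measure_unique (@open E) (fun=> setT)) => //.
- exact: openI.
- by move=> _; exact: openT.
- by apply/seteqP; split => // x _; exists 0%N.
- move=> U oU; have := c0 _ oU; have mU := open_measurable_rV oU.
  rewrite cE// => /eqP; rewrite sube_eq ?fin_num_measure ?fin_num_adde_defr//.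
  by rewrite add0e => /eqP.
- by move=> _; rewrite -ge0_fin_numE ?fin_num_measure.
Qed.

Lemma lebesgue_rV_ball_lty (x : E) (r : R) : (leb (ball x r) < +oo)%E.
Proof.
have mI i : measurable (`[x 0 i - r, x 0 i + r]%classic : set R).
  exact: measurable_itv.
have moI : measurable (box (fun i => `[x 0 i - r, x 0 i + r]%classic)).
  exact: measurable_box.
apply: le_lt_trans (lebesgue_rV_box_lty mI _); last first.
  by move=> i; rewrite lebesgue_measure_itv/=; case: ifP => // _; rewrite -EFinB ltry.
apply: le_measure; rewrite ?inE//.
  by apply: open_measurable_rV; exact: ball_open.
move=> y xy i /=; rewrite in_itv/= -ler_distl distrC ltW//.
by have [_ /(_ 0 i)] := xy.
Qed.

(** The restrictions of [T] to balls are densities of signed measures, to which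
    [charge_eq0_open] applies. *)
Lemma ae_eq0_open (T : E -> R) (M : R) :
  measurable_fun setT T -> (forall x, `|T x| <= M) ->
  (forall U, open U -> (leb U < +oo)%E -> \int[leb]_(x in U) T x = 0) ->
  {ae leb, forall x, T x = 0}.
Proof.
move=> mT TM T0.
pose B (N : nat) : set E := ball 0 N.+1%:R.
have oB N : open (B N) by exact: ball_open.
have mB N : measurable (B N) by exact: open_measurable_rV.
have BN N : {ae leb, forall x, B N x -> T x = 0}.
  have TiB : leb.-integrable (B N) (EFin \o T).
    exact: (integrable_bounded (mB N) (lebesgue_rV_ball_lty _ _) mT TM).
  have Ti : leb.-integrable setT (EFin \o (T \_ (B N))).
    by move/(integrable_mkcond _ (mB N)) : TiB; rewrite restrict_EFin.
  have c0 := @charge_eq0_open (induced_charge Ti).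
  have : ae_eq leb setT (EFin \o (T \_ (B N))) (cst 0%E).
    apply: integral_ae_eq => // A _ mA; rewrite integral0.
    apply: c0 => // U oU; rewrite /= /induced_charge.
    rewrite -restrict_EFin -integral_mkcondr.
    have oUB : open (U `&` B N) by exact: openI.
    have UBoo : (leb (U `&` B N) < +oo)%E.
      apply: le_lt_trans (lebesgue_rV_ball_lty 0 N.+1%:R).
      apply: le_measure; rewrite ?inE.
      - exact: open_measurable_rV.
      - exact: mB.
      - exact: subIsetr.
    have mUB : measurable (U `&` B N) by exact: open_measurable_rV.
    have TiU := integrable_bounded mUB UBoo mT TM.
    rewrite -[LHS]fineK; last exact: integrable_fin_num.
    by congr EFin; exact: T0.
  apply: ae_imply => x /(_ I) /= [] + Bx.
  by rewrite patchE mem_set.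
have := ae_foralln BN; apply: ae_imply => x Tx.
apply: (Tx (Num.truncn `|x|)); rewrite /B -ball_normE /= sub0r normrN.
exact: truncnS_gt.
Qed.

Lemma Rintegral_translation (D : set E) (a : E) (g : E -> R) : measurable D ->
  measurable_fun setT g -> leb.-integrable D (fun x => (g (x + a))%:E) ->
  \int[leb]_(x in D) g (x + a) = \int[leb]_(x in (fun x => x - a) @^-1` D) g x.
Proof.
move=> mD mg gi.
have mp : measurable_fun setT (fun x : E => x + a) by exact: measurable_rVD.
have mDa : measurable ((fun x => x - a) @^-1` D).
  have ms : measurable_fun setT (fun x : E => x - a) by exact: measurable_rVD.
  by rewrite -[X in measurable X]setTI; exact: ms.
have DE : (fun x => x + a) @^-1` ((fun x => x - a) @^-1` D) = D.
  by apply/seteqP; split => x /=; rewrite addrK.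
rewrite /Rintegral; congr fine.
transitivity (\int[image_measure leb mp]_(x in (fun x => (x - a)%R) @^-1` D)
    (g x)%:E)%E; last first.
  apply: eq_measure_integral => A mA _; rewrite /image_measure /pushforward /=.
  exact: lebesgue_rV_translation.
rewrite /image_measure integral_pushforward//.
- by rewrite DE.
- exact/measurable_EFinP.
- by rewrite DE.
Qed.

(** Shifting a set of finite measure by [o(1)] changes the integral of a bounded
    function by [o(1)]. *)
Lemma Rintegral_shift_bound (U : set E) (a : E) (g : E -> R) (M : R) :
  measurable U -> (leb U < +oo)%E -> measurable_fun setT g ->
  (forall x, `|g x| <= M) ->
  `|\int[leb]_(x in U) (g (x + a) - g x)| <=
    2 * M * fine (leb (U `\` (fun x => x - a) @^-1` U)).
Proof.
move=> mU Uoo mg gM; set Ua := (fun x => x - a) @^-1` U.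
have mp : measurable_fun setT (fun x : E => x + a) by exact: measurable_rVD.
have mga : measurable_fun setT (fun x : E => g (x + a)).
  exact: (measurableT_comp mg).
have gai := integrable_bounded mU Uoo mga (fun x => gM (x + a)).
have gi := integrable_bounded mU Uoo mg gM.
have mUa : measurable Ua.
  have ms : measurable_fun setT (fun x : E => x - a) by exact: measurable_rVD.
  by rewrite -[X in measurable X]setTI; exact: ms.
have UaE : leb Ua = leb U by exact: lebesgue_rV_translation.
have gUa : leb.-integrable Ua (EFin \o g).
  by apply: (integrable_bounded mUa _ mg gM); rewrite [ltLHS]UaE.
rewrite RintegralB// Rintegral_translation// -/Ua.
have mD1 : measurable (Ua `\` U) by exact: measurableD.
have mD2 : measurable (U `\` Ua) by exact: measurableD.
have mI : measurable (Ua `&` U) by exact: measurableI.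
have D12 : leb (Ua `\` U) = leb (U `\` Ua).
  rewrite measureD//; last by rewrite [ltLHS]UaE.
  by rewrite measureD// [in RHS]setIC; congr (_ - _)%E; exact: UaE.
have split_int A B : measurable A -> measurable B ->
    leb.-integrable A (EFin \o g) ->
    \int[leb]_(x in A) g x =
    \int[leb]_(x in A `&` B) g x + \int[leb]_(x in A `\` B) g x.
  move=> mA mB Ai; rewrite -Rintegral_setU ?setUIDK//.
  - exact: measurableI.
  - exact: measurableD.
  - by apply/disj_setPS => x [[_ Bx] [_]].
rewrite (split_int Ua U)// (split_int U Ua)// setIC.
rewrite opprD addrACA subrr add0r (le_trans (ler_normB _ _))//.
have Doo : (leb (U `\` Ua) < +oo)%E.
  by rewrite (le_lt_trans _ Uoo)// le_measure ?inE//; exact: subDsetl.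
have D1oo : (leb (Ua `\` U) < +oo)%E by rewrite D12.
rewrite -mulrA mulr_natl mulr2n lerD//; last exact: Rintegral_bound.
by rewrite -D12; exact: Rintegral_bound.
Qed.

Section additivity.
Variables (f : E -> R) (k : R).
Hypotheses (k0 : 0 < k) (fk : bounded_slope k f).

(** Integrated over a bounded open set, the defect of additivity of the difference
    quotients is the effect of a small translation on an integral, so it tends
    to [0]; a bounded function with vanishing integrals over all such open sets
    is null almost everywhere. *)
Lemma derive_additive_ae (v w : E) :
  {ae leb, forall x, 'D_(v + w) f x = 'D_v f x + 'D_w f x}.
Proof.
pose T x := 'D_(v + w) f x - 'D_v f x - 'D_w f x.
have mT : measurable_fun setT T.
  by apply: measurable_funB; [apply: measurable_funB|]; exact: measurable_derive fk _.
pose M := k * `|v + w| + k * `|v| + k * `|w|.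
have TM x : `|T x| <= M.
  rewrite (le_trans (ler_normB _ _))// lerD ?(derive_bound k0 fk)//.
  by rewrite (le_trans (ler_normB _ _))// lerD ?(derive_bound k0 fk).
suff : {ae leb, forall x, T x = 0}.
  by apply: ae_imply => x /eqP; rewrite subr_eq0 subr_eq => /eqP ->; rewrite addrC.
apply: (ae_eq0_open mT TM) => U oU Uoo.
have mU := open_measurable_rV oU.
pose s (m : nat) : R := m.+1%:R^-1.
pose g m x := diff_quot f w x (s m).
have mg m : measurable_fun setT (g m) by exact: measurable_diff_quot fk _ _.
pose Tm m x := g m (x + s m *: v) - g m x.
have mTm m : measurable_fun setT (Tm m).
  apply: measurable_funB => //; apply: (measurableT_comp (mg m)).
  exact: measurable_rVD.
have TmE m x : Tm m x = diff_quot f (v + w) x (s m) - diff_quot f v x (s m) -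
    diff_quot f w x (s m).
  rewrite /Tm /g /diff_quot.
  have -> : s m *: w + (x + s m *: v) = s m *: (v + w) + x.
    by rewrite scalerDr [x + _]addrC addrA [s m *: w + _]addrC.
  by rewrite [x + _]addrC; ring.
have TmM m x : `|Tm m x| <= M.
  rewrite TmE (le_trans (ler_normB _ _))// lerD ?(diff_quot_bound k0 fk)//.
  by rewrite (le_trans (ler_normB _ _))// lerD ?(diff_quot_bound k0 fk).
have TmT : {ae leb, forall x, U x -> Tm m x @[m --> \oo] --> T x}.
  have := ae_and (ae_derivable (v + w) k0 fk)
    (ae_and (ae_derivable v k0 fk) (ae_derivable w k0 fk)).
  apply: ae_imply => x [Dvw [Dv Dw]] _; under eq_fun do rewrite TmE.
  have cvg_dq u : derivable f x u -> diff_quot f u x (s m) @[m --> \oo] --> 'D_u f x.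
    move=> /derivableP/diff_quot_cvgP.
    by move=> /(cvg_comp _ _ natSinv_cvg_dnbhs).
  by apply: cvgB; [apply: cvgB|]; exact: cvg_dq.
have limT := bounded_convergence mU Uoo mTm mT TmM TmT.
suff lim0 : \int[leb]_(x in U) Tm m x @[m --> \oo] --> 0.
  by apply: cvg_unique limT lim0; exact: Rhausdorff.
pose V m := U `\` (fun x => x - s m *: v) @^-1` U.
have mV m : measurable (V m).
  apply: measurableD => //.
  have ms : measurable_fun setT (fun x : E => x - s m *: v).
    exact: measurable_rVD.
  by rewrite -[X in measurable X]setTI; exact: ms.
have V0 : 2 * (k * `|w|) * fine (leb (V m)) @[m --> \oo] --> 0.
  rewrite -(mulr0 (2 * (k * `|w|))); apply: cvgM; first exact: cvg_cst.
  have -> : (fun m => fine (leb (V m))) = (fun m => \int[leb]_(x in U) \1_(V m) x).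
    apply/funext => m; rewrite /Rintegral integral_indic//.
    by rewrite setIidl//; exact: subDsetl.
  have <- : \int[leb]_(x in U) cst (0 : R) x = 0 by rewrite Rintegral_cst ?mul0r.
  apply: (@bounded_convergence _ _ _ leb U (fun m => \1_(V m)) (cst 0) 1) => //.
    by move=> m x; rewrite indicE ger0_norm// lern1 leq_b1.
  apply: aeW => x Ux; apply: cvg_near_cst.
  have s0 : s m @[m --> \oo] --> 0 by exact: cvg_harmonic.
  have xs : x - s m *: v @[m --> \oo] --> x.
    rewrite -[X in _ --> X](subr0 x) -(scale0r v).
    by apply: cvgB; [exact: cvg_cst|apply: cvgZr_tmp; exact: s0].
  have Ux' : nbhs x U by apply: open_nbhs_nbhs; split.
  have xU : \forall m \near \oo, U (x - s m *: v) by exact: xs.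
  apply: filterS xU => m /= Um.
  by rewrite indicE memNset// => -[_].
apply/norm_cvg0P.
apply: (@squeeze_cvgr _ _ _ _ (cst 0) (fun m => 2 * (k * `|w|) * fine (leb (V m)))) => //.
- apply: nearW => m; rewrite normr_ge0/=; apply: Rintegral_shift_bound => //.
  by move=> x; exact: diff_quot_bound.
- exact: cvg_cst.
Qed.

Lemma is_derive_dir0 (x : E) : is_derive x 0 f 0.
Proof.
apply/diff_quot_cvgP; rewrite /diff_quot.
under eq_fun do rewrite scaler0 add0r subrr mulr0.
exact: cvg_cst.
Qed.

Lemma is_derive_dirZ (v x : E) (c l : R) :
  is_derive x v f l -> is_derive x (c *: v) f (c * l).
Proof.
have [->|c0] := eqVneq c 0.
  by rewrite scale0r mul0r => _; exact: is_derive_dir0.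
have dqZ h : diff_quot f (c *: v) x h = c * diff_quot f v x (c * h).
  by rewrite /diff_quot scalerA [h * c]mulrC mulrA invfM mulrA divff// mul1r.
move=> /diff_quot_cvgP xl; apply/diff_quot_cvgP.
under eq_fun do rewrite dqZ; apply: cvgM; first exact: cvg_cst.
apply: (cvg_comp (fun h => c * h) (diff_quot f v x) _ xl).
move=> A A0; have : \forall h \near (0 : R)^', A h by exact: A0.
rewrite near_withinE => /nbhs_ballP[d /= d0 dA].
suff : \forall h \near (0 : R)^', A (c * h) by [].
rewrite near_withinE; apply/nbhs_ballP; exists (d / `|c|) => /=.
  by rewrite divr_gt0// normr_gt0.
move=> h; rewrite /ball/= sub0r normrN => hd h0; apply: dA.
  by rewrite /ball/= sub0r normrN normrM mulrC -ltr_pdivlMr// normr_gt0.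
by rewrite mulf_neq0.
Qed.

Lemma diff_quot_dir_bound (v w x : E) (h : R) :
  `|diff_quot f v x h - diff_quot f w x h| <= k * `|v - w|.
Proof.
rewrite /diff_quot -mulrBr opprB addrA subrK.
have [->|h0] := eqVneq h 0.
  by rewrite invr0 mul0r normr0 mulr_ge0// ltW.
rewrite normrM normfV ler_pdivrMl ?normr_gt0//.
rewrite (le_trans (fk _ _))// opprD addrACA subrr addr0 -scalerBr normrZ.
by rewrite mulrCA.
Qed.

Lemma partial_bound (i : 'I_n) (x : E) : `|partial i f x| <= k.
Proof.
rewrite (le_trans (derive_bound k0 fk _ _))// -[leRHS]mulr1.
by rewrite ler_pM2l// norm_delta_mx_le1.
Qed.

Lemma dotv_grad_bound (u x : E) : `|dotv u (grad f x)| <= n%:R * k * `|u|.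
Proof.
rewrite /dotv (le_trans (ler_norm_sum _ _ _))//.
rewrite (@le_trans _ _ (\sum_(i < n) `|u| * k))//.
  apply: ler_sum => i _; rewrite normrM mxE ler_pM//.
    exact: coord_le_norm.
  exact: partial_bound.
rewrite sumr_const card_ord (_ : n%:R * k * `|u| = n%:R * (`|u| * k)); last by ring.
by rewrite mulr_natl.
Qed.

Lemma derive_linear_ae (v : E) :
  {ae leb, forall x, is_derive x v f (dotv v (grad f x))}.
Proof.
pose e (i : 'I_n) : E := delta_mx 0 i.
suff H (s : seq 'I_n) : {ae leb, forall x,
    is_derive x (\sum_(i <- s) v 0 i *: e i) f
                (\sum_(i <- s) v 0 i * partial i f x)}.
  have := H (index_enum 'I_n); apply: ae_imply => x.
  rewrite -[X in is_derive _ X](row_sum_delta v).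
  by congr (is_derive _ _ _ _); apply: eq_bigr => i _; rewrite mxE.
elim: s => [|i s IHs].
  by apply: aeW => x; rewrite !big_nil; exact: is_derive_dir0.
have := ae_and (derive_additive_ae (v 0 i *: e i) (\sum_(i <- s) v 0 i *: e i))
  (ae_and IHs (ae_and (ae_derivable (e i) k0 fk)
  (ae_derivable (v 0 i *: e i + \sum_(i <- s) v 0 i *: e i) k0 fk))).
apply: ae_imply => x [addx [sx [ix dx]]]; rewrite !big_cons.
apply: DeriveDef => //; rewrite addx; congr (_ + _); last exact: derive_val.
have := is_derive_dirZ (v 0 i) (derivableP ix).
by move=> ?; exact: derive_val.
Qed.

(** Rademacher's theorem: the almost everywhere additivity of directional
    derivatives gives linearity along rational directions, and the Lipschitz
    bound extends it to all directions at once. *)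
Theorem rademacher :
  {ae leb, forall x, forall v, is_derive x v f (dotv v (grad f x))}.
Proof.
pose Q (m : nat) : E := oapp (map_mx ratr) 0 (unpickle m : option 'rV[rat]_n).
have := ae_foralln (fun m => derive_linear_ae (Q m)).
apply: ae_imply => x Dx v; apply/diff_quot_cvgP/cvgrPdist_lt => e e0.
pose c := (1 + n%:R) * k.
have c0 : 0 < c by rewrite mulr_gt0// ltr_wpDr.
pose d := e / 2 / c.
have d0 : 0 < d by rewrite !divr_gt0.
have /choice[q Hq] : forall i : 'I_n, exists q : rat, `|v 0 i - ratr q| < d.
  move=> i; have [|q] := @rat_in_itvoo _ (v 0 i - d) (v 0 i + d).
    by rewrite ltrD2l gtrN.
  rewrite in_itv/= => /andP[q1 q2]; exists q.
  by rewrite distrC ltr_distl q1 q2.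
pose w : E := map_mx ratr (\row_i q i).
have vw : `|v - w| <= d.
  by apply: norm_le_coord => [|i]; [exact: ltW|rewrite !mxE ltW].
have Dw : is_derive x w f (dotv w (grad f x)).
  by have := Dx (pickle (\row_i q i)); rewrite /Q pickleK.
have /diff_quot_cvgP/cvgrPdist_lt/(_ (e / 2)) := Dw.
rewrite divr_gt0// => /(_ isT); apply: filterS => h Hh.
have -> : dotv v (grad f x) - diff_quot f v x h =
    (dotv (v - w) (grad f x) + (diff_quot f w x h - diff_quot f v x h)) +
    (dotv w (grad f x) - diff_quot f w x h).
  have -> : dotv (v - w) (grad f x) = dotv v (grad f x) - dotv w (grad f x).
    by rewrite /dotv -sumrB; apply: eq_bigr => i _; rewrite !mxE mulrBl.
  ring.
rewrite [ltRHS]splitr (le_lt_trans (ler_normD _ _))// ler_ltD//.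
rewrite (le_trans (ler_normD _ _))//.
have -> : e / 2 = n%:R * k * d + k * d.
  rewrite -(_ : c * d = e / 2); first by rewrite /c; ring.
  by rewrite /d mulrC divfK// lt0r_neq0.
rewrite lerD//.
  rewrite (le_trans (dotv_grad_bound _ _))// ler_wpM2l// mulr_ge0//.
  exact: ltW.
rewrite (le_trans (diff_quot_dir_bound _ _ _ _))// distrC.
by rewrite ler_wpM2l// ltW.
Qed.

End additivity.

End rademacher.

(** * Signed measures with densities *)

Section densities.
Context d (T : measurableType d) (R : realType).

Lemma integrableM_bounded (mu : {measure set T -> \bar R}) (D : set T)
  (psi g : T -> R) (M : R) : measurable D -> mu.-integrable setT (EFin \o g) ->
  measurable_fun setT psi -> (forall x, `|psi x| <= M) ->
  mu.-integrable D (EFin \o (fun x => psi x * g x)).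
Proof.
move=> mD gi mpsi psiM.
rewrite (_ : EFin \o _ = (EFin \o psi) \* (EFin \o g))%E//.
apply: integrableMr => //.
- exact: measurable_funTS.
- exists M; split; first exact: num_real.
  by move=> N MN x _ /=; rewrite (le_trans (psiM x))// ltW.
- exact: integrableS gi.
Qed.

Lemma integral_density (mu : {sigma_finite_measure set T -> \bar R})
  (m : {finite_measure set T -> \bar R}) (g : T -> R) :
  mu.-integrable setT (EFin \o g) ->
  (forall A, measurable A -> m A = (\int[mu]_(x in A) (g x)%:E)%E) ->
  forall (D : set T) (psi : T -> R) (M : R), measurable D ->
  measurable_fun setT psi -> (forall x, `|psi x| <= M) ->
  \int[m]_(x in D) psi x = \int[mu]_(x in D) (psi x * g x).
Proof.
move=> gi mE D psi M mD mpsi psiM.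
have m_mu : charge_of_finite_measure m `<< mu.
  apply/null_content_dominatesP => A mA A0.
  rewrite [LHS]mE// null_set_integral//.
  exact: measurable_funTS (measurable_int _ gi).
have psii : m.-integrable D (EFin \o psi).
  apply: (integrable_bounded mD _ mpsi psiM).
  by rewrite -ge0_fin_numE// fin_num_measure.
rewrite /Rintegral -(Radon_Nikodym_change_of_variables m_mu mD psii).
congr fine; under [RHS]eq_integral do rewrite EFinM.
apply: ae_eq_integral => //.
- apply: emeasurable_funM; first exact: measurable_int psii.
  by apply: measurable_funTS; apply: measurable_int (Radon_Nikodym_integrable m_mu).
- apply: emeasurable_funM; first exact: measurable_int psii.
  by apply: measurable_funTS; exact: measurable_int gi.
- apply: ae_eqe_mul2l; apply: ae_eq_subset (subsetT _) _.
  apply: integral_ae_eq => //.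
  + exact: Radon_Nikodym_integrable.
  + exact: measurable_int gi.
  + move=> A _ mA; rewrite -mE//.
    by rewrite -(Radon_Nikodym_integral m_mu mA).
Qed.

Section charge.
Variables (mu : {sigma_finite_measure set T -> \bar R}).
Variables (c : {charge set T -> \bar R}) (g : T -> R).
Hypothesis gi : mu.-integrable setT (EFin \o g).
Hypothesis cE : forall A, measurable A -> c A = (\int[mu]_(x in A) (g x)%:E)%E.
Variables (P N : set T) (PN : hahn_decomposition c P N).

Let mP : measurable P. Proof. by have [[]] := PN. Qed.
Let mN : measurable N. Proof. by have [_ []] := PN. Qed.

Let indic_integrable A : measurable A ->
  mu.-integrable setT (EFin \o (fun x => \1_A x * g x)).
Proof.
move=> mA; apply: (@integrableM_bounded _ _ _ _ 1) => // x.
by rewrite indicE ger0_norm// lern1 leq_b1.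
Qed.

Let integral_indicM A B : (\int[mu]_(x in A) (\1_B x * g x)%:E =
  \int[mu]_(x in A `&` B) (g x)%:E)%E.
Proof.
rewrite integral_mkcondr; apply: eq_integral => x _; rewrite patchE indicE.
by case: ifPn; rewrite ?mul1r ?mul0r.
Qed.

Lemma jordan_integral (D : set T) (psi : T -> R) (M : R) : measurable D ->
  measurable_fun setT psi -> (forall x, `|psi x| <= M) ->
  \int[jordan_pos PN]_(x in D) psi x - \int[jordan_neg PN]_(x in D) psi x =
  \int[mu]_(x in D) (psi x * g x).
Proof.
move=> mD mpsi psiM.
have pE A : measurable A ->
    jordan_pos PN A = (\int[mu]_(x in A) (\1_P x * g x)%:E)%E.
  move=> mA; rewrite jordan_posE cjordan_posE /crestr0 mem_set// /crestr.
  by rewrite integral_indicM cE//; exact: measurableI.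
have nE A : measurable A ->
    jordan_neg PN A = (\int[mu]_(x in A) (- (\1_N x * g x))%:E)%E.
  move=> mA; rewrite jordan_negE cjordan_negE /crestr0 mem_set// /crestr.
  rewrite cE -?integral_indicM; last exact: measurableI.
  rewrite [RHS](eq_integral (fun x =>
      (-1)%:E * (EFin \o (fun x => \1_N x * g x)%R) x)%E).
    rewrite integralZl//; first by rewrite mulN1e.
    by apply: (integrableS measurableT) => //; exact: indic_integrable.
  by move=> x _; rewrite /= -EFinM mulN1r.
rewrite (integral_density (indic_integrable mP) pE mD mpsi psiM).
have Ni : mu.-integrable setT (EFin \o (fun x => - (\1_N x * g x))).
  rewrite (_ : _ \o _ = (-%E \o (EFin \o (fun x => \1_N x * g x))))//.
  by apply: integrableN => //; exact: indic_integrable.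
rewrite (integral_density Ni nE mD mpsi psiM).
rewrite -RintegralB//.
- apply: eq_Rintegral => x _; rewrite -mulrBr opprK -mulrDl; congr (_ * _).
  have [_ _ PNT PN0] := PN; rewrite !indicE.
  have [xP|xP] := boolP (x \in P).
    rewrite (_ : x \in N = false) ?addr0 ?mul1r//; apply/negbTE/negP.
    by rewrite inE in xP; rewrite inE => xN; have : set0 x by rewrite -PN0.
  rewrite (_ : x \in N = true) ?add0r ?mul1r//.
  have : (P `|` N) x by rewrite PNT.
  by case=> [|/mem_set//]; move: xP; rewrite notin_setE.
- exact: integrableM_bounded (indic_integrable mP) mpsi psiM.
- exact: integrableM_bounded Ni mpsi psiM.
Qed.

End charge.

(** The integral against a signed measure with density [g] does not depend on
    the Hahn decomposition from which it is computed. *)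
Lemma charge_integral_density (mu : {sigma_finite_measure set T -> \bar R})
  (c : {charge set T -> \bar R}) (g : T -> R) :
  mu.-integrable setT (EFin \o g) ->
  (forall A, measurable A -> c A = (\int[mu]_(x in A) (g x)%:E)%E) ->
  forall (D : set T) (psi : T -> R) (M : R), measurable D ->
  measurable_fun setT psi -> (forall x, `|psi x| <= M) ->
  charge_integral c D psi = \int[mu]_(x in D) (psi x * g x).
Proof. by move=> gi cE D psi M; exact: jordan_integral. Qed.

(** Polar decomposition: the density of a signed measure with respect to its
    total variation is the difference of the indicators of the two sets of a
    Hahn decomposition. *)
Lemma charge_polar (c : {charge set T -> \bar R}) :
  exists m : {finite_measure set T -> \bar R}, exists theta : T -> R,
  [/\ measurable_fun setT theta, forall x, `|theta x| <= 1,
      forall A, measurable A -> m A = charge_tv c A &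
      forall A, measurable A -> c A = (\int[m]_(x in A) (theta x)%:E)%E].
Proof.
rewrite /charge_tv; case: (hahn_ex c) => -[P N] /= PN.
have [[mP _] [mN _] PNT PN0] := PN.
have vfin : fin_num_fun (charge_variation PN).
  by move=> A mA; exact: fin_num_measure.
pose m : {finite_measure set T -> \bar R} := HB.pack_for (FiniteMeasure.type T R)
  (charge_variation PN) (Measure.class (charge_variation PN))
  (Measure_isFinite.Build _ _ _ (charge_variation PN) vfin).
exists m, (fun x => \1_P x - \1_N x); split => //.
- by apply: measurable_funB; exact: measurable_indic.
- move=> x; rewrite !indicE.
  have [xP|xP] := boolP (x \in P).
    rewrite (_ : x \in N = false) ?subr0 ?normr1//; apply/negbTE/negP.
    by rewrite inE in xP; rewrite inE => xN; have : set0 x by rewrite -PN0.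
  by rewrite sub0r normrN; case: (x \in N); rewrite ?normr1 ?normr0.
- move=> A mA.
  have mAP : measurable (A `&` P) by exact: measurableI.
  have mAN : measurable (A `&` N) by exact: measurableI.
  have mE B : measurable B -> m B = (c (B `&` P) - c (B `&` N))%E.
    move=> mB; rewrite /m /= /charge_variation jordan_posE cjordan_posE.
    by rewrite jordan_negE cjordan_negE /crestr0 mem_set.
  have mP' : m (A `&` P) = c (A `&` P).
    by rewrite mE// -!setIA setIid PN0 setI0 charge0 sube0.
  have mN' : m (A `&` N) = (- c (A `&` N))%E.
    by rewrite mE// -!setIA setIid [N `&` P]setIC PN0 setI0 charge0 sub0e.
  rewrite (eq_integral (fun x => (\1_P x)%:E - (\1_N x)%:E)%E); last first.
    by move=> x _; rewrite EFinB.
  rewrite integralB//; [|exact: integrableS (integrable_indic _ _)..].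
  rewrite !integral_indic// ![_ `&` A]setIC.
  rewrite [X in (X - _)%E]mP' [X in (_ - X)%E]mN' oppeK.
  exact: charge_partition.
Qed.

End densities.

(** * Superpositions of segments *)

Section superposition.
Context d d' (T : measurableType d) (T' : measurableType d') (R : realType).
Variables (mu : {sigma_finite_measure set T' -> \bar R}).
Variables (P : {sigma_finite_measure set T -> \bar R}).

(** The signed measure obtained by carrying the mass [V z] to [X z] is absolutely
    continuous when the law of [X] is, and its density is [f]; this is how
    vector measures concentrated on curves become fields when averaged. *)
Lemma superposition_density (X : T -> T') (V : T -> R) :
  measurable_fun setT X -> P.-integrable setT (EFin \o V) ->
  (forall N, measurable N -> mu N = 0%E -> P (X @^-1` N) = 0%E) ->
  exists f : T' -> R, [/\ mu.-integrable setT (EFin \o f),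
    forall (psi : T' -> R) (M : R), measurable_fun setT psi ->
      (forall x, `|psi x| <= M) ->
      \int[mu]_x (psi x * f x) = \int[P]_z (psi (X z) * V z) &
    forall N, measurable N ->
      \int[mu]_(x in N) `|f x| <= \int[P]_(z in X @^-1` N) `|V z|].
Proof.
move=> mX Vi X0; pose c := induced_charge Vi.
have cE A : measurable A -> c A = (\int[P]_(z in A) (V z)%:E)%E by [].
have [Q [N QN]] := Hahn_decomposition c.
have image_density (m : {finite_measure set T -> \bar R}) :
    m `<< P -> exists2 f : T' -> R, mu.-integrable setT (EFin \o f) &
      forall (psi : T' -> R) (M : R), measurable_fun setT psi ->
      (forall x, `|psi x| <= M) ->
      \int[mu]_x (psi x * f x) = \int[m]_z psi (X z).
  move=> mP; pose mX' := image_measure m mX.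
  have mX_mu : charge_of_finite_measure mX' `<< mu.
    apply/null_content_dominatesP => A mA A0.
    move/null_content_dominatesP : mP; apply; last exact: X0.
    by rewrite -[X in measurable X]setTI; exact: (mX measurableT _ mA).
  pose f := fine \o Radon_Nikodym (charge_of_finite_measure mX') mu.
  have fE : EFin \o f = Radon_Nikodym (charge_of_finite_measure mX') mu.
    by apply/funext => x; rewrite /f /= fineK// Radon_Nikodym_fin_num.
  have fi : mu.-integrable setT (EFin \o f).
    by rewrite fE; exact: Radon_Nikodym_integrable.
  exists f => // psi M mpsi psiM.
  have mXE A : measurable A -> mX' A = (\int[mu]_(x in A) (f x)%:E)%E.
    move=> mA; rewrite [LHS](Radon_Nikodym_integral mX_mu mA) -fE.
    exact: eq_integral.
  rewrite -(integral_density fi mXE measurableT mpsi psiM).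
  rewrite /Rintegral; congr fine; rewrite /mX' /image_measure.
  rewrite integral_pushforward//; first exact/measurable_EFinP.
  rewrite preimage_setT; apply: (integrable_bounded measurableT) => //.
  - by rewrite -ge0_fin_numE// fin_num_measure.
  - exact: (measurableT_comp mpsi mX).
have c_P : c `<< P.
  apply/null_content_dominatesP => A mA A0; rewrite cE// null_set_integral//.
  exact: measurable_funTS (measurable_int _ Vi).
have [f1 f1i f1E] := image_density _ (jordan_pos_dominates QN c_P).
have [f2 f2i f2E] := image_density _ (jordan_neg_dominates QN c_P).
pose f x := f1 x - f2 x.
have fi : mu.-integrable setT (EFin \o f).
  rewrite (_ : EFin \o f = (EFin \o f1) \- (EFin \o f2))%E//.
  exact: integrableB.
have fE (psi : T' -> R) (M : R) : measurable_fun setT psi ->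
    (forall x, `|psi x| <= M) ->
    \int[mu]_x (psi x * f x) = \int[P]_z (psi (X z) * V z).
  move=> mpsi psiM.
  have psii := @integrableM_bounded _ _ _ mu setT psi _ M measurableT _ mpsi psiM.
  under eq_Rintegral do rewrite mulrBr.
  rewrite RintegralB ?f1E ?f2E//; [|exact: psii..].
  rewrite (f1E _ _ mpsi psiM) (f2E _ _ mpsi psiM).
  have mpsiX : measurable_fun setT (fun z => psi (X z)).
    exact: (measurableT_comp mpsi mX).
  by rewrite (jordan_integral Vi cE QN measurableT mpsiX (fun z => psiM (X z))).
exists f; split => // A mA.
have mf : measurable_fun setT f by exact/measurable_EFinP/(measurable_int _ fi).
pose S := [set x | 0 <= f x].
have mS : measurable S.
  rewrite (_ : S = f @^-1` `[0, +oo[%classic); last first.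
    by apply/seteqP; split => x; rewrite /S /= in_itv/= andbT.
  by rewrite -[X in measurable X]setTI; apply: mf => //; exact: measurable_itv.
pose psi x : R := (\1_S x *+ 2 - 1) * \1_A x.
have mpsi : measurable_fun setT psi.
  apply: measurable_funM; last exact: measurable_indic.
  apply: measurable_funB => //; under eq_fun do rewrite mulr2n.
  by apply: measurable_funD; exact: measurable_indic.
have psi1 x : `|psi x| <= 1.
  rewrite /psi normrM !indicE; case: (x \in S); case: (x \in A) => /=;
  by rewrite ?mulr0 ?normr0 ?mulr1 ?mul0rn ?sub0r ?normrN ?normr1 ?mulr2n
    ?addrK ?normr1.
(* [psi] is the sign of [f] on [A] *)
have fpsi : \int[mu]_(x in A) `|f x| = \int[mu]_x (psi x * f x).
  rewrite Rintegral_mkcond; apply: eq_Rintegral => x _.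
  rewrite patchE /psi !indicE; case: ifPn => _; last by rewrite mulr0 mul0r.
  rewrite mulr1; have [fx|fx] := leP 0 (f x).
    by rewrite mem_set// mulr2n addrK mul1r ger0_norm.
  by rewrite memNset ?mul0rn ?sub0r ?mulN1r ?ltr0_norm// /S /= leNgt fx.
rewrite fpsi (fE _ _ mpsi psi1) [leRHS]Rintegral_mkcond.
have mV : measurable_fun setT V by exact/measurable_EFinP/(measurable_int _ Vi).
have mXA : measurable (X @^-1` A) by rewrite -[X in measurable X]setTI; exact: mX.
apply: le_Rintegral => //.
- apply: (@integrableM_bounded _ _ _ P setT (fun z => psi (X z)) V 1) => //.
  exact: (measurableT_comp mpsi mX).
- have nVi : P.-integrable (X @^-1` A) (EFin \o (fun z => `|V z|)).
    by apply: integrable_norm; apply: (integrableS _ _ _ Vi).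
  by move/(integrable_mkcond _ mXA) : nVi; rewrite restrict_EFin.
- move=> z _; rewrite patchE; case: ifPn => zA.
    rewrite (le_trans (ler_norm _))// normrM -[leRHS]mul1r ler_wpM2r//.
  rewrite /psi (_ : \1_A (X z) = 0) ?mulr0 ?mul0r// indicE memNset//.
  by rewrite notin_setE in zA.
Qed.

End superposition.

Section unit_interval.
Context {R : realType}.

Let D : set (measurableTypeR R) := `[0 : R, 1]%classic.
Let mD : measurable D. Proof. exact: measurable_itv. Qed.
Let Doo : (@lebesgue_measure R D < +oo)%E.
Proof. by rewrite [ltLHS]lebesgue_unit_itv ltry. Qed.

Definition unit_itv_measure : {finite_measure set (measurableTypeR R) -> \bar R} :=
  mfrestr mD Doo.

Lemma unit_itv_measureE (A : set R) :
  unit_itv_measure A = lebesgue_measure (A `&` `[0, 1]%classic).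
Proof. by []. Qed.

Lemma Rintegral_unit_itv (f : R -> R) (M : R) : measurable_fun setT f ->
  (forall t, `|f t| <= M) ->
  \int[unit_itv_measure]_t f t = \int[lebesgue_measure]_(t in `[0, 1]) f t.
Proof.
move=> mf fM.
have i01 : lebesgue_measure.-integrable setT
    (EFin \o (\1_(`[0 : R, 1]%classic) : R -> R)).
  exact: integrable_indic_itv.
rewrite (integral_density i01 _ measurableT mf fM).
  rewrite [RHS]Rintegral_mkcond; apply: eq_Rintegral => t _.
  by rewrite patchE indicE; case: ifPn; rewrite ?mulr1 ?mulr0.
move=> A mA; rewrite unit_itv_measureE.
by rewrite integral_indic// setIC.
Qed.

Lemma unit_itv_measure_ae (N : set (measurableTypeR R)) : measurable N ->
  (forall t : R, N t -> ~~ (0 < t < 1)) -> unit_itv_measure N = 0%E.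
Proof.
move=> mN N01; rewrite unit_itv_measureE.
have m1 (r : R) : measurable [set r] by [].
have leb01 : lebesgue_measure ([set 0; 1] : set R) = 0%E.
  by rewrite measureU0//; exact: lebesgue_measure_set1.
apply/eqP; rewrite eq_le measure_ge0 andbT -leb01.
apply: le_measure; rewrite ?inE//.
- by apply: measurableI => //; exact: measurable_itv.
- by apply: measurableU.
move=> t [/N01]; rewrite /= in_itv/= negb_and -!leNgt => /orP t01 /andP[t0 t1].
by case: t01 => [t0'|t1']; [left|right]; apply/eqP; rewrite eq_le ?t0 ?t1 ?t0' ?t1'.
Qed.

Lemma measurable_unit_itv_le (eta : R) :
  measurable [set t : R | (t <= eta) || ~~ (0 < t < 1)].
Proof.
rewrite (_ : mkset _ = `]-oo, eta]%classic `|` ~` `]0 : R, 1[%classic).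
  by apply: measurableU; [|apply: measurableC]; exact: measurable_itv.
apply/seteqP; split => t /=; rewrite !in_itv/=.
  by case/orP=> [|/negP]; [left|right].
by case=> [->//|/negP ->]; rewrite orbT.
Qed.

Lemma unit_itv_measure_le (eta : R) : 0 <= eta <= 1 ->
  (unit_itv_measure [set t : R | ((t <= eta) || ~~ (0 < t < 1))%R] <= eta%:E)%E.
Proof.
move=> /andP[eta0 eta1]; rewrite unit_itv_measureE.
have mI : measurable (`[0, eta]%classic : set R) by exact: measurable_itv.
have Ieta : lebesgue_measure (`[0, eta]%classic : set R) = eta%:E.
  rewrite lebesgue_measure_itv/= lte_fin; case: ltgtP eta0 => // [_ _|<- _].
    by rewrite sube0.
  by [].
have <- : lebesgue_measure (`[0, eta]%classic `|` [set 1] : set R) = eta%:E.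
  by rewrite measureU0//; exact: lebesgue_measure_set1.
have sub : [set t : R | (t <= eta) || ~~ (0 < t < 1)] `&` `[0, 1]%classic `<=`
    `[0, eta]%classic `|` [set 1].
  move=> t [] /=; rewrite in_itv/= => + /andP[t0 t1].
  have [te _|te /=] := leP t eta; first by left; rewrite /= in_itv/= t0.
  rewrite (le_lt_trans eta0 te)/= -leNgt => t1'; right.
  by apply/eqP; rewrite eq_le t1.
have mS := measurable_unit_itv_le eta.
apply: le_measure; rewrite ?inE; last exact: sub.
- by apply: measurableI => //; exact: measurable_itv.
- by apply: measurableU.
Qed.

End unit_interval.

Section finite_product.
Context d d' (T : measurableType d) (T' : measurableType d') (R : realType).
Variables (m : {finite_measure set T -> \bar R}).
Variables (m' : {finite_measure set T' -> \bar R}).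

(** A copy of [m \x m'] that carries a finite measure structure. *)
Definition finite_product : set (T * T') -> \bar R := (m \x m')%E.

Let fp0 : finite_product set0 = 0%E.
Proof. by rewrite /finite_product measure0. Qed.

Let fp_ge0 A : (0 <= finite_product A)%E.
Proof. by rewrite /finite_product measure_ge0. Qed.

Let fp_sigma_additive : semi_sigma_additive finite_product.
Proof. by apply: measure_semi_sigma_additive. Qed.

HB.instance Definition _ := isMeasure.Build _ _ _ finite_product
  fp0 fp_ge0 fp_sigma_additive.

Let fp_finite : fin_num_fun finite_product.
Proof.
move=> A mA; rewrite ge0_fin_numE//.
apply: (@le_lt_trans _ _ (finite_product (setT `*` setT))).
  by apply: le_measure; rewrite ?inE//; exact: measurableX.
by rewrite /finite_product product_measure1E// lte_mul_pinfty//
  ?fin_num_measure// -ge0_fin_numE// fin_num_measure.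
Qed.

HB.instance Definition _ := Measure_isFinite.Build _ _ _ finite_product fp_finite.

Lemma finite_productX A B : measurable A -> measurable B ->
  finite_product (A `*` B) = (m A * m' B)%E.
Proof. exact: product_measure1E. Qed.

Lemma finite_product_swap A : measurable A ->
  finite_product A = (\int[m']_y m (ysection A y))%E.
Proof.
move=> mA; rewrite /finite_product.
rewrite (@product_measure_unique _ _ _ _ _ m m' (m \x^ m')%E)//.
by move=> B C mB mC; exact: product_measure2E.
Qed.

Lemma Rintegral_finite_product (W : T * T' -> R) (M : R) :
  measurable_fun setT W -> (forall z, `|W z| <= M) ->
  \int[finite_product]_z W z = \int[m]_x \int[m']_y W (x, y).
Proof.
move=> mW WM.
have fpoo : (finite_product setT < +oo)%E by rewrite -ge0_fin_numE// fin_num_measure.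
have m'oo : (m' setT < +oo)%E by rewrite -ge0_fin_numE// fin_num_measure.
have Wi := integrable_bounded measurableT fpoo mW WM.
rewrite {1}/Rintegral -(integral12_prod_meas1 Wi) {1}/Rintegral; congr fine.
apply: eq_integral => x _; rewrite /fubini_F -[LHS]fineK//.
have mWx : measurable_fun setT (fun y => W (x, y)).
  exact: (measurableT_comp mW).
apply: integrable_fin_num => //.
exact: (integrable_bounded measurableT m'oo mWx (fun y => WM (x, y))).
Qed.

End finite_product.

Lemma Rintegral_sum d (T : measurableType d) (R : realType)
  (mu : {measure set T -> \bar R}) (D : set T) (I : Type) (s : seq I)
  (f : I -> T -> R) : measurable D ->
  (forall i, mu.-integrable D (EFin \o f i)) ->
  \int[mu]_(x in D) (\sum_(i <- s) f i x) = \sum_(i <- s) \int[mu]_(x in D) f i x.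
Proof.
move=> mD fi; elim: s => [|i s IHs].
  by under eq_Rintegral do rewrite big_nil; rewrite big_nil Rintegral_cst// mul0r.
under eq_Rintegral do rewrite big_cons.
rewrite big_cons RintegralD ?IHs//.
rewrite (_ : EFin \o _ = (fun x => \sum_(i <- s) (f i x)%:E)%E).
  by apply: integrable_sum => // j _; exact: fi.
by apply/funext => x /=; rewrite sumEFin.
Qed.

Section flow.
Context {R : realType} {n : nat} d (T : measurableType d).
Local Notation E := 'rV[R]_n.
Local Notation leb := (@lebesgue_rV R n).
Variable P : {finite_measure set T -> \bar R}.
Local Notation I01 := (@unit_itv_measure R).
Local Notation PI := (finite_product P I01).
Variables (theta : T -> R) (p q : T -> E) (M : R).
Hypothesis mtheta : measurable_fun setT theta.
Hypothesis mp : measurable_fun setT p.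
Hypothesis mq : measurable_fun setT q.
Hypothesis M0 : 0 <= M.
Hypothesis theta_pq : forall z, `|theta z *: (q z - p z)| <= M.
Hypothesis law0 : forall (t : R) (N : set E), 0 < t < 1 -> measurable N ->
  leb N = 0%E -> P [set z | N (p z + t *: (q z - p z))] = 0%E.

Let X (z : T * measurableTypeR R) : E := p z.1 + (z.2 : R) *: (q z.1 - p z.1).
Let V (i : 'I_n) (z : T * measurableTypeR R) : R :=
  theta z.1 * (q z.1 - p z.1) 0 i.

Let mX : measurable_fun setT X.
Proof.
have mp1 : measurable_fun setT (fun z : T * measurableTypeR R => p z.1).
  by apply: (measurableT_comp mp).
have mq1 : measurable_fun setT (fun z : T * measurableTypeR R => q z.1).
  by apply: (measurableT_comp mq).
apply: measurable_rVD => //; apply: measurable_rVZ; first exact: measurable_snd.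
exact: measurable_rVB.
Qed.

Let mV i : measurable_fun setT (V i).
Proof.
have mv : measurable_fun setT (fun z => theta z * (q z - p z) 0 i).
  by apply: measurable_funM => //; apply: measurable_coord_comp; exact: measurable_rVB.
exact: (measurableT_comp mv).
Qed.

Let VM i z : `|V i z| <= M.
Proof.
have := theta_pq z.1; apply: le_trans.
by have := coord_le_norm (theta z.1 *: (q z.1 - p z.1)) i; rewrite mxE.
Qed.

Let PIoo : (PI setT < +oo)%E.
Proof. by rewrite -ge0_fin_numE// fin_num_measure. Qed.

Let Vi i : PI.-integrable setT (EFin \o V i).
Proof. exact: (integrable_bounded measurableT PIoo (mV i) (VM i)). Qed.

Let X0 N : measurable N -> leb N = 0%E -> PI (X @^-1` N) = 0%E.
Proof.
move=> mN N0.
have mXN : measurable (X @^-1` N) by rewrite -[X in measurable X]setTI; exact: mX.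
rewrite finite_product_swap//.
transitivity (\int[I01]_(t in setT) (cst 0 t : \bar R))%E; last exact: integral0.
apply: ae_eq_integral => //; first exact: measurable_fun_ysection.
exists [set t : R | ~~ (0 < t < 1)]; split.
- rewrite (_ : mkset _ = ~` `]0 : R, 1[%classic).
    by apply: measurableC; exact: measurable_itv.
  by apply/seteqP; split => t /=; rewrite in_itv/= => /negP.
- apply: unit_itv_measure_ae => //.
  rewrite (_ : mkset _ = ~` `]0 : R, 1[%classic).
    by apply: measurableC; exact: measurable_itv.
  by apply/seteqP; split => t /=; rewrite in_itv/= => /negP.
- move=> t /= Ht; apply/negP => t01; apply: Ht => _.
  rewrite -(law0 t01 mN N0); congr (P _).
  by apply/seteqP; split => z; rewrite /ysection /= inE.
Qed.

(** Fubini turns the null set of a Lipschitz function into a null set of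
    parameters on almost every segment, where the one-variable theorem applies. *)
Let segment_FTC (phi : E -> R) (k : R) : 0 < k -> bounded_slope k phi ->
  {ae P, forall z, \int[I01]_t dotv (q z - p z) (grad phi (X (z, t))) =
    phi (q z) - phi (p z)}.
Proof.
move=> k0 phik; have [N [mN N0 DN]] := rademacher k0 phik.
have mXN : measurable (X @^-1` N) by rewrite -[X in measurable X]setTI; exact: mX.
have mXNP := X0 mN N0.
have : {ae P, forall z, I01 (xsection (X @^-1` N) z) = 0%E}.
  have := mXNP; rewrite /product_measure1 => int0.
  have mxs : measurable_fun setT (fun z => I01 (xsection (X @^-1` N) z)).
    exact: measurable_fun_xsection.
  have : ae_eq P setT (fun z => I01 (xsection (X @^-1` N) z)) (cst 0%E).
    apply/(ae_eq_integral_abs P measurableT mxs).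
    by rewrite -[RHS]int0; apply: eq_integral => z _; rewrite gee0_abs.
  by apply: ae_imply => z /(_ I).
apply: ae_imply => z z0; set v := q z - p z.
pose g t := phi (p z + t *: v).
have kv0 : 0 < k * `|v| + 1 by rewrite ltr_wpDl// mulr_ge0// ltW.
have gk : bounded_slope (k * `|v| + 1) g.
  move=> s t; rewrite (le_trans (phik _ _))//.
  rewrite opprD addrACA subrr add0r -scalerBl normrZ mulrDl mul1r.
  by rewrite [`|s - t| * _]mulrC mulrA lerDl.
have [h [hi gh h01]] := lipschitz_unit_FTC kv0 gk.
have -> : phi (q z) - phi (p z) = g 1 - g 0.
  by rewrite /g scale1r scale0r addr0 /v subrKC.
have mD i : measurable_fun setT (partial i phi).
  exact: measurable_derive phik _.
pose w (t : R) := dotv v (grad phi (p z + t *: v)).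
have ml : measurable_fun setT (fun t : R => p z + t *: v).
  by apply: measurable_rVD => //; exact: measurable_rVZ.
have mw : measurable_fun setT w.
  rewrite /w /dotv; apply: measurable_sum => i.
  under eq_fun do rewrite [(grad _ _) 0 i]mxE.
  by apply: measurable_funM => //; exact: (measurableT_comp (mD i) ml).
have wb t : `|w t| <= n%:R * k * `|v| by exact: dotv_grad_bound.
rewrite -h01 (Rintegral_unit_itv mw wb) /Rintegral; congr fine.
have mI : measurable (`[0 : R, 1]%classic) by exact: measurable_itv.
have mz : measurable (xsection (X @^-1` N) z) by exact: measurable_xsection.
apply: ae_eq_integral => //.
- exact/measurable_EFinP/measurable_funTS.
- exact: measurable_funTS (measurable_int _ hi).
have Nz : lebesgue_measure.-negligible (xsection (X @^-1` N) z `&` `[0 : R, 1]%classic).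
  by apply/negligibleP => //; exact: measurableI.
have N1 (r : R) : lebesgue_measure.-negligible [set r].
  by apply/negligibleP => //; exact: lebesgue_measure_set1.
apply: negligibleS
  (negligibleU (negligibleU Nz gh) (negligibleU (N1 0) (N1 1))).
move=> t /not_implyP[tI wh]; apply: contrapT => /not_orP[/not_orP[tN tg] t01].
apply: wh => /=; congr EFin.
have t01' : 0 < t < 1.
  move: tI; rewrite /= in_itv/= => /andP[]; rewrite !le_eqVlt.
  move=> /predU1P[t0|->]; first by case: t01; left.
  by move=> /predU1P[t1|->//]; case: t01; right.
have /is_derive_line[_ <-] : is_derive t 1 g (h t) by move: tg => /contrapT; exact.
have XtN : ~ N (p z + t *: v).
  by move=> Nt; apply: tN; split => //; rewrite /xsection/= inE.
by have [_ ->] : is_derive (p z + t *: v) v phi (w t)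
  by apply: contrapT => nD; apply: XtN; apply: DN => H; exact: nD.
Qed.

(** [F] is the density of the vector measure carried by the segments from [p z] to
    [q z] with weight [theta z]. Each segment is run through in unit time at
    speed [q z - p z], so a set that the segments meet only before the time
    [eta] carries a mass proportional to [eta]. *)
Lemma flow_field : exists F : E -> E, [/\ measurable_fun setT F,
  forall i, leb.-integrable setT (EFin \o (fun x => F x 0 i)),
  forall (phi : E -> R) (k : R), 0 < k -> bounded_slope k phi ->
    \int[leb]_x dotv (F x) (grad phi x) =
    \int[P]_z (theta z * (phi (q z) - phi (p z))) &
  forall (N : set E) (eta : R), measurable N -> 0 <= eta <= 1 ->
    (forall z t, theta z != 0 -> 0 < t < 1 ->
       N (p z + t *: (q z - p z)) -> t <= eta) ->
    forall i, \int[leb]_(x in N) `|F x 0 i| <= M * eta * fine (P setT)].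
Proof.
have /choice[f Hf] i := @superposition_density _ _ _ _ _ leb PI X (V i) mX (Vi i) X0.
have fi i : leb.-integrable setT (EFin \o f i) by have [] := Hf i.
have mf i : measurable_fun setT (f i).
  by apply/measurable_EFinP; exact: measurable_int (fi i).
have rowE x i : (\row_j f j x) 0 i = f i x by rewrite mxE.
exists (fun x => \row_i f i x); split.
- by apply: measurable_fun_rV => i; under eq_fun do rewrite rowE; exact: mf.
- move=> i; rewrite (_ : (fun x => _) = f i); first exact: fi.
  by apply/funext => x; rewrite rowE.
- move=> phi k k0 phik.
  have mD i : measurable_fun setT (partial i phi).
    exact: measurable_derive phik _.
  have Dk i x : `|partial i phi x| <= k by exact: partial_bound.
  have mDX i : measurable_fun setT (fun z => partial i phi (X z)).
    exact: (measurableT_comp (mD i) mX).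
  transitivity (\int[PI]_z \sum_(i < n) (partial i phi (X z) * V i z)).
    rewrite [RHS]Rintegral_sum//; last first.
      move=> i; apply: (@integrableM_bounded _ _ _ PI setT
        (fun z => partial i phi (X z)) (V i) k) => //.
    under eq_Rintegral do rewrite /dotv.
    rewrite Rintegral_sum//.
      apply: eq_bigr => i _; have [_ fE _] := Hf i.
      rewrite -(fE (partial i phi) k)//.
      by apply: eq_Rintegral => x _; rewrite !mxE mulrC.
    move=> i; rewrite (_ : _ \o _ = EFin \o (fun x => partial i phi x * f i x)).
      by apply: (@integrableM_bounded _ _ _ leb setT (partial i phi) (f i) k).
    by apply/funext => x; rewrite /= !mxE mulrC.
  have WE z t : \sum_(i < n) (partial i phi (X (z, t)) * V i (z, t)) =
      theta z * dotv (q z - p z) (grad phi (X (z, t))).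
    rewrite /dotv mulr_sumr; apply: eq_bigr => i _.
    by rewrite [(grad _ _) 0 i]mxE mulrC mulrA.
  pose W z := \sum_(i < n) (partial i phi (X z) * V i z).
  have mW : measurable_fun setT W.
    by apply: measurable_sum => i; apply: measurable_funM; [exact: mDX|exact: mV].
  have WM z : `|W z| <= n%:R * (k * M).
    rewrite /W (le_trans (ler_norm_sum _ _ _))//.
    rewrite (@le_trans _ _ (\sum_(i < n) (k * M)))//.
      by apply: ler_sum => i _; rewrite normrM ler_pM// VM.
    by rewrite sumr_const card_ord mulr_natl.
  have Wi := integrable_bounded measurableT PIoo mW WM.
  rewrite /Rintegral -(integral12_prod_meas1 Wi); congr fine.
  have mphi : measurable_fun setT phi.
    by apply: continuous_measurable_rV; exact: bounded_slope_continuous k0 phik.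
  apply: ae_eq_integral => //.
  + exact: (measurable_fubini_F Wi).
  + apply/measurable_EFinP; apply: measurable_funM => //.
    by apply: measurable_funB; exact: measurableT_comp.
  have := segment_FTC k0 phik; apply: ae_imply => z zE _ /=; rewrite /fubini_F.
  have mWz : measurable_fun setT (fun t => W (z, t)).
    exact: (measurableT_comp mW).
  have I01oo : (I01 setT < +oo)%E by rewrite -ge0_fin_numE// fin_num_measure.
  have Wzi : I01.-integrable setT (EFin \o (fun t => W (z, t))).
    exact: (integrable_bounded measurableT I01oo mWz (fun t => WM (z, t))).
  rewrite -[LHS]fineK; last exact: integrable_fin_num.
  congr EFin; rewrite -zE -[LHS]/(\int[I01]_t W (z, t)).
  under eq_Rintegral do rewrite /W WE.
  rewrite RintegralZl//.
  have mv : measurable_fun setT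
      (fun t => dotv (q z - p z) (grad phi (X (z, t)))).
    rewrite /dotv; apply: measurable_sum => j.
    under eq_fun do rewrite [(grad _ _) 0 j]mxE.
    apply: measurable_funM => //.
    exact: (measurableT_comp (mDX j) (pair1_measurable z)).
  apply: (integrable_bounded measurableT I01oo mv) => t.
  exact: (dotv_grad_bound k0 phik).
- move=> N eta mN eta01 Neta i.
  have [_ _ fN] := Hf i.
  under eq_Rintegral do rewrite rowE.
  rewrite (le_trans (fN _ mN))//.
  pose S : set (T * measurableTypeR R) :=
    setT `*` [set t : R | (t <= eta) || ~~ (0 < t < 1)].
  have mS2 : measurable ([set t : R | (t <= eta) || ~~ (0 < t < 1)]).
    exact: measurable_unit_itv_le.
  have mS : measurable S by exact: measurableX.
  have mXN : measurable (X @^-1` N) by rewrite -[X in measurable X]setTI; exact: mX.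
  have VS z : (X @^-1` N) z -> `|V i z| <= M * \1_S z.
    move=> XNz; have [zS|zS] := boolP (z \in S); rewrite indicE.
      by rewrite zS mulr1 VM.
    rewrite (negbTE zS) mulr0; have [th0|th0] := eqVneq (theta z.1) 0.
      by rewrite /V th0 mul0r normr0.
    exfalso; move: zS; rewrite notin_setE; apply; split => //=.
    apply/orP; have [z2|z2] := boolP (0 < (z.2 : R) < 1); last by right.
    by left; exact: (Neta z.1 z.2).
  have Si : PI.-integrable setT (EFin \o (\1_S : _ -> R)).
    exact: integrable_indic.
  have MSi : PI.-integrable setT (EFin \o (fun z => M * \1_S z)).
    rewrite (_ : EFin \o _ = fun z => (M%:E * (\1_S z)%:E)%E)//.
    exact: integrableZl.
  have SE : \int[PI]_z (M * \1_S z) <= M * eta * fine (P setT).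
    rewrite RintegralZl// -mulrA ler_wpM2l// /Rintegral integral_indic// setIT.
    rewrite [X in fine X]finite_productX// fineM ?fin_num_measure// mulrC.
    rewrite ler_wpM2r ?fine_ge0// -lee_fin fineK ?fin_num_measure//.
    exact: unit_itv_measure_le.
  have nVi : PI.-integrable (X @^-1` N) (EFin \o (fun z => `|V i z|)).
    by apply: integrable_norm; exact: integrableS (Vi i).
  apply: le_trans SE; rewrite Rintegral_mkcond; apply: le_Rintegral => //.
  + by move/(integrable_mkcond _ mXN) : nVi; rewrite restrict_EFin.
  + move=> z _; rewrite patchE; case: ifPn => [|_]; last first.
      by rewrite mulr_ge0.
    by rewrite inE; exact: VS.
Qed.

End flow.

(** * Cones at the points of a Lipschitz boundary *)

Section boundary_cones.
Context {R : realType} {n : nat}.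
Local Notation E := 'rV[R]_n.
Implicit Types (v w x y : E) (A : set E).

Lemma norm_le_enorm v : `|v| <= enorm v.
Proof.
apply: norm_le_coord => [|i]; first exact: sqrtr_ge0.
rewrite -sqrtr_sqr ler_sqrt; last by rewrite sumr_ge0// => j _; exact: sqr_ge0.
rewrite /dotv (bigD1 i)//= -expr2 lerDl sumr_ge0// => j _.
exact: sqr_ge0.
Qed.

Lemma enorm_le_sum v : enorm v <= \sum_(i < n) `|v 0 i|.
Proof.
have s0 : 0 <= \sum_(i < n) `|v 0 i| by rewrite sumr_ge0.
rewrite /enorm -[leRHS]ger0_norm// -sqrtr_sqr ler_sqrt ?sqr_ge0//.
rewrite /dotv expr2 mulr_suml; apply: ler_sum => i _.
rewrite -[leLHS]ger0_norm -?expr2 ?sqr_ge0// normrX expr2 ler_wpM2l//.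
by rewrite (bigD1 i)//= lerDl sumr_ge0.
Qed.

Lemma enorm_le_norm v : enorm v <= n%:R * `|v|.
Proof.
rewrite (le_trans (enorm_le_sum v))//.
rewrite (@le_trans _ _ (\sum_(i < n) `|v|))//.
  by apply: ler_sum => i _; exact: coord_le_norm.
by rewrite sumr_const card_ord mulr_natl.
Qed.

Lemma lipschitz_bounded_slope (V : normedModType R) (f : V -> R) :
  lipschitz f -> exists2 k, 0 < k & bounded_slope k f.
Proof.
move=> [M [_ Mf]]; exists (Num.max M 0 + 1).
  by rewrite ltr_wpDl// le_max lexx orbT.
by move=> x y; apply: (Mf _ _ (x, y)) => //; rewrite ltr_pwDr// le_max lexx.
Qed.

Lemma boundary_notin A x : open A -> topo_boundary A x -> ~ A x.
Proof. by move=> oA [_ nx] Ax; apply: nx; apply: open_nbhs_nbhs; split. Qed.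

Lemma boundary_meets A x (e : R) : 0 < e -> topo_boundary A x ->
  exists2 y, A y & `|y - x| < e.
Proof.
move=> e0 [cx _]; have [y [Ay xy]] := cx _ (nbhsx_ballx x e e0).
by exists y => //; rewrite distrC; move: xy; rewrite -ball_normE.
Qed.

Lemma mulmx_bound (O : 'M[R]_n) : exists2 K : R, 1 <= K &
  forall v, `|v *m O| <= K * `|v|.
Proof.
exists (1 + \sum_i \sum_j `|O i j|).
  by rewrite lerDl sumr_ge0// => i _; rewrite sumr_ge0.
move=> v; apply: norm_le_coord => [|j].
  by rewrite mulr_ge0// addr_ge0// sumr_ge0// => i _; rewrite sumr_ge0.
rewrite mxE (le_trans (ler_norm_sum _ _ _))//.
rewrite (@le_trans _ _ (\sum_i `|v| * `|O i j|))//.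
  by apply: ler_sum => i _; rewrite normrM ler_wpM2r// coord_le_norm.
rewrite -mulr_sumr mulrC ler_wpM2r//.
rewrite (@le_trans _ _ (\sum_i \sum_j `|O i j|))//; last by rewrite lerDr.
apply: ler_sum => i _; rewrite (bigD1 j)//= lerDl sumr_ge0//.
Qed.

Lemma col'_norm (k : 'I_n) v : `|col' k v| <= `|v|.
Proof. by apply: norm_le_coord => // j; rewrite mxE coord_le_norm. Qed.

(** Above a Lipschitz graph there is a vertical cone, and below it the opposite
    one; both keep a fixed opening when their vertex moves along the graph, so
    that one box on each side is seen from all nearby boundary points. *)
Lemma boundary_cones A x0 : open A -> lipschitz_boundary A ->
  topo_boundary A x0 ->
  exists (r rho : R) (a b : E), [/\ 0 < r, 0 < rho &
    forall y w (t : R), topo_boundary A y -> `|y - x0| < r -> `|w| <= 2 ->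
      0 < t <= 1 ->
      A (y + t *: (a + rho *: w - y)) /\ ~ A (y + t *: (b + rho *: w - y))].
Proof.
move=> oA lipA bx0.
have [ O [k [g [s [ O1 /lipschitz_bounded_slope[L L0 gL] s0 Ag]]]]] := lipA _ bx0.
have [K K1 OK] := mulmx_bound O.
have K0 : 0 < K by exact: lt_le_trans K1.
(* [e] is the vertical direction of the chart; the height [h] keeps all the
   points considered inside the chart; [c] bounds the remaining displacement,
   and [K c (1 + L) < h], so that it cannot make up for the height [h] *)
pose e : E := delta_mx 0 k *m O^T.
have eO : e *m O = delta_mx 0 k by rewrite -mulmxA (mulmx1C O1) mulmx1.
pose h := s / (n%:R * (`|e| + 2) + 1).
have D0 : 0 < n%:R * (`|e| + 2) + 1 by rewrite ltr_wpDl// mulr_ge0// addr_ge0.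
have h0 : 0 < h by rewrite divr_gt0.
pose c := h / (2 * K * (1 + L)).
have KL0 : 0 < 2 * K * (1 + L) by rewrite !mulr_gt0// addr_gt0.
have c0 : 0 < c by rewrite divr_gt0.
have cKL : K * c * (1 + L) = h / 2.
  by rewrite /c; field; rewrite !gt_eqF//= ltr_wpDr// ltW.
have ch : c <= h.
  rewrite /c ler_pdivrMr// ler_peMr// ?ltW//.
  by have := L0; have := K1; nra.
have near_s z : `|z - x0| <= h * (`|e| + 2) -> enorm (z - x0) < s.
  move=> zx; rewrite (le_lt_trans (enorm_le_norm _))//.
  rewrite (@le_lt_trans _ _ (n%:R * (h * (`|e| + 2))))//; first exact: ler_wpM2l.
  rewrite [ltRHS](_ : s = h * (n%:R * (`|e| + 2) + 1)); last first.
    by rewrite /h divfK// gt_eqF.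
  rewrite [ltRHS](_ : _ = n%:R * (h * (`|e| + 2)) + h); last by ring.
  by rewrite ltrDl.
exists (c / 2), (c / 4), (x0 + h *: e), (x0 - h *: e).
split; rewrite ?divr_gt0// => y w t yA yx w2 /andP[t0 t1].
(* [y] is on the graph: it is not in [A], but points of [A] come close to it *)
have gy_ge : (y *m O) 0 k <= g (col' k (y *m O)).
  rewrite leNgt; apply/negP => /Ag Ay; apply: (boundary_notin oA yA); apply: Ay.
  apply: near_s; rewrite (le_trans (ltW yx))//.
  have := normr_ge0 e; nra.
have gy_le : g (col' k (y *m O)) <= (y *m O) 0 k.
  rewrite leNgt; apply/negP => gt_y.
  pose d := g (col' k (y *m O)) - (y *m O) 0 k.
  have d0 : 0 < d by rewrite subr_gt0.
  have KL : 0 < K * (1 + L) by rewrite mulr_gt0// addr_gt0.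
  pose dl := Num.min (d / (K * (1 + L))) (c / 2).
  have dl0 : 0 < dl by rewrite lt_min !divr_gt0.
  have [y' Ay' yy'] := boundary_meets dl0 yA.
  have dlc : dl <= c / 2 by rewrite ge_min lexx orbT.
  have dld : K * (1 + L) * dl <= d.
    by rewrite mulrC -ler_pdivlMr// ge_min lexx.
  have : g (col' k (y' *m O)) < (y' *m O) 0 k.
    apply/Ag => //; apply: near_s.
    rewrite (le_trans (ler_distD y _ _))//.
    have := normr_ge0 e; nra.
  have yO : `|(y' - y) *m O| <= K * dl.
    by rewrite (le_trans (OK _))// ler_wpM2l ?ltW.
  have := gL (col' k (y' *m O)) (col' k (y *m O)).
  have -> : col' k (y' *m O) - col' k (y *m O) = col' k ((y' - y) *m O).
    by rewrite mulmxBl; apply/matrixP => i j; rewrite !mxE.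
  have := le_trans (col'_norm k _) yO.
  have := le_trans (coord_le_norm _ k) yO.
  have -> : ((y' - y) *m O) 0 k = (y' *m O) 0 k - (y *m O) 0 k.
    by rewrite mulmxBl !mxE.
  move=> /ler_normlP[_ H1] H2 /ler_normlP[H3 _] H4.
  have : L * `|col' k ((y' - y) *m O)| <= L * (K * dl) by rewrite ler_wpM2l// ltW.
  rewrite /d in dld; nra.
pose u := x0 - y + (c / 4) *: w.
have uc : `|u| <= c.
  rewrite (le_trans (ler_normD _ _))// distrC normrZ gtr0_norm ?divr_gt0//.
  nra.
have uO : `|u *m O| <= K * c by rewrite (le_trans (OK _))// ler_wpM2l// ltW.
(* the two points are [y + t (sg h e + u)] with [sg = 1] and [sg = -1] *)
have zE (sg : R) : y + t *: (x0 + (sg * h) *: e + (c / 4) *: w - y) =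
    y + t *: ((sg * h) *: e + u).
  congr (_ + _ *: _); rewrite /u [x0 + _ *: e]addrC -!addrA.
  by congr (_ + (_ + _)); rewrite addrC.
have z_near (sg : R) : `|sg| = 1 ->
    enorm (y + t *: ((sg * h) *: e + u) - x0) < s.
  move=> sg1; apply: near_s; rewrite addrAC (le_trans (ler_normD _ _))//.
  rewrite normrZ gtr0_norm//.
  have : `|(sg * h) *: e + u| <= h * `|e| + c.
    rewrite (le_trans (ler_normD _ _))// normrZ normrM sg1 mul1r gtr0_norm//.
    by rewrite lerD.
  have := ler_piMl (normr_ge0 ((sg * h) *: e + u)) t1.
  lra.
have zk (sg : R) : ((y + t *: ((sg * h) *: e + u)) *m O) 0 k =
    (y *m O) 0 k + t * (sg * h + (u *m O) 0 k).
  rewrite mulmxDl -scalemxAl mulmxDl -scalemxAl eO !mxE !eqxx mulr1.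
  by [].
have zg (sg : R) : `|g (col' k ((y + t *: ((sg * h) *: e + u)) *m O)) -
    g (col' k (y *m O))| <= L * (t * (K * c)).
  rewrite (le_trans (gL _ _))// ler_wpM2l ?(ltW L0)//.
  have -> : col' k ((y + t *: ((sg * h) *: e + u)) *m O) - col' k (y *m O) =
      t *: col' k (u *m O).
    rewrite mulmxDl -scalemxAl mulmxDl -scalemxAl eO.
    apply/matrixP => i j; rewrite !mxE [lift k j == k]eq_sym.
    by rewrite (negbTE (neq_lift _ _)) andbF mulr0 add0r addrAC subrr add0r.
  by rewrite normrZ gtr0_norm// ler_wpM2l ?(ltW t0)// (le_trans (col'_norm _ _)).
have /ler_normlP[uk1 uk2] := le_trans (coord_le_norm _ k) uO.
split.
- have := zE 1; rewrite mul1r => ->; apply/Ag.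
    by have := z_near 1 (normr1 _); rewrite mul1r.
  have := zk 1; have /ler_normlP[_] := zg 1; rewrite !mul1r => + ->.
  nra.
- have := zE (-1); rewrite mulN1r scaleNr => ->.
  move=> /Ag; have := zk (-1); have /ler_normlP[+ _] := zg (-1).
  have := z_near (-1); rewrite normrN1 mulN1r scaleNr => /(_ erefl) zn + -> => zg' /(_ zn).
  nra.
Qed.

End boundary_cones.

(** * Transport between boxes *)

Section fields.
Context {R : realType} {n : nat}.
Local Notation E := 'rV[R]_n.
Local Notation leb := (@lebesgue_rV R n).
Implicit Types (F G : E -> E) (phi : E -> R) (N : set E).

Definition integrable_field F := measurable_fun setT F /\
  forall i, leb.-integrable setT (EFin \o (fun x => F x 0 i)).

(** For a Lipschitz [phi] this is minus the distributional divergence of [F],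
    tested against [phi]. *)
Definition pairing F phi : R := \int[leb]_x dotv (F x) (grad phi x).

Definition mass F N (i : 'I_n) : R := \int[leb]_(x in N) `|F x 0 i|.

Definition bounded_lipschitz phi := (exists2 k, 0 < k & bounded_slope k phi) /\
  exists M, forall x, `|phi x| <= M.

Lemma integrable_fieldD F G : integrable_field F -> integrable_field G ->
  integrable_field (fun x => F x + G x).
Proof.
move=> [mF iF] [mG iG]; split; first exact: measurable_rVD.
move=> i; rewrite (_ : EFin \o _ =
    (EFin \o (fun x => F x 0%R i)) \+ (EFin \o (fun x => G x 0%R i)))%E.
  exact: integrableD.
by apply/funext => x; rewrite /= mxE EFinD.
Qed.

Lemma integrable_fieldZ (c : R) F : integrable_field F ->
  integrable_field (fun x => c *: F x).
Proof.
move=> [mF iF]; split; first exact: measurable_rVZ.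
move=> i; rewrite (_ : EFin \o _ = (fun x => c%:E * (F x 0%R i)%:E)%E).
  by apply: integrableZl => //; exact: iF.
by apply/funext => x; rewrite /= mxE EFinM.
Qed.

Lemma integrable_field0 : integrable_field (fun=> 0).
Proof.
split; first exact: measurable_cst.
move=> i; rewrite (_ : EFin \o _ = cst 0%E); first exact: integrable0.
by apply/funext => x; rewrite /= mxE.
Qed.

Lemma integrable_pairing F phi k : 0 < k -> bounded_slope k phi ->
  integrable_field F ->
  leb.-integrable setT (EFin \o (fun x => dotv (F x) (grad phi x))).
Proof.
move=> k0 phik [mF iF].
rewrite (_ : EFin \o _ =
    (fun x => \sum_(i < n) (partial i phi x * F x 0%R i)%:E)%E); last first.
  apply/funext => x; rewrite /= /dotv sumEFin; congr EFin.
  by apply: eq_bigr => i _; rewrite [(grad _ _) 0 i]mxE mulrC.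
apply: integrable_sum => // i _.
apply: (@integrableM_bounded _ _ _ leb setT (partial i phi) (fun x => F x 0 i) k) => //.
- exact: measurable_derive phik _.
- by move=> x; exact: partial_bound.
Qed.

Lemma pairingD F G phi k : 0 < k -> bounded_slope k phi ->
  integrable_field F -> integrable_field G ->
  pairing (fun x => F x + G x) phi = pairing F phi + pairing G phi.
Proof.
move=> k0 phik fF fG; rewrite /pairing -RintegralD//; last 2 first.
- exact: integrable_pairing phik fF.
- exact: integrable_pairing phik fG.
apply: eq_Rintegral => x _; rewrite /dotv -big_split/=.
by apply: eq_bigr => i _; rewrite mxE mulrDl.
Qed.

Lemma pairingZ (c : R) F phi k : 0 < k -> bounded_slope k phi ->
  integrable_field F -> pairing (fun x => c *: F x) phi = c * pairing F phi.
Proof.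
move=> k0 phik fF; rewrite /pairing -RintegralZl//; last first.
  exact: integrable_pairing phik fF.
apply: eq_Rintegral => x _; rewrite /dotv mulr_sumr.
by apply: eq_bigr => i _; rewrite mxE mulrA.
Qed.

Lemma pairing0 phi : pairing (fun=> 0) phi = 0.
Proof.
transitivity (\int[leb]_(x in setT) cst (0 : R) x).
  apply: eq_Rintegral => x _; rewrite /dotv big1// => i _.
  by rewrite mxE mul0r.
by rewrite Rintegral_cst// mul0r.
Qed.

Lemma integrable_mass F N i : integrable_field F -> measurable N ->
  leb.-integrable N (EFin \o (fun x => `|F x 0 i|)).
Proof.
by move=> [_ iF] mN; apply: integrable_norm; exact: integrableS (iF i).
Qed.

Lemma mass_ge0 F N i : 0 <= mass F N i.
Proof. by apply: Rintegral_ge0. Qed.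

Lemma massD F G N i : measurable N -> integrable_field F -> integrable_field G ->
  mass (fun x => F x + G x) N i <= mass F N i + mass G N i.
Proof.
move=> mN fF fG; rewrite /mass -RintegralD//; try exact: integrable_mass.
apply: le_Rintegral => //.
- exact: integrable_mass (integrable_fieldD fF fG) mN.
- rewrite (_ : EFin \o _ = (EFin \o (fun x => `|F x 0%R i|%R)) \+
    (EFin \o (fun x => `|G x 0%R i|%R)))%E//.
  by apply: integrableD => //; exact: integrable_mass.
- by move=> x _; rewrite mxE ler_normD.
Qed.

Lemma massZ (c : R) F N i : measurable N -> integrable_field F ->
  mass (fun x => c *: F x) N i = `|c| * mass F N i.
Proof.
move=> mN fF; rewrite /mass -RintegralZl//; last exact: integrable_mass.
by apply: eq_Rintegral => x _; rewrite mxE normrM.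
Qed.

Lemma le_Rintegral_subset (f : E -> R) (A B : set E) : measurable A ->
  measurable B -> A `<=` B -> leb.-integrable B (EFin \o f) ->
  (forall x, 0 <= f x) -> \int[leb]_(x in A) f x <= \int[leb]_(x in B) f x.
Proof.
move=> mA mB AB fi f0; rewrite /Rintegral fine_le//.
- by apply: integrable_fin_num => //; exact: integrableS fi.
- exact: integrable_fin_num.
apply: ge0_subset_integral => //; first exact: measurable_int fi.
by move=> x _; rewrite lee_fin.
Qed.

Lemma mass_le F (A B : set E) i : measurable A -> measurable B -> A `<=` B ->
  integrable_field F -> mass F A i <= mass F B i.
Proof.
move=> mA mB AB fF; apply: le_Rintegral_subset => //.
exact: integrable_mass.
Qed.

Lemma mass_eq0 F (A B : set E) i : measurable A -> measurable B -> A `<=` B ->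
  integrable_field F -> mass F B i = 0 -> mass F A i = 0.
Proof.
move=> mA mB AB fF B0; apply/eqP; rewrite eq_le mass_ge0 andbT -B0.
exact: mass_le.
Qed.

End fields.

Section uniform_box.
Context {R : realType} {n : nat}.
Local Notation E := 'rV[R]_n.
Local Notation leb := (@lebesgue_rV R n).

Definition unit_box : set E := box (fun=> `[0, 1]%classic).

Lemma measurable_unit_box : measurable unit_box.
Proof. by apply: measurable_box => i; exact: measurable_itv. Qed.

Lemma lebesgue_unit_box : leb unit_box = 1%E.
Proof.
rewrite lebesgue_rV_boxE; last by move=> i; exact: measurable_itv.
by rewrite big1// => i _; exact: lebesgue_unit_itv.
Qed.

Let unit_box_lty : (leb unit_box < +oo)%E.
Proof. by rewrite lebesgue_unit_box ltry. Qed.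

Definition unif : {finite_measure set E -> \bar R} :=
  mfrestr measurable_unit_box unit_box_lty.

Lemma unifT : unif setT = 1%E.
Proof. by rewrite /unif /= /mfrestr /mrestr setTI lebesgue_unit_box. Qed.

Lemma unif_unit_box : unif unit_box = 1%E.
Proof. by rewrite /unif /= /mfrestr /mrestr setIid lebesgue_unit_box. Qed.

Lemma unit_box_norm w : unit_box w -> `|w| <= 1.
Proof.
move=> wQ; apply: norm_le_coord => // i; have := wQ i.
by rewrite /= in_itv/= => /andP[w0 w1]; rewrite ger0_norm.
Qed.

Lemma unif_affine0 (a : E) (c : R) (N : set E) : 0 < c -> measurable N ->
  leb N = 0%E -> unif [set w | N (a + c *: w)] = 0%E.
Proof.
move=> c0 mN N0.
have mf : measurable_fun setT (fun w : E => a + c *: w).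
  by apply: measurable_rVD => //; exact: measurable_rVZ.
have mA : measurable [set w | N (a + c *: w)].
  by rewrite -[X in measurable X]setTI; exact: mf.
have A0 : leb [set w | N (a + c *: w)] = 0%E.
  have := @lebesgue_rV_affine R n a c N c0 mN; rewrite N0 => /eqP.
  by rewrite mule_eq0 eqe gt_eqF ?exprn_gt0//= => /eqP.
apply/eqP; rewrite eq_le measure_ge0 andbT -A0.
apply: le_measure; rewrite ?inE//.
by apply: measurableI => //; exact: measurable_unit_box.
Qed.

(** The indicator is equal to [1] almost surely; it makes the weight of the
    segments vanish for every [w] outside of the unit box. *)
Definition box_mean (a : E) (rho : R) (phi : E -> R) : R :=
  \int[unif]_w (\1_unit_box w * phi (a + rho *: w)).

Lemma measurable_affine (a : E) (c : R) :
  measurable_fun setT (fun w : E => a + c *: w).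
Proof. by apply: measurable_rVD => //; exact: measurable_rVZ. Qed.

Lemma indic_bound (A : set E) w : `|\1_A w : R| <= 1.
Proof. by rewrite indicE ger0_norm// lern1 leq_b1. Qed.

(** Affine maps of positive ratio pull back null sets to null sets, so the uniform
    distribution on a box has a density. *)
Lemma box_mean_density (a : E) (rho : R) : 0 < rho ->
  exists g : E -> R, [/\ leb.-integrable setT (EFin \o g),
    forall (phi : E -> R) (M : R), measurable_fun setT phi ->
      (forall x, `|phi x| <= M) ->
      \int[leb]_x (phi x * g x) = box_mean a rho phi &
    forall N, measurable N -> (forall w, unit_box w -> ~ N (a + rho *: w)) ->
      \int[leb]_(x in N) `|g x| = 0].
Proof.
move=> rho0; have mX := measurable_affine a rho.
have Vi : unif.-integrable setT (EFin \o (\1_unit_box : E -> R)).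
  by apply: integrable_indic; exact: measurable_unit_box.
have [g [gi gE gN]] := @superposition_density _ _ _ _ _ leb unif _
  (\1_unit_box : E -> R) mX Vi (fun N mN N0 => unif_affine0 a rho0 mN N0).
exists g; split => //.
- move=> phi M mphi phiM; rewrite (gE phi M)//.
  by apply: eq_Rintegral => w _; rewrite mulrC.
- move=> N mN QN; apply/eqP; rewrite eq_le Rintegral_ge0// andbT.
  rewrite (le_trans (gN _ mN))//.
  have mXN : measurable ((fun w => a + rho *: w) @^-1` N).
    by rewrite -[X in measurable X]setTI; exact: mX.
  rewrite [leLHS](_ : _ = \int[unif]_(w in (fun w => a + rho *: w) @^-1` N)
      cst (0 : R) w); first by rewrite Rintegral_cst// mul0r.
  apply: eq_Rintegral => w /set_mem Nw.
  by rewrite indicE memNset ?normr0// => /QN.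
Qed.

End uniform_box.

Section linked_boxes.
Context {R : realType} {n : nat}.
Local Notation E := 'rV[R]_n.
Local Notation leb := (@lebesgue_rV R n).
Local Notation Q := (@unit_box R n).

Definition thickening (B : set E) (delta : R) : set E :=
  [set x | exists2 y, B y & `|x - y| < delta].

Lemma open_thickening B delta : open (thickening B delta).
Proof.
rewrite (_ : thickening B delta = \bigcup_(y in B) ball y delta).
  by apply: bigcup_open => y _; exact: ball_open.
apply/seteqP; split => x [y By xy]; exists y => //.
  by rewrite -ball_normE /= distrC.
by move: xy; rewrite -ball_normE /= distrC.
Qed.

Lemma measurable_thickening B delta : measurable (thickening B delta).
Proof. by apply: open_measurable_rV; exact: open_thickening. Qed.

Lemma subset_thickening B d1 d2 : d1 <= d2 ->
  thickening B d1 `<=` thickening B d2.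
Proof. by move=> d12 x [y By xy]; exists y => //; exact: lt_le_trans d12. Qed.

Variable A : set E.
Local Notation collar := (thickening (~` A)).

(** [G] is a flow from the first box to the second one. It vanishes near the
    complement of [A] so that adding it to a field does not change the field
    near the boundary of [A]. *)
Definition linked (a : E) (rho : R) (b : E) (rho' : R) :=
  exists (G : E -> E) (delta : R), [/\ integrable_field G, 0 < delta,
    forall phi, bounded_lipschitz phi ->
      pairing G phi = box_mean b rho' phi - box_mean a rho phi &
    forall i, mass G (collar delta) i = 0].

Lemma linked_sym a rho b rho' : linked a rho b rho' -> linked b rho' a rho.
Proof.
move=> [G [d [fG d0 GE G0]]]; exists (fun x => (-1) *: G x), d; split => //.
- exact: integrable_fieldZ.
- move=> phi phiL; have [[k k0 phik] _] := phiL.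
  by rewrite (pairingZ _ k0 phik)// GE// mulN1r opprB.
- by move=> i; rewrite massZ ?G0 ?mulr0//; exact: measurable_thickening.
Qed.

Lemma linked_trans a rho b rho' c rho'' :
  linked a rho b rho' -> linked b rho' c rho'' -> linked a rho c rho''.
Proof.
move=> [G [d [fG d0 GE G0]]] [H [d' [fH d'0 HE H0]]].
exists (fun x => G x + H x), (Num.min d d'); split => //.
- exact: integrable_fieldD.
- by rewrite lt_min d0.
- move=> phi phiL; have [[k k0 phik] _] := phiL.
  by rewrite (pairingD k0 phik)// GE// HE// addrC addrA subrK.
- move=> i; apply/eqP; rewrite eq_le mass_ge0 andbT.
  rewrite (le_trans (massD _ _ _ _))//; first exact: measurable_thickening.
  rewrite (mass_eq0 _ _ _ _ (G0 i))//; last 3 first.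
  - exact: measurable_thickening.
  - exact: measurable_thickening.
  - by apply: subset_thickening; rewrite ge_min lexx.
  rewrite (mass_eq0 _ _ _ _ (H0 i)) ?addr0//.
  - exact: measurable_thickening.
  - exact: measurable_thickening.
  - by apply: subset_thickening; rewrite ge_min lexx orbT.
Qed.

(** Inside a ball the straight segments between corresponding points of two
    boxes do the transport. *)
Lemma linked_ball (c : E) (r : R) a rho b rho' :
  (forall x, `|x - c| < r -> A x) -> 0 < r -> 0 < rho -> 0 < rho' ->
  (forall w, Q w -> `|a + rho *: w - c| <= r / 2) ->
  (forall w, Q w -> `|b + rho' *: w - c| <= r / 2) -> linked a rho b rho'.
Proof.
move=> Ac r0 rho0 rho'0 aQ bQ.
have mQ : measurable Q by exact: measurable_unit_box.
have mI : measurable_fun setT (\1_Q : E -> R) by exact: measurable_indic.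
have mp := measurable_affine a rho; have mq := measurable_affine b rho'.
have pqM w : `|(\1_Q w : R) *: (b + rho' *: w - (a + rho *: w))| <= r.
  have [/set_mem wQ|wQ] := boolP (w \in Q); rewrite indicE.
    rewrite mem_set// scale1r [leRHS]splitr.
    rewrite (le_trans (ler_distD c _ _))// lerD ?bQ// distrC; exact: aQ.
  by rewrite (negbTE wQ) scale0r normr0 ltW.
have law0 (t : R) (N : set E) : 0 < t < 1 -> measurable N -> leb N = 0%E ->
    (@unif R n) [set w |
      N (a + rho *: w + t *: (b + rho' *: w - (a + rho *: w)))] = 0%E.
  move=> /andP[t0 t1] mN N0.
  have s0 : 0 < (1 - t) * rho + t * rho' by rewrite addr_gt0// mulr_gt0// subr_gt0.
  rewrite -(unif_affine0 ((1 - t) *: a + t *: b) s0 mN N0); congr (unif _).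
  apply/funext => w /=; congr N.
  by apply/rowP => j; rewrite !mxE; ring.
have [F [mF iF FE FN]] := flow_field mI mp mq (ltW r0) pqM law0.
exists F, (r / 2); split => //.
- by rewrite divr_gt0.
- move=> phi [[k k0 phik] [M phiM]]; rewrite /pairing (FE _ _ k0 phik).
  have mphi : measurable_fun setT phi.
    by apply: continuous_measurable_rV; exact: bounded_slope_continuous k0 phik.
  have unifoo : ((@unif R n) setT < +oo)%E by rewrite unifT ltry.
  have phii (x : E) (s : R) : (@unif R n).-integrable setT
      (EFin \o (fun w => \1_Q w * phi (x + s *: w))).
    apply: (@integrable_bounded _ _ _ _ _ _ M) => //.
      apply: measurable_funM => //.
      exact: (measurableT_comp mphi (measurable_affine x s)).
    move=> w; rewrite normrM -[leRHS]mul1r ler_pM//; exact: indic_bound.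
  rewrite /box_mean -RintegralB//.
  by apply: eq_Rintegral => w _; rewrite mulrBr.
- move=> i; apply/eqP; rewrite eq_le mass_ge0 andbT.
  have := FN (collar (r / 2)) 0 (measurable_thickening _ _) _ _ i.
  rewrite mulr0 mul0r; apply; first by rewrite lexx ler01.
  move=> w t Iw t01 [y nAy xy]; exfalso; apply: nAy; apply: Ac.
  have wQ : Q w.
    by move: Iw; rewrite indicE; case: (boolP (w \in Q)) => [/set_mem|_ /eqP].
  have /andP[t0 t1] := t01.
  rewrite (le_lt_trans (ler_distD (a + rho *: w +
     t *: (b + rho' *: w - (a + rho *: w))) _ _))//.
  rewrite [ltRHS]splitr distrC ltr_leD//.
  have -> : a + rho *: w + t *: (b + rho' *: w - (a + rho *: w)) - c =
      (1 - t) *: (a + rho *: w - c) + t *: (b + rho' *: w - c).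
    by apply/rowP => j; rewrite !mxE; ring.
  rewrite (le_trans (ler_normD _ _))// !normrZ gtr0_norm ?subr_gt0// gtr0_norm//.
  by have := aQ _ wQ; have := bQ _ wQ; nra.
Qed.

Hypotheses (oA : open A) (cA : connected A).

(** Being linked by all admissible boxes is an equivalence relation with open
    classes, so a connected open set forms a single class. *)
Lemma linked_connected a b rho rho' : 0 < rho -> 0 < rho' ->
  (forall x, `|x - a| < 2 * rho -> A x) ->
  (forall x, `|x - b| < 2 * rho' -> A x) -> linked a rho b rho'.
Proof.
pose adm (a : E) (rho : R) := 0 < rho /\ forall x, `|x - a| < 2 * rho -> A x.
move=> rho0 rho'0 aA bA.
have adm_ex x : A x -> exists r, adm x r.
  move=> Ax; have : nbhs x A by apply: open_nbhs_nbhs; split.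
  move=> /nbhs_ballP[r /= r0 xr]; exists (r / 2); split; first by rewrite divr_gt0.
  move=> y; rewrite mulrC divfK// => xy; apply: xr.
  by rewrite -ball_normE /= distrC.
pose eqv x y := forall r s, adm x r -> adm y s -> linked x r y s.
have box_in (x c : E) (r s : R) : 0 < s -> `|x - c| + s <= r -> forall w, Q w ->
    `|x + s *: w - c| <= r.
  move=> s0 xc w /unit_box_norm wQ; rewrite addrAC (le_trans (ler_normD _ _))//.
  rewrite normrZ gtr0_norm// (le_trans _ xc)// lerD2l.
  by rewrite ler_piMr// ltW.
have same x r s : adm x r -> adm x s -> linked x r x s.
  wlog rs : r s / r <= s.
    move=> H xr xs; have [rs|/ltW sr] := leP r s; first exact: H.
    by apply: linked_sym; exact: H.
  move=> [r0 xr] [s0 xs]; apply: (linked_ball xs) => //.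
  - by rewrite mulr_gt0.
  - by apply: box_in => //; rewrite subrr normr0 add0r mulrC mulKf.
  - by apply: box_in => //; rewrite subrr normr0 add0r mulrC mulKf.
have near x : A x -> exists2 r, 0 < r & forall y, `|y - x| < r -> A y /\ eqv x y.
  move=> Ax; have [r [r0 xr]] := adm_ex x Ax.
  exists (r / 2); first by rewrite divr_gt0.
  move=> y xy; have Ay : A y by apply: xr; lra.
  split => // s1 s2 xs1 ys2.
  have xr2 : adm x (r / 2) by split; [rewrite divr_gt0|move=> z ?; apply: xr; lra].
  have yr2 : adm y (r / 2).
    split; first by rewrite divr_gt0.
    by move=> z zy; apply: xr; rewrite (le_lt_trans (ler_distD y _ _))//; lra.
  apply: (linked_trans (same _ _ _ xs1 xr2)).
  apply: linked_trans (same _ _ _ yr2 ys2).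
  apply: (linked_ball xr); rewrite ?mulr_gt0 ?divr_gt0//.
  - by apply: box_in; rewrite ?divr_gt0// subrr normr0; lra.
  - by apply: box_in; rewrite ?divr_gt0//; lra.
have trans x y z : A y -> eqv x y -> eqv y z -> eqv x z.
  move=> Ay xy yz r s xr zs; have [u yu] := adm_ex y Ay.
  exact: linked_trans (xy _ _ xr yu) (yz _ _ yu zs).
have sym x y : eqv x y -> eqv y x.
  by move=> xy r s yr xs; apply: linked_sym; exact: xy.
have Aa : A a by apply: aA; rewrite subrr normr0 mulr_gt0.
have Ab : A b by apply: bA; rewrite subrr normr0 mulr_gt0.
suff BA : A `&` [set x | eqv a x] = A.
  have [_ ab] : (A `&` [set x | eqv a x]) b by rewrite BA.
  by apply: ab; split.
have openS (S : set E) : (forall x, S x -> exists2 r, 0 < r &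
    forall y, `|y - x| < r -> S y) -> open S.
  move=> Sx; rewrite openE => x /Sx[r r0 xr]; apply/nbhs_ballP; exists r => //.
  by move=> y; rewrite -ball_normE /= distrC; exact: xr.
apply: cA.
- by exists a; split => // r s; exact: same.
- exists (A `&` [set x | eqv a x]); last by rewrite setIA setIid.
  apply: openS => x [Ax ax]; have [r r0 xr] := near x Ax; exists r => // y /xr[Ay xy].
  by split => //; exact: trans xy.
- exists (~` (A `&` ~` [set x | eqv a x])).
    apply: open_closedC; apply: openS => x [Ax ax]; have [r r0 xr] := near x Ax.
    exists r => // y /xr[Ay xy]; split => // ay; apply: ax.
    by apply: (trans _ y) => //; exact: sym.
  by rewrite setCI setCK setIUr setICr set0U.
Qed.

End linked_boxes.

(** * Solutions for measures on pieces of the boundary *)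

Section cone_flow.
Context {R : realType} {n : nat}.
Local Notation E := 'rV[R]_n.
Local Notation leb := (@lebesgue_rV R n).
Local Notation Q := (@unit_box R n).
Local Notation U := (@unif R n).

(** The segments joining each point [y], weighted by [theta y * m], to a fixed
    box: the part of the resulting field that is close to [S] has a mass
    proportional to the distance from [S]. *)
Lemma cone_flow (m : {finite_measure set E -> \bar R}) (theta : E -> R)
    (S : set E) (c : E) (rho D : R) :
  measurable_fun setT theta -> (forall y, `|theta y| <= 1) ->
  (forall y, ~ S y -> theta y = 0) -> 0 < rho -> 0 <= D ->
  (forall y, S y -> `|c - y| <= D) ->
  exists F : E -> E, [/\ integrable_field F,
    forall phi, bounded_lipschitz phi -> pairing F phi =
      (\int[m]_y theta y) * box_mean c rho phi - \int[m]_y (theta y * phi y) &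
    forall (N : set E) (eta : R), measurable N -> 0 <= eta <= 1 ->
      (forall y w t, S y -> Q w -> 0 < t < 1 ->
         N (y + t *: (c + rho *: w - y)) -> t <= eta) ->
      forall i, mass F N i <= (D + rho) * eta * fine (m setT)].
Proof.
move=> mth th1 thS rho0 D0 cD.
have mQ : measurable Q by exact: measurable_unit_box.
have mI : measurable_fun setT (\1_Q : E -> R) by exact: measurable_indic.
pose P := finite_product m U.
pose th (z : E * E) : R := theta z.1 * \1_Q z.2.
pose q (z : E * E) : E := c + rho *: z.2.
have mth' : measurable_fun setT th.
  apply: measurable_funM; first exact: (measurableT_comp mth).
  exact: (measurableT_comp mI).
have mp : measurable_fun setT (fst : E * E -> E) by exact: measurable_fst.
have mq : measurable_fun setT q.
  exact: (measurableT_comp (measurable_affine c rho) measurable_snd).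
have M0 : 0 <= D + rho by rewrite addr_ge0// ltW.
have thM z : `|th z *: (q z - z.1)| <= D + rho.
  have [Sz|/thS th0] := pselect (S z.1); last first.
    by rewrite /th th0 mul0r scale0r normr0.
  rewrite /th indicE; have [/set_mem zQ|zQ] := boolP (z.2 \in Q); last first.
    by rewrite mulr0 scale0r normr0.
  rewrite mulr1 normrZ -[leRHS]mul1r ler_pM// /q addrAC.
  rewrite (le_trans (ler_normD _ _))// lerD ?cD// normrZ gtr0_norm//.
  by rewrite ler_piMr ?(ltW rho0)// unit_box_norm.
(* for a given [y], the point at time [t] is affine in [w] with ratio [t * rho] *)
have law0 (t : R) (N : set E) : 0 < t < 1 -> measurable N -> leb N = 0%E ->
    P [set z | N (z.1 + t *: (q z - z.1))] = 0%E.
  move=> /andP[t0 t1] mN N0.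
  rewrite /P /finite_product /product_measure1 integral0_eq// => y _ /=.
  rewrite -(unif_affine0 ((1 - t) *: y + t *: c) (mulr_gt0 t0 rho0) mN N0).
  congr (unif _); apply/seteqP; split => w; rewrite /xsection /= inE /q /=;
    by congr N; apply/rowP => j; rewrite !mxE; ring.
have [F [mF iF FE FN]] := flow_field mth' mp mq M0 thM law0.
exists F; split => //.
- move=> phi [[k k0 phik] [M phiM]]; rewrite /pairing (FE _ _ k0 phik).
  have mphi : measurable_fun setT phi.
    by apply: continuous_measurable_rV; exact: bounded_slope_continuous k0 phik.
  have mphiq : measurable_fun setT (fun w : E => phi (c + rho *: w)).
    exact: (measurableT_comp mphi (measurable_affine c rho)).
  have moo : (m setT < +oo)%E by rewrite -ge0_fin_numE// fin_num_measure.
  have Uoo : (U setT < +oo)%E by rewrite unifT ltry.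
  have phii : U.-integrable setT (EFin \o (fun w : E => \1_Q w * phi (c + rho *: w))).
    apply: (@integrable_bounded _ _ _ _ _ _ M) => //.
      exact: measurable_funM.
    by move=> w; rewrite normrM -[leRHS]mul1r ler_pM//; exact: indic_bound.
  have Qi : U.-integrable setT (EFin \o (\1_Q : E -> R)) by exact: integrable_indic.
  have U1 : \int[U]_w (\1_Q w : R) = 1.
    by rewrite /Rintegral integral_indic// setIT [X in fine X]unif_unit_box.
  rewrite (@Rintegral_finite_product _ _ _ _ _ _ _ _ (M + M)); last 2 first.
  + apply: measurable_funM => //; apply: measurable_funB.
      exact: (measurableT_comp mphi mq).
    exact: (measurableT_comp mphi mp).
  + move=> z; rewrite normrM -[leRHS]mul1r ler_pM//.
      rewrite /th normrM -[leRHS]mul1r ler_pM//; exact: indic_bound.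
    by rewrite (le_trans (ler_normB _ _))// lerD.
  transitivity (\int[m]_y (theta y * box_mean c rho phi - theta y * phi y)).
    apply: eq_Rintegral => y _.
    transitivity (\int[U]_w (theta y * (\1_Q w * phi (c + rho *: w)) -
        theta y * phi y * \1_Q w)).
      by apply: eq_Rintegral => w _; rewrite /th /q /=; ring.
    rewrite RintegralB//.
    - by rewrite RintegralZl// RintegralZl// U1 mulr1.
    - rewrite (_ : EFin \o _ = fun w => ((theta y)%:E *
        (EFin \o (fun w => \1_Q w * phi (c + rho *: w)%R)%R) w)%E)//.
      exact: integrableZl.
    - rewrite (_ : EFin \o _ = fun w => ((theta y * phi y)%:E * (\1_Q w)%:E)%E)//.
      exact: integrableZl.
  have thi : m.-integrable setT (EFin \o theta).
    exact: (integrable_bounded measurableT moo mth th1).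
  have thphi : m.-integrable setT (EFin \o (fun y => theta y * phi y)).
    apply: (@integrable_bounded _ _ _ _ _ _ M) => //.
      exact: measurable_funM.
    by move=> y; rewrite normrM -[leRHS]mul1r ler_pM.
  rewrite RintegralB// ?RintegralZr//.
  rewrite (_ : EFin \o _ = fun y => ((EFin \o theta) y * (box_mean c rho phi)%:E)%E)//.
  exact: integrableZr.
- move=> N eta mN eta01 Neta i.
  have -> : fine (m setT) = fine (P setT).
    congr fine; rewrite -[in RHS]setXTT [RHS]finite_productX//.
    by rewrite [X in (_ * X)%E]unifT mule1.
  apply: FN => // z t thz t01 Nz; apply: (Neta z.1 z.2) => //.
    by apply: contrapT => /thS th0; move: thz; rewrite /th th0 mul0r eqxx.
  move: thz; rewrite /th indicE; case: (boolP (z.2 \in Q)) => [/set_mem//|_].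
  by rewrite mulr0 eqxx.
Qed.

End cone_flow.

Section compactness.
Context {X : topologicalType}.

(** The sets [A] such that [P] holds on [K] minus [A] form a filter; if [P K]
    failed it would be proper, and the local hypothesis at a cluster point would
    be contradicted. *)
Lemma compact_local_to_global (K : set X) (P : set X -> Prop) :
  compact K -> P set0 -> (forall A B, A `<=` B -> P B -> P A) ->
  (forall A B, P A -> P B -> P (A `|` B)) ->
  (forall x, K x -> exists2 B, nbhs x B & P (K `&` B)) -> P K.
Proof.
move=> cK P0 Psub PU Ploc; apply: contrapT => nPK.
pose F : set_system X := [set A | P (K `\` A)].
have FF : ProperFilter F.
  split; first by rewrite /F /= setD0.
  split => [|A B FA FB|A B AB FA].
  - by rewrite /F /= setDT.
  - by rewrite /F /= setDIr; exact: PU.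
  - by apply: Psub FA; exact: setDS.
have FK : F K by rewrite /F /= setDv.
have [x [Kx Fx]] := cK F FF FK.
have [B xB PB] := Ploc x Kx.
have FB : F (K `&` ~` B).
  apply: Psub PB => y [Ky nKB]; split => //.
  by apply: contrapT => nBy; apply: nKB.
have [y [[_ nBy] By]] := Fx _ _ FB xB.
exact: nBy.
Qed.

End compactness.

Section near_boundary.
Context {R : realType} {n : nat}.
Local Notation E := 'rV[R]_n.
Implicit Types (A B : set E).

Lemma enorm_ge0 (v : E) : 0 <= enorm v. Proof. exact: sqrtr_ge0. Qed.

Lemma eucl_dist_lt B (x : E) (e : R) : B !=set0 ->
  eucl_dist B x < e <-> exists2 y, B y & enorm (x - y) < e.
Proof.
move=> [y0 By0]; have hi : has_inf [set enorm (x - y) | y in B].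
  split; first by exists (enorm (x - y0)), y0.
  by exists 0 => _ [y _ <-]; exact: enorm_ge0.
split=> [xe|[y By xy]].
  have e0 : 0 < e - eucl_dist B x by rewrite subr_gt0.
  have [_ [y By <-]] := inf_adherent e0 hi.
  by rewrite subrKC; exists y.
apply: le_lt_trans xy; apply: ge_inf; first exact: hi.2.
by exists y.
Qed.

Lemma measurable_eucl_nbhd B (e : R) : measurable (eucl_nbhd e B).
Proof.
have [B0|/set0P/negP] := pselect (B !=set0); last first.
  rewrite negbK => /eqP ->.
  have [e0|e0] := ltP 0 e.
    rewrite (_ : eucl_nbhd _ _ = setT)//; apply/seteqP; split => // x _.
    by rewrite /eucl_nbhd /= /eucl_dist image_set0 inf0.
  rewrite (_ : eucl_nbhd _ _ = set0)//; apply/seteqP; split => // x.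
  by rewrite /eucl_nbhd /= /eucl_dist image_set0 inf0 ltNge e0.
apply: open_measurable_rV.
rewrite (_ : eucl_nbhd e B = \bigcup_(y in B) [set x | enorm (x - y) < e]).
  apply: bigcup_open => y _.
  have [e0|e0] := ltP 0 e; last first.
    rewrite (_ : mkset _ = set0); first exact: open0.
    apply/seteqP; split => // x /=; apply/negP; rewrite -leNgt.
    exact: le_trans (enorm_ge0 _).
  have cd : continuous (fun x : E => dotv (x - y) (x - y)).
    rewrite /dotv; apply: continuous_big => [|i _].
      by move=> [u v]; apply: cvgD; [exact: cvg_fst|exact: cvg_snd].
    have ci : continuous (fun x : E => (x - y) 0 i).
      apply: (bounded_slope_continuous (@ltr01 R)) => x z; rewrite mul1r.
      by rewrite !mxE opprB addrA subrK; have := coord_le_norm (x - z) i; rewrite !mxE.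
    by move=> x; have cx := ci x; exact: (cvgM cx cx).
  have xe x : (enorm (x - y) < e) = (dotv (x - y) (x - y) < e ^+ 2).
    rewrite -[in LHS](ger0_norm (ltW e0)) -sqrtr_sqr.
    by rewrite /enorm ltr_sqrt ?exprn_gt0.
  rewrite (_ : mkset _ = (fun x => dotv (x - y) (x - y)) @^-1` [set r | r < e ^+ 2]).
    by apply: open_comp; [move=> x _; exact: cd|exact: open_lt].
  by apply/funext => x; rewrite /= xe.
apply/seteqP; split => x; first by move/(eucl_dist_lt x e B0) => [y]; exists y.
by move=> [y By xy]; apply/(eucl_dist_lt x e B0); exists y.
Qed.

End near_boundary.

Section solvable.
Context {R : realType} {n : nat}.
Local Notation E := 'rV[R]_n.
Local Notation leb := (@lebesgue_rV R n).
Variables (A : set E) (a0 : E) (rho0 : R).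
Local Notation Q := (@unit_box R n).
Local Notation N e := (eucl_nbhd e (topo_boundary A)).

(** The measure [theta * m] on the boundary of [A] is the flux of [Fi] through
    the boundary from the reference box, and [Fo] carries it on to the density
    [g], outside of [A]. *)
Definition is_solution (C eps0 delta : R) (m : {finite_measure set E -> \bar R})
    (theta : E -> R) (Fi Fo : E -> E) (g : E -> R) :=
  [/\ integrable_field Fi /\ integrable_field Fo,
      leb.-integrable setT (EFin \o g) /\
        \int[leb]_(x in thickening (closure A) delta) `|g x| = 0,
      forall phi, bounded_lipschitz phi ->
        pairing Fi phi = \int[m]_y (theta y * phi y) -
          (\int[m]_y theta y) * box_mean a0 rho0 phi /\
        pairing Fo phi = \int[leb]_x (phi x * g x) - \int[m]_y (theta y * phi y),
      forall i, mass Fi (~` A) i = 0 /\ mass Fo (closure A) i = 0 &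
      forall e, 0 < e < eps0 -> forall i,
        mass Fi (N e) i <= C * e * fine (m setT) /\
        mass Fo (N e) i <= C * e * fine (m setT)].

(** The constants have to be uniform in the measure on [S] for the constant of
    the theorem to depend on the domain only. *)
Definition solvable (S : set E) := exists C eps0 delta : R,
  [/\ 0 <= C, 0 < eps0, 0 < delta &
    forall (m : {finite_measure set E -> \bar R}) (theta : E -> R),
      measurable_fun setT theta -> (forall y, `|theta y| <= 1) ->
      (forall y, ~ S y -> theta y = 0) ->
      exists Fi Fo g, is_solution C eps0 delta m theta Fi Fo g].

Hypothesis oA : open A.

Let mcA : measurable (closure A).
Proof.
rewrite -[closure A]setCK; apply: measurableC; apply: open_measurable_rV.
exact/closed_openC/closed_closure.
Qed.

Let mA : measurable A. Proof. exact: open_measurable_rV. Qed.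

Lemma measurable_topo_boundary : measurable (topo_boundary A).
Proof.
by apply: measurableD => //; apply: open_measurable_rV; exact: open_interior.
Qed.

Lemma is_solution_weaken C C' e e' d d' m theta Fi Fo g :
  C <= C' -> e' <= e -> d' <= d ->
  is_solution C e d m theta Fi Fo g -> is_solution C' e' d' m theta Fi Fo g.
Proof.
move=> CC ee dd [fF [ig g0] FE F0 FN]; split => //.
- split => //; apply/eqP; rewrite eq_le Rintegral_ge0// andbT -g0.
  apply: le_Rintegral_subset => //; try exact: measurable_thickening.
    exact: subset_thickening.
  apply: integrable_norm.
  by apply: integrableS ig => //; exact: measurable_thickening.
- move=> r /andP[r0 re] i.
  have [|H1 H2] := FN r _ i; first by rewrite r0 (lt_le_trans re).
  have Cm : C * r * fine (m setT) <= C' * r * fine (m setT).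
    by rewrite !ler_wpM2r ?fine_ge0// ltW.
  by split; [exact: le_trans H1 Cm|exact: le_trans H2 Cm].
Qed.

Lemma is_solutionD C C' e d m (th1 th2 : E -> R) Fi Fo g Gi Go h :
  measurable_fun setT th1 -> (forall y, `|th1 y| <= 1) ->
  measurable_fun setT th2 -> (forall y, `|th2 y| <= 1) ->
  is_solution C e d m th1 Fi Fo g -> is_solution C' e d m th2 Gi Go h ->
  is_solution (C + C') e d m (fun y => th1 y + th2 y)
    (fun x => Fi x + Gi x) (fun x => Fo x + Go x) (fun x => g x + h x).
Proof.
move=> mt1 t1 mt2 t2 [[fFi fFo] [ig g0] FE F0 FN] [[fGi fGo] [ih h0] GE G0 GN].
have moo : (m setT < +oo)%E by rewrite -ge0_fin_numE// fin_num_measure.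
have igh : leb.-integrable setT (EFin \o (fun x => g x + h x)).
  by rewrite (_ : EFin \o _ = (EFin \o g) \+ (EFin \o h))%E//; exact: integrableD.
split.
- by split; exact: integrable_fieldD.
- split => //; apply/eqP; rewrite eq_le Rintegral_ge0// andbT.
  have mT := measurable_thickening (closure A) d.
  have iT (f : E -> R) : leb.-integrable setT (EFin \o f) ->
      leb.-integrable (thickening (closure A) d) (EFin \o (fun x => `|f x|)).
    move=> fi; apply: integrable_norm.
    exact: integrableS fi.
  rewrite -(addr0 0) -{1}g0 -{1}h0 -RintegralD//; try exact: iT.
  apply: le_Rintegral => //.
  + exact: iT.
  + rewrite (_ : EFin \o _ = (EFin \o (fun x => `|g x|%R)) \+
      (EFin \o (fun x => `|h x|%R)))%E//.
    by apply: integrableD => //; exact: iT.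
  + by move=> x _; exact: ler_normD.
- move=> phi phiL; have [[k k0 phik] [M phiM]] := phiL.
  have mphi : measurable_fun setT phi.
    by apply: continuous_measurable_rV; exact: bounded_slope_continuous k0 phik.
  have [FEi FEo] := FE _ phiL; have [GEi GEo] := GE _ phiL.
  have ti (t : E -> R) : measurable_fun setT t -> (forall y, `|t y| <= 1) ->
      m.-integrable setT (EFin \o t).
    by move=> mt tb; exact: (integrable_bounded measurableT moo mt tb).
  have tp (t : E -> R) : measurable_fun setT t -> (forall y, `|t y| <= 1) ->
      m.-integrable setT (EFin \o (fun y => t y * phi y)).
    move=> mt tb; apply: (@integrable_bounded _ _ _ _ _ _ M) => //.
      exact: measurable_funM.
    by move=> y; rewrite normrM -[leRHS]mul1r ler_pM.
  have -> : \int[m]_y (th1 y + th2 y) = \int[m]_y th1 y + \int[m]_y th2 y.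
    by rewrite RintegralD//; exact: ti.
  have -> : \int[m]_y ((th1 y + th2 y) * phi y) =
      \int[m]_y (th1 y * phi y) + \int[m]_y (th2 y * phi y).
    rewrite -RintegralD//; try exact: tp.
    by apply: eq_Rintegral => y _; rewrite mulrDl.
  have pg (f : E -> R) : leb.-integrable setT (EFin \o f) ->
      leb.-integrable setT (EFin \o (fun x => phi x * f x)).
    by move=> fi; exact: (@integrableM_bounded _ _ _ leb setT phi f M).
  have -> : \int[leb]_x (phi x * (g x + h x)) =
      \int[leb]_x (phi x * g x) + \int[leb]_x (phi x * h x).
    rewrite -RintegralD//; try exact: pg.
    by apply: eq_Rintegral => x _; rewrite mulrDr.
  by split; rewrite (pairingD k0 phik)//; [rewrite FEi GEi|rewrite FEo GEo]; ring.
- move=> i; have [Fi0 Fo0] := F0 i; have [Gi0 Go0] := G0 i.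
  by split; apply/eqP; rewrite eq_le mass_ge0 andbT;
    rewrite (le_trans (massD _ _ _ _))// ?Fi0 ?Gi0 ?Fo0 ?Go0 ?addr0//; exact: measurableC.
- move=> r re i; have [Fi0 Fo0] := FN r re i; have [Gi0 Go0] := GN r re i.
  have mN := measurable_eucl_nbhd (topo_boundary A) r.
  by rewrite 2!mulrDl; split; rewrite (le_trans (massD _ _ _ _))// lerD.
Qed.

Lemma solvable0 : solvable set0.
Proof.
exists 0, 1, 1; split => // m theta _ _ th0; exists (fun=> 0), (fun=> 0), (fun=> 0).
have tE y : theta y = 0 by exact: th0.
have z0 d (T : measurableType d) (mu : {measure set T -> \bar R}) (D : set T) :
    \int[mu]_(x in D) (0 : R) = 0.
  by rewrite /Rintegral integral0.
have m0 (B : set E) i : mass (fun=> 0) B i = 0.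
  rewrite /mass -[RHS](z0 _ _ leb B); apply: eq_Rintegral => x _.
  by rewrite mxE normr0.
split.
- by split; exact: integrable_field0.
- split; first by rewrite (_ : EFin \o _ = cst 0%E)//; exact: integrable0.
  rewrite -[RHS](z0 _ _ leb (thickening (closure A) 1)).
  by apply: eq_Rintegral => x _; rewrite normr0.
- move=> phi _; rewrite pairing0.
  have -> : \int[m]_y (theta y * phi y) = 0.
    by rewrite -[RHS](z0 _ _ m setT); apply: eq_Rintegral => y _; rewrite tE mul0r.
  have -> : \int[m]_y theta y = 0.
    by rewrite -[RHS](z0 _ _ m setT); apply: eq_Rintegral => y _.
  have -> : \int[leb]_x (phi x * 0) = 0.
    by rewrite -[RHS](z0 _ _ leb setT); apply: eq_Rintegral => y _; rewrite mulr0.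
  by rewrite mul0r subr0.
- by move=> i; rewrite !m0.
- by move=> e _ i; rewrite !m0 !mul0r.
Qed.

Lemma solvable_subset S T : S `<=` T -> solvable T -> solvable S.
Proof.
move=> ST [C [e [d [C0 e0 d0 H]]]]; exists C, e, d; split => // m th mth th1 thS.
by apply: H => // y nTy; apply: thS => /ST.
Qed.

(** The weight [theta] is split along the measurable set [S]. *)
Lemma solvableU S T : measurable S -> solvable S -> solvable T ->
  solvable (S `|` T).
Proof.
move=> mS [C [e [d [C0 e0 d0 H]]]] [C' [e' [d' [C'0 e'0 d'0 H']]]].
exists (C + C'), (Num.min e e'), (Num.min d d'); split.
- exact: addr_ge0.
- by rewrite lt_min e0.
- by rewrite lt_min d0.
move=> m th mth th1 thST.
pose t1 y := th y * \1_S y; pose t2 y := th y * \1_(~` S) y.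
have mI (B : set E) : measurable B -> measurable_fun setT (\1_B : E -> R).
  by move=> mB; exact: measurable_indic.
have mt1 : measurable_fun setT t1 by apply: measurable_funM => //; exact: mI.
have mt2 : measurable_fun setT t2.
  by apply: measurable_funM => //; apply: mI; exact: measurableC.
have bt (B : set E) y : `|th y * \1_B y| <= 1.
  rewrite normrM -[leRHS]mul1r ler_pM//; exact: indic_bound.
have [|Fi [Fo [g FF]]] := H m t1 mt1 (bt S).
  by move=> y nSy; rewrite /t1 indicE memNset// mulr0.
have [|Gi [Go [h GG]]] := H' m t2 mt2 (bt (~` S)).
  move=> y nTy; rewrite /t2 indicE; have [Sy|nSy] := pselect (S y).
    by rewrite memNset ?mulr0//; apply.
  by rewrite (thST y) ?mul0r// => -[].
exists (fun x => Fi x + Gi x), (fun x => Fo x + Go x), (fun x => g x + h x).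
rewrite (_ : th = fun y => t1 y + t2 y); last first.
  apply/funext => y; rewrite /t1 /t2 -mulrDr -[RHS]/(th y * (\1_S y + \1_(~` S) y)).
  rewrite !indicE; have [Sy|nSy] := pselect (S y).
    by rewrite mem_set// memNset ?addr0 ?mulr1//; apply.
  by rewrite memNset// mem_set// add0r mulr1.
apply: is_solutionD => //.
- exact: (bt S).
- exact: (bt (~` S)).
- by apply: is_solution_weaken FF => //; rewrite ge_min lexx.
- by apply: is_solution_weaken GG => //; rewrite ge_min lexx orbT.
Qed.

(** Near a boundary point, the segments to a box inside the cone above the
    boundary stay inside [A], those to a box in the opposite cone stay outside,
    and both leave the boundary at a speed bounded below; the first box is linked
    to the reference box. *)
Lemma solvable_local x0 : connected A -> lipschitz_boundary A -> 0 < rho0 ->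
  (forall x, `|x - a0| < 2 * rho0 -> A x) -> topo_boundary A x0 ->
  exists2 r, 0 < r & solvable (topo_boundary A `&` ball x0 r).
Proof.
move=> cA lipA rho00 a0A bx0.
have [r [rho [a [b [r0 rho_gt0 Hab]]]]] := boundary_cones oA lipA bx0.
exists r => //; set S := topo_boundary A `&` ball x0 r.
have SP y : S y -> topo_boundary A y /\ `|y - x0| < r.
  by move=> [yA]; rewrite -ball_normE /= distrC.
have aA x : `|x - a| < 2 * rho -> A x.
  move=> xa; have [|||+ _] := Hab x0 (rho^-1 *: (x - a)) 1 bx0.
  - by rewrite subrr normr0.
  - rewrite normrZ gtr0_norm ?invr_gt0// mulrC ler_pdivrMr//; exact: ltW.
  - by rewrite ltr01 lexx.
  by rewrite scalerA divff ?gt_eqF// !scale1r [a + _]addrC subrK addrC subrK.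
(* the ball of radius [t * rho] around a point of a segment stays in the cone:
   the cone condition covers [w] of norm [2], and boxes use norm [1] only *)
have ab_ball y w t z : S y -> Q w -> 0 < t <= 1 ->
    (`|z - (y + t *: (a + rho *: w - y))| < t * rho -> A z) /\
    (`|z - (y + t *: (b + rho *: w - y))| < t * rho -> ~ A z).
  move=> /SP[yA yr] Qw /andP[t0 t1].
  have key c : `|z - (y + t *: (c + rho *: w - y))| < t * rho ->
      exists2 w', `|w'| <= 2 & z = y + t *: (c + rho *: w' - y).
    set q := y + _ => zq; exists (w + (t * rho)^-1 *: (z - q)).
      rewrite (le_trans (ler_normD _ _))// (_ : 2 = 1 + 1 :> R); last by ring.
      rewrite lerD ?(unit_box_norm Qw)// normrZ gtr0_norm ?invr_gt0 ?mulr_gt0//.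
      by rewrite mulrC ler_pdivrMr ?mulr_gt0// mul1r ltW.
    have -> : y + t *: (c + rho *: (w + (t * rho)^-1 *: (z - q)) - y) = q + (z - q).
      have trho : t * rho != 0 by rewrite mulf_neq0// gt_eqF.
      rewrite -[X in q + X](scalerKV trho) /q; apply/rowP => j; rewrite !mxE.
      ring.
    by rewrite addrC subrK.
  have t01 : 0 < t <= 1 by rewrite t0.
  by split => /key[w' w'2 ->]; have [] := Hab y w' t yA yr w'2 t01.
have b_away y w t y' : S y -> Q w -> 0 < t <= 1 -> closure A y' ->
    t * rho <= `|y' - (y + t *: (b + rho *: w - y))|.
  move=> Sy Qw t01 cy'; set q := y + _; rewrite leNgt; apply/negP => y'q.
  have d0 : 0 < t * rho - `|y' - q| by rewrite subr_gt0.
  have [z [Az]] := cy' _ (nbhsx_ballx y' _ d0).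
  rewrite -ball_normE /= ltrBrDr => zy'.
  have [_ /(_ _ Az)] := ab_ball y w t z Sy Qw t01; apply.
  by rewrite (le_lt_trans (ler_distD y' _ _))// distrC.
have a_away y w t y' : S y -> Q w -> 0 < t <= 1 -> ~ A y' ->
    t * rho <= `|y' - (y + t *: (a + rho *: w - y))|.
  move=> Sy Qw t01 ny'; rewrite leNgt; apply/negP => y'q.
  by have [/(_ y'q)] := ab_ball y w t y' Sy Qw t01.
have NP e x : N e x -> exists2 y', topo_boundary A y' & `|y' - x| < e.
  move=> /eucl_dist_lt[|y' By' xy']; first by exists x0.
  by exists y' => //; rewrite distrC (le_lt_trans (norm_le_enorm _)).
pose D := `|a - x0| + `|b - x0| + r.
have D0 : 0 <= D by rewrite !addr_ge0// ltW.
have aD y : S y -> `|a - y| <= D.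
  move=> /SP[_ yr]; rewrite (le_trans (ler_distD x0 _ _))// /D -addrA lerD//.
  by rewrite (distrC x0) ler_wpDl// ltW.
have bD y : S y -> `|b - y| <= D.
  move=> /SP[_ yr]; rewrite (le_trans (ler_distD x0 _ _))// /D addrAC -addrA.
  by rewrite ler_wpDl// addrC lerD// distrC ltW.
have [G [dG [fG dG0 GE G0]]] : linked A a0 rho0 a rho by exact: linked_connected.
have [u [ui uE u0]] := box_mean_density b rho_gt0.
exists ((D + rho) / rho), (Num.min rho dG), rho; split => //.
- by rewrite divr_ge0 ?addr_ge0// ltW.
- by rewrite lt_min rho_gt0.
move=> m th mth th1 thS.
have [F1 [fF1 F1E F1N]] := cone_flow m mth th1 thS rho_gt0 D0 aD.
have [F2 [fF2 F2E F2N]] := cone_flow m mth th1 thS rho_gt0 D0 bD.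
pose c := \int[m]_y th y.
exists (fun x => (-1) *: F1 x + c *: G x), F2, (fun x => c * u x).
have fF1' := integrable_fieldZ (-1) fF1; have fG' := integrable_fieldZ c fG.
have tle (t : R) : 0 < t < 1 -> 0 < t <= 1 by move=> /andP[-> /ltW].
have mcA' := mcA.
have Fi_mass B i : measurable B -> B `<=` thickening (~` A) dG ->
    mass (fun x => (-1) *: F1 x + c *: G x) B i <= mass F1 B i.
  move=> mB BG; rewrite (le_trans (massD _ _ _ _))// !massZ//.
  rewrite (mass_eq0 mB (measurable_thickening _ _) BG fG (G0 i)) mulr0 addr0.
  by rewrite normrN1 mul1r.
split.
- by split => //; exact: integrable_fieldD.
- split.
    rewrite (_ : EFin \o _ = (fun x => c%:E * (EFin \o u) x)%E)//.
    exact: integrableZl.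
  have T0 : \int[leb]_(x in thickening (closure A) rho) `|u x| = 0.
    apply: u0; first exact: measurable_thickening.
    move=> w Qw [y' cy' y'q].
    have Sx0 : S x0 by split => //; exact: ballxx.
    have := b_away x0 w 1 y' Sx0 Qw _ cy'.
    rewrite ltr01 lexx scale1r mul1r [x0 + _]addrC subrK leNgt distrC y'q.
    by move=> /(_ isT).
  have mT := measurable_thickening (closure A) rho.
  transitivity (\int[leb]_(x in thickening (closure A) rho) (`|c| * `|u x|)).
    by apply: eq_Rintegral => x _; rewrite normrM.
  rewrite RintegralZl ?T0 ?mulr0//; apply: integrable_norm.
  exact: integrableS ui.
- move=> phi phiL; have [[k k0 phik] [M phiM]] := phiL.
  have mphi : measurable_fun setT phi.
    by apply: continuous_measurable_rV; exact: bounded_slope_continuous k0 phik.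
  rewrite (pairingD k0 phik)// !(pairingZ _ k0 phik)// F1E// F2E// GE//.
  split; first by rewrite /c; ring.
  congr (_ - _); rewrite -(uE phi M)// -RintegralZl//; last first.
    exact: (@integrableM_bounded _ _ _ leb setT phi u M).
  by apply: eq_Rintegral => x _; rewrite /= mulrCA.
- have zero01 : 0 <= (0 : R) <= 1 by rewrite lexx ler01.
  move=> i; split; apply/eqP; rewrite eq_le mass_ge0 andbT.
    rewrite (le_trans (Fi_mass _ _ _ _))//; first exact: measurableC.
      by move=> x nAx; exists x => //; rewrite subrr normr0.
    have := F1N (~` A) 0 (measurableC mA) zero01; rewrite mulr0 mul0r; apply.
    move=> y w t Sy Qw /tle t01 /(a_away _ _ _ _ Sy Qw t01).
    by rewrite subrr normr0 pmulr_lle0.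
  have := F2N (closure A) 0 mcA' zero01; rewrite mulr0 mul0r; apply.
  move=> y w t Sy Qw /tle t01 /(b_away _ _ _ _ Sy Qw t01).
  by rewrite subrr normr0 pmulr_lle0.
- move=> e /andP[e0]; rewrite lt_min => /andP[erho eG] i.
  have mN := measurable_eucl_nbhd (topo_boundary A) e.
  have eta01 : 0 <= e / rho <= 1.
    by rewrite divr_ge0 ?(ltW e0) ?(ltW rho_gt0)//= ler_pdivrMr// mul1r ltW.
  have -> : (D + rho) / rho * e = (D + rho) * (e / rho) by ring.
  split.
    rewrite (le_trans (Fi_mass _ _ _ _))//.
      move=> x /NP[y' By' y'x]; exists y'; first exact: boundary_notin.
      by rewrite distrC (lt_trans y'x).
    apply: F1N => // y w t Sy Qw /tle t01 /NP[y' By' y'q].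
    rewrite ler_pdivlMr//.
    by rewrite (le_trans (a_away _ _ _ _ Sy Qw t01 (boundary_notin oA By')))// ltW.
  apply: F2N => // y w t Sy Qw /tle t01 /NP[y' By' y'q].
  rewrite ler_pdivlMr//.
  by rewrite (le_trans (b_away _ _ _ _ Sy Qw t01 By'.1))// ltW.
Qed.

Lemma solvable_boundary : connected A -> bounded_set A -> lipschitz_boundary A ->
  0 < rho0 -> (forall x, `|x - a0| < 2 * rho0 -> A x) ->
  solvable (topo_boundary A).
Proof.
move=> cA bA lipA rho00 a0A.
(* the sets are enlarged to measurable ones, as needed for unions *)
pose P S := exists S', [/\ measurable S', S `<=` S' & solvable S'].
suff [S' [_ SS' S'P]] : P (topo_boundary A) by exact: solvable_subset S'P.
apply: compact_local_to_global.
- apply: bounded_closed_compact.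
    have [M [Mr HM]] := bA; exists (M + 2); split; first exact: realD.
    move=> M' MM' y By /=; have [x Ax xy] := boundary_meets ltr01 By.
    have /= xM := HM (M + 1) ltac:(by rewrite ltrDl) x Ax.
    rewrite -[y](subrK x) (le_trans (ler_normD _ _))// distrC.
    by rewrite (le_trans (lerD (ltW xy) xM))//; move: MM'; lra.
  rewrite /topo_boundary setDE; apply: closedI; first exact: closed_closure.
  by apply: open_closedC; exact: open_interior.
- by exists set0; split => //; exact: solvable0.
- by move=> S T ST [S' [mS' TS' PS']]; exists S'; split => //; exact: subset_trans TS'.
- move=> S T [S' [mS' SS' PS']] [T' [mT' TT' PT']]; exists (S' `|` T'); split.
  + exact: measurableU.
  + exact: setUSS.
  + exact: solvableU.
- move=> x bx; have [r r0 Pr] := solvable_local cA lipA rho00 a0A bx.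
  exists (ball x r); first exact: nbhsx_ballx.
  exists (topo_boundary A `&` ball x r); split => //.
  apply: measurableI; first exact: measurable_topo_boundary.
  by apply: open_measurable_rV; exact: ball_open.
Qed.

End solvable.

(** * Test functions *)

Section test_functions.
Context {R : realType} {n : nat}.
Local Notation E := 'rV[R]_n.
Implicit Types phi : E -> R.

(** Coordinates are changed one at a time, and the mean value theorem bounds each
    step. *)
Lemma partial_bound_slope phi (K : R) : 0 <= K ->
  (forall i x, derivable phi x (delta_mx 0 i : E)) ->
  (forall i x, `|partial i phi x| <= K) -> bounded_slope (n%:R * K) phi.
Proof.
move=> K0 dphi phiK.
have step_ge0 i (x : E) (t : R) : 0 <= t ->
    `|phi (x + t *: delta_mx 0 i) - phi x| <= K * t.
  move=> t0.
  have dl (s : R) : is_derive s 1 (fun u => phi (x + u *: delta_mx 0 i))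
      (partial i phi (x + s *: delta_mx 0 i)).
    by apply/is_derive_line; exact: derivableP.
  have [|c _] := @MVT_segment _ _ _ 0 t t0 (fun s _ => dl s).
    by apply: derivable_within_continuous => s _; exact: ex_derive.
  rewrite scale0r addr0 subr0 => ->.
  by rewrite normrM (ger0_norm t0) ler_wpM2r.
have step i (x : E) (t : R) :
    `|phi (x + t *: delta_mx 0 i) - phi x| <= K * `|t|.
  have [t0|t0] := leP 0 t; first by rewrite (ger0_norm t0) step_ge0.
  rewrite (ltr0_norm t0) distrC.
  have := @step_ge0 i (x + t *: delta_mx 0 i) (- t).
  by rewrite scaleNr addrK oppr_ge0 => ->//; exact: ltW.
move=> x y.
pose z (j : nat) : E := \row_i (if (i < j)%N then x 0 i else y 0 i).
have zj (j : nat) : (j <= n)%N -> `|phi (z j) - phi y| <= j%:R * (K * `|x - y|).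
  elim: j => [|j IHj] jn.
    have -> : z 0%N = y by apply/rowP => i; rewrite mxE.
    by rewrite subrr normr0 mul0r.
  have zS : z j.+1 = z j + (x - y) 0 (Ordinal jn) *: delta_mx 0 (Ordinal jn).
    apply/rowP => i; have [ij|ij] := eqVneq (i : nat) j.
      have -> : i = Ordinal jn by exact/val_inj.
      by rewrite !mxE !eqxx ltnSn ltnn mulr1 subrKC.
    by rewrite !mxE eqxx -val_eqE /= (negbTE ij) mulr0 addr0 ltnS leq_eqVlt (negbTE ij).
  rewrite (le_trans (ler_distD (phi (z j)) _ _))//.
  rewrite [leRHS](_ : _ = K * `|x - y| + j%:R * (K * `|x - y|)); last first.
    by rewrite -natr1; ring.
  rewrite lerD ?IHj//; last exact: ltnW.
  by rewrite zS (le_trans (step _ _ _))// ler_wpM2l// coord_le_norm.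
have -> : phi x = phi (z n).
  by congr phi; apply/rowP => i; rewrite mxE ltn_ord.
by rewrite -mulrA; exact: zj.
Qed.

Lemma compact_support_bounded (K : set E) (f : E -> R) : compact K ->
  continuous f -> (forall x, ~ K x -> f x = 0) ->
  exists2 M : R, 0 <= M & forall x, `|f x| <= M.
Proof.
move=> cK cf fK; have cfK : {within K, continuous f} by exact: continuous_subspaceT.
have [M [_ HM]] := compact_bounded (continuous_compact cfK cK).
exists (`|M| + 1); first by rewrite addr_ge0.
move=> x; have [Kx|nKx] := pselect (K x); last by rewrite fK// normr0 addr_ge0.
apply: (HM (`|M| + 1)); last by exists x.
by rewrite (le_lt_trans (ler_norm M))// ltrDl.
Qed.

Lemma notin_tsupport phi x : ~ tsupport phi x -> phi x = 0.
Proof.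
move=> nx; apply: contrapT => /eqP phix; apply: nx.
exact: subset_closure.
Qed.

Lemma partial_notin_tsupport phi i x : ~ tsupport phi x -> partial i phi x = 0.
Proof.
move=> nx; have : nbhs x (~` tsupport phi).
  apply: open_nbhs_nbhs; split => //.
  by apply: closed_openC; exact: closed_closure.
move=> xU; rewrite /partial -[RHS](derive_cst (0 : R) x (delta_mx 0 i : E)).
apply: near_eq_derive.
by apply: filterS xU => y /notin_tsupport.
Qed.

Lemma test_function_bounded_lipschitz phi :
  test_function phi -> bounded_lipschitz phi.
Proof.
move=> [phik cphi].
have [cont H1] := phik 1%N.
have [M _ phiM] := compact_support_bounded cphi cont (@notin_tsupport phi).
have /choice[B HB] i : exists B : R, 0 <= B /\ forall x, `|partial i phi x| <= B.
  have [_ [ci _]] := H1 i.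
  have [B B0 HB] := compact_support_bounded cphi ci (@partial_notin_tsupport phi i).
  by exists B.
pose K := \sum_i B i.
have BK i : B i <= K.
  by rewrite /K (bigD1 i)//= lerDl sumr_ge0// => j _; have [] := HB j.
have K0 : 0 <= K by rewrite sumr_ge0// => i _; have [] := HB i.
split; last by exists M.
have phin : bounded_slope (n%:R * K) phi.
  apply: partial_bound_slope => // i x; first by have [] := H1 i.
  by have [_ HBi] := HB i; exact: le_trans (HBi x) _.
exists (n%:R * K + 1); first by rewrite ltr_wpDl// mulr_ge0.
by move=> x y; rewrite (le_trans (phin x y))// ler_wpM2r// lerDl.
Qed.

End test_functions.

(** * Assembling the field *)

Section null_parts.
Context {R : realType} {n : nat}.
Local Notation E := 'rV[R]_n.
Local Notation leb := (@lebesgue_rV R n).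

Lemma Rintegral_mul_null (g psi : E -> R) (B : set E) (M : R) : measurable B ->
  leb.-integrable setT (EFin \o g) -> measurable_fun setT psi ->
  (forall x, `|psi x| <= M) -> \int[leb]_(x in B) `|g x| = 0 ->
  \int[leb]_(x in B) (psi x * g x) = 0.
Proof.
move=> mB ig mpsi psiM g0.
have ipg : leb.-integrable B (EFin \o (fun x => psi x * g x)).
  exact: integrableM_bounded ig mpsi psiM.
have ig' : leb.-integrable B (EFin \o (fun x => `|g x|)).
  by apply: integrable_norm; exact: integrableS ig.
apply/eqP; rewrite -normr_le0 (le_trans (le_normr_Rintegral mB ipg))//.
rewrite -(mulr0 M) -g0 -RintegralZl//; apply: le_Rintegral => //.
- exact: integrable_norm.
- rewrite (_ : EFin \o _ = (fun x => M%:E * (EFin \o (fun x => `|g x|%R)) x)%E)//.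
  exact: integrableZl.
- by move=> x _; rewrite normrM ler_wpM2r.
Qed.

Lemma pairing_null (F : E -> E) (phi : E -> R) (k : R) (B : set E) :
  0 < k -> bounded_slope k phi -> measurable B -> integrable_field F ->
  (forall i, mass F B i = 0) -> \int[leb]_(x in B) dotv (F x) (grad phi x) = 0.
Proof.
move=> k0 phik mB fF F0.
transitivity (\int[leb]_(x in B) \sum_(i < n) (partial i phi x * F x 0 i)).
  by apply: eq_Rintegral => x _; apply: eq_bigr => i _; rewrite mxE mulrC.
rewrite Rintegral_sum//.
  apply: big1 => i _; apply: (@Rintegral_mul_null (fun x => F x 0 i) _ _ k) => //.
  - exact: fF.2.
  - exact: measurable_derive phik _.
  - by move=> x; exact: partial_bound.
  - exact: F0.
move=> i; apply: (@integrableM_bounded _ _ _ leb B (partial i phi)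
  (fun x => F x 0 i) k) => //.
- exact: fF.2.
- exact: measurable_derive phik _.
- by move=> x; exact: partial_bound.
Qed.

Lemma Rintegral_setC (f : E -> R) (B : set E) : measurable B ->
  leb.-integrable setT (EFin \o f) ->
  \int[leb]_x f x = \int[leb]_(x in B) f x + \int[leb]_(x in ~` B) f x.
Proof.
move=> mB fi; rewrite -{1}(setUv B) Rintegral_setU ?setUv//.
  exact: measurableC.
by apply/disj_set2P; rewrite setICr.
Qed.

Lemma integral_enorm_le (F : E -> E) (B : set E) : measurable B ->
  integrable_field F ->
  (\int[leb]_(x in B) (enorm (F x))%:E <= (\sum_i mass F B i)%:E)%E.
Proof.
move=> mB fF.
have iB i : leb.-integrable B (EFin \o (fun x => `|F x 0 i|)).
  exact: integrable_mass.
have mc i : measurable_fun setT (fun x => F x 0 i).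
  by apply/measurable_EFinP; exact: measurable_int (fF.2 i).
have mE : measurable_fun setT (fun x => enorm (F x)).
  apply: (measurableT_comp (continuous_measurable_fun (@sqrt_continuous R))).
  by apply: measurable_sum => i; exact: measurable_funM.
have -> : (\sum_i mass F B i)%:E = (\int[leb]_(x in B) (\sum_i `|F x 0%R i|)%:E)%E.
  rewrite /mass -Rintegral_sum// /Rintegral fineK//.
  apply: integrable_fin_num => //.
  rewrite (_ : (fun _ => _) =
      (fun x => \sum_i (EFin \o (fun x => `|F x 0%R i|%R)) x)%E).
    by apply: integrable_sum => // i _; exact: iB.
  by apply/funext => x; rewrite /= sumEFin.
apply: ge0_le_integral => //.
- by move=> x _; rewrite lee_fin enorm_ge0.
- by apply/measurable_EFinP; exact: measurable_funTS.
- apply/measurable_EFinP; apply: measurable_funTS; apply: measurable_sum => i.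
  exact: measurableT_comp.
- by move=> x _; rewrite lee_fin enorm_le_sum.
Qed.

End null_parts.


Lemma concentrated_tv d (T : measurableType d) (R : realType)
    (s : {charge set T -> \bar R}) (B : set T) : measurable B ->
  concentrated_on s B -> charge_tv s (~` B) = 0%E.
Proof.
move=> mB sB; rewrite /charge_tv; case: (hahn_ex s) => -[P N] /= PN.
have [[mP _] [mN _] _ _] := PN.
have sC A : measurable A -> s (~` B `&` A) = 0%E.
  move=> mA; apply: sB; first by apply: measurableI => //; exact: measurableC.
  by rewrite setIAC setICl set0I.
rewrite /charge_variation jordan_posE cjordan_posE jordan_negE cjordan_negE.
rewrite /crestr0 mem_set; last exact: measurableC.
by rewrite /crestr !sC// oppe0 adde0.
Qed.

Theorem theorem1p2 (R : realType) (n : nat) (n_ge2 : (2 <= n)%N)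
    (Omega : set 'rV[R]_n) (Omega_lip : bounded_lipschitz_domain Omega) :
  exists C : R,
  forall s : {charge set 'rV[R]_n -> \bar R},
  concentrated_on s (topo_boundary Omega) ->
  let solution (F : 'rV[R]_n -> 'rV[R]_n)
      (divF : {charge set 'rV[R]_n -> \bar R}) :=
    [/\ L1_field F,
        distributional_divergence F divF /\ L1_charge divF,
        (limf_esup (boundary_mean F Omega) 0^'+
           <= C%:E * charge_tv s (topo_boundary Omega))%E /\
        (C%:E * charge_tv s (topo_boundary Omega) < +oo)%E &
        normal_trace_eq F divF Omega s] in
  (exists F divF, solution F divF) /\
  (s (topo_boundary Omega) = 0%E ->
   exists F divF, solution F divF /\
     exists U : set 'rV[R]_n,
       [/\ open U, closure Omega `<=` U & divergence_free_in U F]).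
Proof.
have [[a Aa] oA cA bA lipA] := Omega_lip.
set bd := topo_boundary Omega.
have mbd : measurable bd by exact: measurable_topo_boundary.
have mO : measurable Omega by exact: open_measurable_rV.
have mcO : measurable (closure Omega).
  rewrite -[closure Omega]setCK; apply: measurableC; apply: open_measurable_rV.
  exact/closed_openC/closed_closure.
have [rho rho0 aA] : exists2 rho : R, 0 < rho &
    forall x, `|x - a| < 2 * rho -> Omega x.
  have /nbhs_ballP[r /= r0 rA] : nbhs a Omega by exact: open_nbhs_nbhs.
  exists (r / 2) => [|x]; first by rewrite divr_gt0.
  rewrite mulrC divfK// => xa; apply: rA.
  by rewrite -ball_normE /= distrC.
have [C [e0 [d0 [C0 e00 d00 H]]]] := solvable_boundary oA cA bA lipA rho0 aA.
exists (n%:R * C) => s sB sol.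
have [m [theta0 [mth0 th01 mE sE]]] := charge_polar s.
pose theta x := theta0 x * \1_bd x.
have mth : measurable_fun setT theta.
  by apply: measurable_funM => //; exact: measurable_indic.
have th1 x : `|theta x| <= 1.
  by rewrite normrM -[leRHS]mul1r ler_pM//; exact: indic_bound.
have thbd x : ~ bd x -> theta x = 0.
  by move=> nx; rewrite /theta indicE memNset// mulr0.
have [Fi [Fo [g [[fFi fFo] [ig g0] FE F0 FN]]]] := H m theta mth th1 thbd.
have [u [iu uE u0]] := box_mean_density a rho0.
pose c := \int[m]_y theta y.
pose F x := Fi x + Fo x.
have fF : integrable_field F by exact: integrable_fieldD.
(* the density of the divergence: the total charge [c], spread uniformly over the
   reference box, enters there, and [g] is where the outer field ends *)
pose h x := c * u x - g x.
have icu : (@lebesgue_rV R n).-integrable setT (EFin \o (fun x => c * u x)).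
  rewrite (_ : EFin \o _ = (fun x => c%:E * (EFin \o u) x)%E)//.
  exact: integrableZl.
have ih : (@lebesgue_rV R n).-integrable setT (EFin \o h).
  rewrite (_ : EFin \o h = (EFin \o (fun x => (c * u x)%R)) \- (EFin \o g))%E//.
  exact: integrableB.
pose divF : {charge set 'rV[R]_n -> \bar R} := induced_charge ih.
have divFE D phi : measurable D -> bounded_lipschitz phi ->
    charge_integral divF D phi =
    c * \int[@lebesgue_rV R n]_(x in D) (phi x * u x) -
    \int[@lebesgue_rV R n]_(x in D) (phi x * g x).
  move=> mD [[k k0 phik] [M phiM]].
  have mphi : measurable_fun setT phi.
    by apply: continuous_measurable_rV; exact: bounded_slope_continuous k0 phik.
  rewrite (@charge_integral_density _ _ _ _ divF h ih _ D phi M)//.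
  have ip := integrableM_bounded mD _ mphi phiM.
  rewrite -RintegralZl//; last exact: ip.
  rewrite -RintegralB//; last 2 first.
  - rewrite (_ : EFin \o _ =
        (fun x => c%:E * (EFin \o (fun x => (phi x * u x)%R)) x)%E)//.
    by apply: integrableZl => //; exact: ip.
  - exact: ip.
  by apply: eq_Rintegral => x _; rewrite /h /= mulrBr mulrCA.
have uEphi phi : bounded_lipschitz phi ->
    \int[@lebesgue_rV R n]_x (phi x * u x) = box_mean a rho phi.
  move=> [[k k0 phik] [M phiM]]; apply: (uE _ M) => //.
  by apply: continuous_measurable_rV; exact: bounded_slope_continuous k0 phik.
have FEphi phi : bounded_lipschitz phi ->
    pairing F phi = - charge_integral divF setT phi.
  move=> phiL; have [[k k0 phik] _] := phiL; have [FiE FoE] := FE _ phiL.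
  by rewrite (pairingD k0 phik)// FiE FoE divFE// uEphi// /c; ring.
have thE psi : \int[m]_y (theta y * psi y) = \int[m]_(y in bd) (psi y * theta0 y).
  rewrite [RHS]Rintegral_mkcond; apply: eq_Rintegral => y _.
  rewrite patchE /theta indicE; case: ifPn => _; first by rewrite mulr1 mulrC.
  by rewrite mulr0 mul0r.
have moo : (m setT < +oo)%E by rewrite -ge0_fin_numE// fin_num_measure.
have thi : m.-integrable setT (EFin \o theta0).
  exact: (integrable_bounded measurableT moo mth0 th01).
have mbdE : m setT = charge_tv s bd.
  rewrite -mE// -(setUv bd) measureU ?setICr//; last exact: measurableC.
  by rewrite [X in (_ + X)%E]mE ?concentrated_tv ?adde0//; exact: measurableC.
have solF : sol F divF.
  split.
  - split; first by have [] := fF.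
    rewrite (le_lt_trans (integral_enorm_le measurableT fF))//.
    by rewrite ltry.
  - split; last by exists h.
    move=> phi phit; have phiL := test_function_bounded_lipschitz phit.
    by rewrite -/(pairing F phi) FEphi.
  - rewrite -mbdE -[m setT]fineK ?fin_num_measure//; split; last by rewrite -EFinM ltry.
    rewrite limf_esupE; apply: (@le_trans _ _ (ereal_sup
        (boundary_mean F Omega @` [set e | 0 < e < e0]))).
      apply: ereal_inf_lbound; exists [set e | 0 < e < e0] => //.
      near=> e; rewrite /=; apply/andP; split; first by near: e; exact: nbhs_right_gt.
      by near: e; exact: nbhs_right_lt.
    apply: ge_ereal_sup => _ [e /= ee <-]; rewrite /boundary_mean.
    have /andP[e_gt0 _] := ee.
    have mN := measurable_eucl_nbhd bd e.
    have FNi i : mass F (eucl_nbhd e bd) i <= 2 * (C * e * fine (m setT)).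
      have [Fie Foe] := FN e ee i.
      by rewrite (le_trans (massD _ _ _ _))// mulr_natl lerD.
    apply: (le_trans (lee_wpmul2l _ (integral_enorm_le mN fF))).
      by rewrite lee_fin invr_ge0 mulr_ge0// ltW.
    rewrite -!EFinM lee_fin.
    apply: (@le_trans _ _ ((2 * e)^-1 * \sum_(i < n) (2 * (C * e * fine (m setT))))).
      apply: ler_wpM2l; first by rewrite invr_ge0 mulr_ge0// ltW.
      by apply: ler_sum => i _; exact: FNi.
    rewrite sumr_const card_ord -mulr_natr le_eqVlt; apply/orP; left; apply/eqP.
    by field; rewrite gt_eqF.
  - move=> phi [M [_ phiM]] /lipschitz_bounded_slope[k k0 phik].
    have phiL : bounded_lipschitz phi.
      split; first by exists k.
      by exists (M + 1) => x; apply: (phiM (M + 1)) => //; rewrite ltrDl.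
    have mphi : measurable_fun setT phi.
      by apply: continuous_measurable_rV; exact: bounded_slope_continuous k0 phik.
    have [_ [M' phiM']] := phiL.
    have gO : \int[@lebesgue_rV R n]_(x in Omega) `|g x| = 0.
      apply/eqP; rewrite eq_le Rintegral_ge0// andbT -g0.
      apply: le_Rintegral_subset => //; first exact: measurable_thickening.
        move=> x Ox; exists x; first exact: subset_closure.
        by rewrite subrr normr0.
      apply: integrable_norm; apply: integrableS ig => //.
      exact: measurable_thickening.
    have uO : \int[@lebesgue_rV R n]_(x in ~` Omega) `|u x| = 0.
      apply: u0 => [|w Qw]; first exact: measurableC.
      apply; apply: aA; rewrite addrC addKr normrZ gtr0_norm//.
      rewrite (@le_lt_trans _ _ (rho * 1))//.
        by rewrite ler_wpM2l ?unit_box_norm// ltW.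
      by rewrite mulr1 ltr_pMl// ltr1n.
    (* [u] vanishes outside of [Omega] and [g] inside, and [Fi] and [Fo] likewise, so
       that the trace on [Omega] is the pairing with [Fi] alone *)
    rewrite /normal_trace divFE// (Rintegral_mul_null mO ig mphi phiM' gO) subr0.
    have uOE : \int[@lebesgue_rV R n]_(x in Omega) (phi x * u x) = box_mean a rho phi.
      rewrite -uEphi// [RHS](Rintegral_setC mO); last first.
        exact: integrableM_bounded mphi phiM'.
      by rewrite (Rintegral_mul_null (measurableC mO) iu mphi phiM' uO) addr0.
    rewrite uOE (@charge_integral_density _ _ _ m s theta0 thi sE _ _ M')// -thE.
    have [FiE _] := FE _ phiL.
    have -> : \int[@lebesgue_rV R n]_(x in Omega) dotv (F x) (grad phi x) =
        pairing Fi phi.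
      have iOS G : integrable_field G -> (@lebesgue_rV R n).-integrable Omega
          (EFin \o (fun x => dotv (G x) (grad phi x))).
        by move=> fG; apply: integrableS (integrable_pairing k0 phik fG).
      transitivity (\int[@lebesgue_rV R n]_(x in Omega) dotv (Fi x) (grad phi x) +
          \int[@lebesgue_rV R n]_(x in Omega) dotv (Fo x) (grad phi x)).
        rewrite -RintegralD//; try exact: iOS.
        apply: eq_Rintegral => x _; rewrite /dotv -big_split/=.
        by apply: eq_bigr => i _; rewrite mxE mulrDl.
      rewrite /pairing [RHS](Rintegral_setC mO); last exact: integrable_pairing phik fFi.
      rewrite (pairing_null k0 phik mO fFo); last first.
        move=> i; apply: (mass_eq0 mO mcO _ fFo (F0 i).2).
        exact: subset_closure.
      rewrite (pairing_null k0 phik (measurableC mO) fFi)// => i.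
      exact: (F0 i).1.
    by rewrite FiE /c; ring.
split; first by exists F, divF.
move=> s0; exists F, divF; split => //.
exists (thickening (closure Omega) d0); split.
- exact: open_thickening.
- by move=> x cx; exists x => //; rewrite subrr normr0.
move=> phi phit phiU.
have phiL := test_function_bounded_lipschitz phit.
have c0 : c = 0.
  rewrite /c; transitivity (\int[m]_y (theta y * 1)).
    by apply: eq_Rintegral => y _; rewrite mulr1.
  rewrite (thE (fun=> 1)); transitivity (\int[m]_(y in bd) theta0 y).
    by apply: eq_Rintegral => y _; rewrite mul1r.
  by rewrite /Rintegral -sE// s0.
rewrite -/(pairing F phi) FEphi// divFE// c0 mul0r sub0r opprK.
have [[k k0 phik] [M phiM]] := phiL.
have mphi : measurable_fun setT phi.
  by apply: continuous_measurable_rV; exact: bounded_slope_continuous k0 phik.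
have mT := measurable_thickening (closure Omega) d0.
rewrite (Rintegral_setC mT); last exact: integrableM_bounded mphi phiM.
rewrite (Rintegral_mul_null mT ig mphi phiM g0) add0r.
transitivity (\int[@lebesgue_rV R n]_(x in ~` thickening (closure Omega) d0) (0 : R)).
  apply: eq_Rintegral => x /set_mem nTx; rewrite notin_tsupport ?mul0r//.
  by move/phiU.
by rewrite /Rintegral integral0.
Unshelve. all: by end_near.
Qed.
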